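(* Let $d\ge1$ and let $A_1,\dots,A_k\in\mathrm{SO}(d+1)$ generate a dense subgroup of $\mathrm{SO}(d+1)$. Then for any $A_0\in\mathrm{SL}(d+1,\mathbb R)\setminus\mathrm{SO}(d+1)$, the natural action on $\mathbb S^d$ of the group generated by $\{A_0,A_1,\dots,A_k\}$ is $\mathcal C^1$-stably ergodic in $\mathrm{Diff}^{1+\alpha}(\mathbb S^d)$ and $\mathcal C^1$-robustly minimal.
   Context: The action of $A\in\mathrm{SL}(d+1,\mathbb R)$ on $\mathbb S^d$ is $f_A(x)=Ax/|Ax|$. $\mathcal C^1$-stably ergodic in $\mathrm{Diff}^{1+\alpha}$: for all $\mathcal C^{1+\alpha}$ diffeomorphisms $\tilde f_0,\dots,\tilde f_k$ $\mathcal C^1$-close to $f_{A_0},\dots,f_{A_k}$, the group they generate acts ergodically w.r.t. Lebesgue (invariant measurable sets have zero or full measure). $\mathcal C^1$-robustly minimal: for all $\mathcal C^1$ diffeomorphisms $\mathcal C^1$-close to them, every orbit of the generated group is dense. *)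

(* Defs.v *)
From HB Require Import structures.
From mathcomp Require Import all_boot all_order all_algebra.
From mathcomp Require Import all_classical all_reals all_analysis.
Set Implicit Arguments. Unset Strict Implicit. Unset Printing Implicit Defensive.
Import Order.TTheory GRing.Theory Num.Theory.
Import numFieldNormedType.Exports.
Local Open Scope classical_set_scope.
Local Open Scope ring_scope.

Section Defs.
Variable R : realType.
Variable n : nat.
Local Notation V := 'cV[R]_n.+1.

Definition enorm (x : V) : R := Num.sqrt (\sum_i (x i ord0) ^+ 2).

Definition sphere : set V := [set x | enorm x = 1].

Definition fA (A : 'M[R]_n.+1) (x : V) : V := (enorm (A *m x))^-1 *: (A *m x).

Definition rad (f : V -> V) (x : V) : V := f ((enorm x)^-1 *: x).

(* C^1 map of the sphere: its radial extension is C^1 on R^{n+1}\{0} *)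
Definition C1map (f : V -> V) : Prop :=
  forall x : V, x != 0 ->
    differentiable (rad f) x /\
    forall v : V, {for x, continuous (fun y : V => 'D_v (rad f) y)}.

Definition Diff1 (f : V -> V) : Prop :=
  C1map f /\ (forall x, sphere x -> sphere (f x)) /\
  exists g : V -> V, C1map g /\ (forall x, sphere x -> sphere (g x)) /\
    (forall x, sphere x -> g (f x) = x /\ f (g x) = x).

Definition Hoelder_deriv (alpha : R) (f : V -> V) : Prop :=
  exists C : R, forall x y v : V, sphere x -> sphere y -> enorm v <= 1 ->
    enorm ('D_v (rad f) x - 'D_v (rad f) y) <= C * (enorm (x - y)) `^ alpha.

Definition C1close (eps : R) (f g : V -> V) : Prop :=
  forall x : V, sphere x ->
    enorm (f x - g x) < eps /\
    forall v : V, enorm v <= 1 -> enorm ('D_v (rad f) x - 'D_v (rad g) x) < eps.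

Definition box (a b : V) : set V := [set x | forall i, a i ord0 <= x i ord0 <= b i ord0].
Definition boxvol (a b : V) : R := \prod_i Num.max 0 (b i ord0 - a i ord0).
Definition lnull (E : set V) : Prop :=
  forall eps : R, 0 < eps -> exists a b : nat -> V,
    E `<=` \bigcup_m box (a m) (b m) /\
    forall N, \sum_(m < N) boxvol (a m) (b m) <= eps.
Definition borel (B : set V) : Prop := <<s [set U : set V | open U] >> B.
Definition lmeasurable (E : set V) : Prop :=
  exists B, borel B /\ lnull ((E `\` B) `|` (B `\` E)).

(* Lebesgue (surface) measure class on the sphere via cones *)
Definition cone (A : set V) : set V :=
  [set y | exists t x, 0 < t <= 1 /\ A x /\ y = t *: x].
Definition snull (A : set V) : Prop := lnull (cone A).
Definition smeasurable (A : set V) : Prop := lmeasurable (cone A).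

Section Family.
Variable I : Type.
Variable F : I -> V -> V.

(* ergodicity of the group generated by the F i (bijections of the sphere) *)
Definition invariant (A : set V) : Prop :=
  forall i x, sphere x -> (A (F i x) <-> A x).
Definition ergodic : Prop :=
  forall A : set V, A `<=` sphere -> smeasurable A -> invariant A ->
    snull A \/ snull (sphere `\` A).

Definition orbit (x : V) : set V :=
  smallest (fun B : set V => forall i y, sphere y ->
              (B y -> B (F i y)) /\ (B (F i y) -> B y)) [set x].
Definition minimal : Prop :=
  forall x y : V, sphere x -> sphere y -> forall eps : R, 0 < eps ->
    exists z, orbit x z /\ enorm (z - y) < eps.
End Family.

Definition SO (M : 'M[R]_n.+1) : Prop := M^T *m M = 1%:M /\ \det M = 1.
Definition gen_group (k : nat) (A : 'I_k -> 'M[R]_n.+1) : set 'M[R]_n.+1 :=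
  smallest (fun G : set 'M[R]_n.+1 => forall i M, G M ->
              G (A i *m M) /\ G (invmx (A i) *m M)) [set 1%:M].
Definition dense_in_SO (k : nat) (A : 'I_k -> 'M[R]_n.+1) : Prop :=
  SO `<=` closure (gen_group A).
End Defs.

Definition gens (R : realType) (n k : nat) (A0 : 'M[R]_n.+1)
  (A : 'I_k -> 'M[R]_n.+1) (o : option 'I_k) : 'M[R]_n.+1 :=
  match o with None => A0 | Some i => A i end.

(* Main.v *)
(* An element A0 of SL outside SO stretches some direction e by the maximal factor sigma > 1,
   so composing copies of A0 with rotations, which bring the image of e back to e and turn the
   orthogonal complement of e, gives a word contracting a neighbourhood of e on the sphere.
   Near-rotations available by density carry this contraction to every point: finitely many
   words ws j contract one ball B(e, rho), and the images of the quarter ball B(e, rho/4) cover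
   the sphere. Both properties survive C^1-small perturbations because words are compared with
   their linear models through strict (Lipschitz) derivatives.

   Minimality: pull a target back along the contractions until its neighbourhood becomes the
   whole ball B(e, rho), which every orbit visits.

   Ergodicity: iterating the cover yields disjoint cells of depth N, each parametrised by a
   word; choosing the radius of the balls at every step by pigeonhole, all but a fraction D r
   of the sphere consists of points whose r-ball in the parameter space is mapped into a single
   cell. On such balls the word contracts by lam^N and, by the Hoelder condition, has volume
   distortion bounded independently of N. As N grows, the image of the ball becomes too small
   to meet both a compact part of an invariant set A and a compact part of its complement, so A
   is almost null or almost conull on some ball of fixed radius r. By compactness it is null or
   conull on a fixed ball, and by minimality on the sphere. No density points and no control of
   the shape of the images are needed.

   The surface measure of a subset of the sphere is the outer volume, by countable covers with
   boxes, of the cone over it; a map of the sphere acts on cones by its homogeneous extension. *)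
From HB Require Import structures.
From mathcomp Require Import all_boot all_order all_algebra.
From mathcomp Require Import all_classical all_reals all_analysis.
From mathcomp Require Import perm ring lra.
Require Import Defs.
Set Implicit Arguments.
Unset Strict Implicit.
Unset Printing Implicit Defensive.
Import Order.TTheory GRing.Theory Num.Theory.
Import numFieldNormedType.Exports.
Local Open Scope classical_set_scope.
Local Open Scope ring_scope.

(** * Euclidean geometry and derivatives *)

(** The perturbed generators are only C^1-close to matrices: they are no longer isometries, so
    density of the rotations can be exploited only through finitely many words fixed in advance. All
    that is kept of the linear picture is a contracting cover, an open condition; from there on
    minimality and ergodicity concern any group that has one.

    A maximally stretched e is a critical point, so A0 / sigma followed by a rotation fixes e and
    does not expand. The determinant forces some direction orthogonal to e to shrink, but only one
    is known, and rotations fixing e must bring all others onto it. There is no contraction along e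
    itself; on the sphere none is required, as displacements near e are tangent to it up to second
    order.

    In the ergodic part the depth N must grow while the radius r stays fixed. This is possible
    because the lost fraction and the distortion obey recursions x >= b + q x with q = lam and q =
    lam^alpha, solved by constants independent of N; the second is where the Hoelder condition is
    spent. *)

Section EuclideanNorm.
Context {R : realType} {n : nat}.
Local Notation V := 'cV[R]_n.+1.
Implicit Types (x y z : V) (A : 'M[R]_n.+1).

Lemma subvACA (W : zmodType) (a b c d : W) : (a - b) - (c - d) = (a - c) - (b - d).
Proof. by rewrite opprD addrACA -opprD. Qed.

Definition dot x y : R := (x^T *m y) ord0 ord0.

Lemma dotE x y : dot x y = \sum_i x i ord0 * y i ord0.
Proof. by rewrite /dot mxE; apply: eq_bigr => i _; rewrite mxE. Qed.

Lemma dotC x y : dot x y = dot y x.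
Proof. by rewrite !dotE; apply: eq_bigr => i _; rewrite mulrC. Qed.

Lemma dotDr x y z : dot x (y + z) = dot x y + dot x z.
Proof. by rewrite /dot mulmxDr mxE. Qed.

Lemma dotDl x y z : dot (x + y) z = dot x z + dot y z.
Proof. by rewrite dotC dotDr !(dotC z). Qed.

Lemma dotZr a x y : dot x (a *: y) = a * dot x y.
Proof. by rewrite /dot -scalemxAr mxE. Qed.

Lemma dotZl a x y : dot (a *: x) y = a * dot x y.
Proof. by rewrite dotC dotZr dotC. Qed.

Lemma dotNr x y : dot x (- y) = - dot x y.
Proof. by rewrite /dot mulmxN mxE. Qed.

Lemma dotNl x y : dot (- x) y = - dot x y.
Proof. by rewrite dotC dotNr dotC. Qed.

Lemma dotBr x y z : dot x (y - z) = dot x y - dot x z.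
Proof. by rewrite dotDr dotNr. Qed.

Lemma dotBl x y z : dot (x - y) z = dot x z - dot y z.
Proof. by rewrite dotDl dotNl. Qed.

Lemma dot0r x : dot x 0 = 0.
Proof. by rewrite /dot mulmx0 mxE. Qed.

Lemma dot_mulmxl A x y : dot (A *m x) y = dot x (A^T *m y).
Proof. by rewrite /dot trmx_mul mulmxA. Qed.

Lemma dotxx_ge0 x : 0 <= dot x x.
Proof. by rewrite dotE; apply: sumr_ge0 => i _; rewrite -expr2 sqr_ge0. Qed.

Lemma enormE x : enorm x = Num.sqrt (dot x x).
Proof. by rewrite dotE /enorm; congr Num.sqrt; apply: eq_bigr => i _; rewrite expr2. Qed.

Lemma enorm_sq x : enorm x ^+ 2 = dot x x.
Proof. by rewrite enormE sqr_sqrtr ?dotxx_ge0. Qed.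

Lemma enorm_ge0 x : 0 <= enorm x.
Proof. by rewrite enormE sqrtr_ge0. Qed.

Lemma ler_enorm x (a : R) : 0 <= a -> dot x x <= a ^+ 2 -> enorm x <= a.
Proof.
move=> a0 h; rewrite -(ler_pXn2r (ltn0Sn 1)) ?nnegrE ?enorm_ge0//.
by rewrite enorm_sq.
Qed.

Lemma coord_le_enorm x i : `|x i ord0| <= enorm x.
Proof.
rewrite -(ler_pXn2r (ltn0Sn 1)) ?nnegrE ?enorm_ge0// enorm_sq dotE.
rewrite real_normK ?num_real// (bigD1 i)//= -expr2 lerDl.
by apply: sumr_ge0 => j _; rewrite -expr2 sqr_ge0.
Qed.

Lemma enorm_eq0 x : (enorm x == 0) = (x == 0).
Proof.
apply/eqP/eqP => [h|->]; last by rewrite enormE dot0r sqrtr0.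
apply/matrixP => i j; rewrite ord1 mxE; apply/eqP.
by rewrite -normr_le0 -h coord_le_enorm.
Qed.

Lemma enorm0 : enorm (0 : V) = 0.
Proof. by apply/eqP; rewrite enorm_eq0. Qed.

Lemma enorm_gt0 x : (0 < enorm x) = (x != 0).
Proof. by rewrite lt_def enorm_ge0 andbT enorm_eq0. Qed.

Lemma enormZ a x : enorm (a *: x) = `|a| * enorm x.
Proof.
by rewrite !enormE dotZl dotZr mulrA -expr2 sqrtrM ?sqr_ge0// sqrtr_sqr.
Qed.

Lemma enormN x : enorm (- x) = enorm x.
Proof. by rewrite !enormE dotNl dotNr opprK. Qed.

Lemma enorm_distC x y : enorm (x - y) = enorm (y - x).
Proof. by rewrite -opprB enormN. Qed.

Lemma normr_dot x y : `|dot x y| <= enorm x * enorm y.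
Proof.
have [->|y0] := eqVneq y 0; first by rewrite dot0r normr0 enorm0 mulr0.
have yy : 0 < dot y y by rewrite -enorm_sq exprn_gt0// enorm_gt0.
rewrite -(ler_pXn2r (ltn0Sn 1)) ?nnegrE ?mulr_ge0 ?enorm_ge0//.
rewrite exprMn !enorm_sq real_normK ?num_real//.
have := dotxx_ge0 (dot y y *: x - dot x y *: y).
rewrite dotBl !dotBr !dotZl !dotZr (dotC y x).
set a := dot y y in yy *; set b := dot x y; set c := dot x x => h.
have : 0 <= a * (c * a - b ^+ 2) by rewrite expr2; nra.
by rewrite pmulr_rge0// subr_ge0.
Qed.

Lemma dot_le_enorm x y : dot x y <= enorm x * enorm y.
Proof. exact: le_trans (ler_norm _) (normr_dot _ _). Qed.

Lemma ler_enormD x y : enorm (x + y) <= enorm x + enorm y.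
Proof.
apply: ler_enorm; first by rewrite addr_ge0 ?enorm_ge0.
rewrite dotDl !dotDr (dotC y x) sqrrD !enorm_sq.
have := dot_le_enorm x y; lra.
Qed.

Lemma ler_enormB x y : enorm (x - y) <= enorm x + enorm y.
Proof. by rewrite -(enormN y) ler_enormD. Qed.

Lemma ler_enorm_add y x z : enorm (x - z) <= enorm (x - y) + enorm (y - z).
Proof. by rewrite -(subrKA y) ler_enormD. Qed.

Lemma ler_enorm_dist x y : `|enorm x - enorm y| <= enorm (x - y).
Proof.
rewrite ler_norml; have := ler_enorm_add y x 0; have := ler_enorm_add x y 0.
by rewrite !subr0 (enorm_distC y x); lra.
Qed.

Lemma enorm_le_mx x : enorm x <= n.+1%:R * `|x|.
Proof.
apply: ler_enorm; first by rewrite mulr_ge0.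
apply: (@le_trans _ _ (\sum_(i < n.+1) `|x| ^+ 2)); last first.
  rewrite sumr_const card_ord -[leLHS]mulr_natl exprMn ler_wpM2r ?sqr_ge0//.
  by rewrite -natrX ler_nat; exact: leq_pmulr.
rewrite dotE; apply: ler_sum => i _; rewrite -expr2 -real_normK ?num_real//.
by rewrite ler_pXn2r ?nnegrE// /Num.norm/= mx_normrE (le_bigmax _ _ (i, ord0)).
Qed.

Lemma mx_le_enorm x : `|x| <= enorm x.
Proof.
rewrite [leLHS]/Num.norm/= mx_normrE; apply/bigmax_leP; split; first exact: enorm_ge0.
by move=> [i j] _ /=; rewrite (ord1 j) coord_le_enorm.
Qed.

Lemma coord_le_mx x i : `|x i ord0| <= `|x|.
Proof. by rewrite [leRHS]/Num.norm/= mx_normrE (le_bigmax _ _ (i, ord0)). Qed.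

Lemma mx_le_coord x (a : R) : 0 <= a -> (forall i, `|x i ord0| <= a) -> `|x| <= a.
Proof.
move=> a0 h; rewrite [leLHS]/Num.norm/= mx_normrE; apply/bigmax_leP; split => //.
by move=> [i j] _ /=; rewrite (ord1 j).
Qed.

Lemma enorm_mulmx A x : enorm (A *m x) <= (n.+1%:R * n.+1%:R * `|A|) * enorm x.
Proof.
rewrite -mulrA -mulrA; apply: (le_trans (enorm_le_mx _)); rewrite ler_pM2l ?ltr0n//.
apply: mx_le_coord; first by rewrite !mulr_ge0 ?enorm_ge0.
move=> i; rewrite mxE; apply: (le_trans (ler_norm_sum _ _ _)).
apply: (@le_trans _ _ (\sum_(j < n.+1) `|A| * enorm x)); last first.
  by rewrite sumr_const card_ord -[leLHS]mulr_natl.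
apply: ler_sum => j _; rewrite normrM ler_pM ?coord_le_enorm//.
by rewrite [leRHS]/Num.norm/= mx_normrE (le_bigmax _ _ (i, j)).
Qed.

Lemma mulmx_bound A : exists2 K, 1 <= K & forall x, enorm (A *m x) <= K * enorm x.
Proof.
exists (1 + n.+1%:R * n.+1%:R * `|A|); first by rewrite lerDl !mulr_ge0.
move=> x; apply: (le_trans (enorm_mulmx _ _)).
by rewrite ler_wpM2r ?enorm_ge0// lerDr.
Qed.

Lemma orthogonal_dot A x y : A^T *m A = 1%:M -> dot (A *m x) (A *m y) = dot x y.
Proof. by move=> h; rewrite dot_mulmxl mulmxA h mul1mx. Qed.

Lemma orthogonal_enorm A x : A^T *m A = 1%:M -> enorm (A *m x) = enorm x.
Proof. by move=> h; rewrite !enormE orthogonal_dot. Qed.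

Lemma sphere_neq0 x : sphere x -> x != 0.
Proof. by move=> h; rewrite -enorm_gt0 h. Qed.

Lemma sphere_dot x : sphere x -> dot x x = 1.
Proof. by move=> h; rewrite -enorm_sq h expr1n. Qed.

Definition unitv x : V := (enorm x)^-1 *: x.

Lemma unitv_sphere x : x != 0 -> sphere (unitv x).
Proof.
move=> x0; rewrite /sphere/= enormZ ger0_norm ?invr_ge0 ?enorm_ge0//.
by rewrite mulVf// enorm_eq0.
Qed.

Lemma unitv_id x : sphere x -> unitv x = x.
Proof. by rewrite /unitv => ->; rewrite invr1 scale1r. Qed.

Lemma unitvZ a x : 0 < a -> unitv (a *: x) = unitv x.
Proof.
move=> a0; rewrite /unitv enormZ gtr0_norm// scalerA.
by rewrite invfM mulrAC mulVf ?mul1r// gt_eqF.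
Qed.

Lemma scale_unitv x : enorm x *: unitv x = x.
Proof.
have [->|x0] := eqVneq x 0; first by rewrite /unitv !scaler0.
by rewrite scalerA mulfV ?scale1r// enorm_eq0.
Qed.

Lemma enorm_unitvB x y : x != 0 -> enorm (unitv x - unitv y) <= 2 * enorm (x - y) / enorm x.
Proof.
move=> x0; have nx : 0 < enorm x by rewrite enorm_gt0.
have -> : unitv x - unitv y =
  (enorm x)^-1 *: ((x - y) - (enorm x - enorm y) *: unitv y).
  rewrite scalerBl scale_unitv opprB addrA subrK.
  by rewrite scalerBr scalerA mulVf ?scale1r ?gt_eqF.
rewrite enormZ gtr0_norm ?invr_gt0// mulrC ler_pM2r ?invr_gt0//.
apply: (le_trans (ler_enormB _ _)); rewrite mulr2n mulrDl !mul1r lerD2l.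
rewrite enormZ; have [->|y0] := eqVneq y 0.
  by rewrite /unitv scaler0 enorm0 mulr0 enorm_ge0.
by rewrite (unitv_sphere y0) mulr1 ler_enorm_dist.
Qed.

(* On the sphere the displacement y - z is tangent to second order. *)
Lemma dot_sphereB x y z : sphere y -> sphere z ->
  `|dot x (y - z)| <= (enorm (x - y) + enorm (x - z)) * enorm (y - z).
Proof.
move=> sy sz.
have e : dot (y + z) (y - z) = 0.
  by rewrite dotDl !dotBr !sphere_dot// (dotC z y); lra.
have -> : dot x (y - z) = 2^-1 * dot ((x - y) + (x - z)) (y - z).
  have -> : (x - y) + (x - z) = x + x - (y + z) by rewrite addrACA opprD.
  by rewrite dotBl e dotDl; lra.
rewrite normrM ger0_norm ?invr_ge0//.
apply: le_trans (_ : 2^-1 * (enorm ((x - y) + (x - z)) * enorm (y - z)) <= _).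
  by rewrite ler_pM2l ?normr_dot.
have h := ler_enormD (x - y) (x - z); have h0 := enorm_ge0 (x - y + (x - z)).
have h1 := enorm_ge0 (y - z).
have := ler_wpM2r h1 h; have := mulr_ge0 h0 h1; lra.
Qed.

End EuclideanNorm.

Section Derivatives.
Context {R : realType} {n : nat}.
Local Notation V := 'cV[R]_n.+1.
Implicit Types (x y z v w : V) (A : 'M[R]_n.+1) (f G : V -> V).

Lemma differentiable_mulmx_coord A i x :
  differentiable (fun y : V => (A *m y) i ord0 : R) x.
Proof.
have -> : (fun y : V => (A *m y) i ord0 : R) =
    \sum_(j < n.+1) (A i j *: (fun y : V => y j ord0 : R)).
  by apply/funext => y; rewrite fct_sumE mxE; apply: eq_bigr.
by apply: differentiable_sum => j; apply: differentiableZ; exact: differentiable_coord.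
Qed.

Lemma differentiable_enorm_mulmx A x : A *m x != 0 ->
  differentiable (fun y : V => enorm (A *m y) : R) x.
Proof.
move=> Ax0.
pose q := \sum_(i < n.+1) ((fun y : V => (A *m y) i ord0 : R) * (fun y : V => (A *m y) i ord0 : R)).
have qE y : q y = dot (A *m y) (A *m y).
  by rewrite /q fct_sumE dotE; apply: eq_bigr.
have -> : (fun y : V => enorm (A *m y) : R) = (@Num.sqrt R) \o q.
  by apply/funext => y; rewrite /= qE enormE.
apply: differentiable_comp.
  by apply: differentiable_sum => i; apply: differentiableM; exact: differentiable_mulmx_coord.
apply/derivable1_diffP.
have : 0 < q x by rewrite qE -enorm_sq exprn_gt0// enorm_gt0.
by move=> /is_derive1_sqrt[].
Qed.

Lemma differentiable_fA A x : A *m x != 0 -> differentiable (fA A) x.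
Proof.
move=> Ax0.
have -> : fA A = \sum_(i < n.+1)
    (fun y : V => ((fun y : V => (enorm (A *m y))^-1) * (fun y : V => (A *m y) i ord0 : R)) y
       *: (delta_mx i ord0 : V)).
  apply/funext => y; rewrite fct_sumE /fA; apply/matrixP => i j.
  rewrite (ord1 j) summxE (bigD1 i)//= big1 ?addr0; last first.
    by move=> k ki; rewrite !mxE eq_sym (negbTE ki) mulr0.
  by rewrite [LHS]mxE [RHS]mxE [delta_mx _ _ _ _]mxE !eqxx mulr1.
apply: differentiable_sum => i; apply: differentiableZl; apply: differentiableM.
  by apply: differentiableV; [exact: differentiable_enorm_mulmx | rewrite enorm_eq0].
exact: differentiable_mulmx_coord.
Qed.

Lemma continuous_dot u : continuous (dot u : V -> R).
Proof.
have -> : dot u = \sum_(i < n.+1) ((u i ord0) *: (fun y : V => y i ord0 : R)).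
  by apply/funext => y; rewrite fct_sumE dotE; apply: eq_bigr.
move=> x; apply: differentiable_continuous.
by apply: differentiable_sum => j; apply: differentiableZ; exact: differentiable_coord.
Qed.

Lemma is_derive_line G z v u (t : R) : derivable G (z + t *: v) v ->
  is_derive t 1 (fun s : R => dot u (G (z + s *: v)) : R) (dot u ('D_v G (z + t *: v))).
Proof.
move=> dG.
have h : (fun h : R => h^-1 *: (((fun s : R => dot u (G (z + s *: v))) \o shift t) (h *: 1)
             - dot u (G (z + t *: v)))) @ 0^' --> dot u ('D_v G (z + t *: v)).
  have -> : (fun h : R => h^-1 *: (((fun s : R => dot u (G (z + s *: v))) \o shift t) (h *: 1)
             - dot u (G (z + t *: v)))) =
     (dot u) \o (fun h : R => h^-1 *: ((G \o shift (z + t *: v)) (h *: v) - G (z + t *: v))).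
    apply/funext => h /=; rewrite dotZr dotBr.
    have -> : (h *: 1 + t : R) = h + t by rewrite [_ *: 1]mulr1.
    by rewrite scalerDl addrCA.
  apply: continuous_cvg; first exact: continuous_dot.
  exact: dG.
by apply: DeriveDef; [apply/cvg_ex; eexists; exact: h | exact: cvg_lim].
Qed.

(* The scalar mean value theorem is applied to the component of G along
   G (z + v) - G z - w. *)
Lemma mean_value_ineq G z v w (M : R) :
  (forall t : R, 0 <= t <= 1 ->
     derivable G (z + t *: v) v /\ enorm ('D_v G (z + t *: v) - w) <= M) ->
  enorm (G (z + v) - G z - w) <= M.
Proof.
move=> h; set u := G (z + v) - G z - w.
pose phi := fun s : R => dot u (G (z + s *: v)) : R.
have dphi (t : R) : 0 <= t <= 1 -> is_derive t 1 phi (dot u ('D_v G (z + t *: v))).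
  by move=> /h[dG _]; exact: is_derive_line.
have [||c] := @MVT R phi (fun t => dot u ('D_v G (z + t *: v))) 0 1 ltr01.
- by move=> t; rewrite in_itv/= => /andP[t0 t1]; apply: dphi; rewrite !ltW.
- apply: derivable_within_continuous => t; rewrite in_itv/= => tt.
  by have [] := dphi _ tt.
rewrite in_itv/= => /andP[c0 c1]; rewrite /phi scale1r scale0r addr0 subr0 mulr1 => e.
have [|_ hM] := h c; first by rewrite !ltW.
have [->|u0] := eqVneq u 0; first by rewrite enorm0 (le_trans _ hM)// enorm_ge0.
have nu : 0 < enorm u by rewrite enorm_gt0.
rewrite -(ler_pM2l nu) -expr2 enorm_sq.
apply: le_trans (_ : dot u ('D_v G (z + c *: v) - w) <= _).
  by rewrite [leRHS]dotBr -e -!dotBr.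
by apply: le_trans (dot_le_enorm _ _) _; rewrite ler_pM2l.
Qed.

Lemma radE f x : rad f x = f (unitv x). Proof. by []. Qed.

Lemma rad_sphere f x : sphere x -> rad f x = f x.
Proof. by move=> sx; rewrite radE unitv_id. Qed.

Lemma radZ f (a : R) x : 0 < a -> rad f (a *: x) = rad f x.
Proof. by move=> a0; rewrite !radE unitvZ. Qed.

(** [rad f] is constant on rays, so its derivative is homogeneous of degree -1. Derivative bounds on
    the sphere thus pass to points p of chords, at the cost of a factor 1/|p|. *)
Lemma derive_radZ f (a : R) x v : 0 < a -> 'D_v (rad f) (a *: x) = 'D_(a^-1 *: v) (rad f) x.
Proof.
move=> a0; rewrite /derive.
have -> // : (fun h : R => h^-1 *: ((rad f \o shift (a *: x)) (h *: v) - rad f (a *: x))) =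
   (fun h : R => h^-1 *: ((rad f \o shift x) (h *: (a^-1 *: v)) - rad f x)).
apply/funext => h /=; rewrite (@radZ f a x a0); congr (_ *: (_ - _)).
rewrite -(@radZ f a (h *: (a^-1 *: v) + x))// scalerDr !scalerA.
by congr (rad f (_ *: _ + _)); rewrite mulrAC mulfV ?mul1r// gt_eqF.
Qed.

Lemma derive_unitv f x v : x != 0 ->
  'D_v (rad f) x = 'D_((enorm x)^-1 *: v) (rad f) (unitv x).
Proof. by move=> x0; rewrite -{1}(scale_unitv x) derive_radZ// enorm_gt0. Qed.

Lemma differentiable_rad_fA A x : (forall y, y != 0 -> A *m y != 0) -> x != 0 ->
  differentiable (rad (fA A)) x.
Proof.
move=> A0 x0.
have e : rad (fA A) = (fA A) \o unitv by [].
have du : differentiable (unitv : V -> V) x.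
  have -> : (unitv : V -> V) = fA 1%:M by apply/funext => y; rewrite /fA mul1mx.
  by apply: differentiable_fA; rewrite mul1mx.
rewrite e; apply: differentiable_comp => //; apply: differentiable_fA.
by apply/A0/sphere_neq0/unitv_sphere.
Qed.

End Derivatives.

Section LipschitzClose.
Context {R : realType} {n : nat}.
Local Notation V := 'cV[R]_n.+1.
Implicit Types (x y z v w : V) (A : 'M[R]_n.+1) (f g F G : V -> V).

Definition bijS f : Prop :=
  (forall x, sphere x -> sphere (f x)) /\
  exists g : V -> V, (forall x, sphere x -> sphere (g x)) /\
    (forall x, sphere x -> g (f x) = x /\ f (g x) = x).

(** C^1-closeness restated without derivatives: the difference of the maps is small and has a small
    Lipschitz constant. In this form it composes along words. *)
Definition LC (eps : R) g f : Prop :=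
  (forall x, sphere x -> enorm (g x - f x) <= eps) /\
  forall x y, sphere x -> sphere y ->
    enorm ((g x - f x) - (g y - f y)) <= eps * enorm (x - y).

(** Every point of a chord of length at most 1 is within 1/2 of one of the endpoints, so the chord
    stays away from the origin, where [rad] is singular. *)
Lemma sphere_segment x v (t : R) : sphere x -> sphere (x + v) -> enorm v <= 1 ->
  0 <= t <= 1 -> 2^-1 <= enorm (x + t *: v).
Proof.
move=> sx sy v1 /andP[t0 t1].
have h1 := ler_enorm_add x (x + t *: v) 0; have h2 := ler_enorm_add (x + v) (x + t *: v) 0.
have e1 : enorm (x - (x + t *: v)) = t * enorm v.
  by rewrite opprD addrA subrr add0r enormN enormZ ger0_norm.
have e2 : enorm (x + v - (x + t *: v)) = (1 - t) * enorm v.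
  rewrite opprD addrACA subrr add0r -{1}(scale1r v) -scalerBl enormZ ger0_norm//.
  by rewrite subr_ge0.
have {}h1 := ler_enorm_add (x + t *: v) x 0; have {}h2 := ler_enorm_add (x + t *: v) (x + v) 0.
move: h1 h2; rewrite !subr0 e1 e2 sx sy => h1 h2.
have := enorm_ge0 v; have [t2|t2] := lerP t 2^-1; nra.
Qed.

Lemma derive_scale G x (c : R) v : differentiable G x -> 'D_(c *: v) G x = c *: 'D_v G x.
Proof. by move=> dG; rewrite !deriveE// linearZ. Qed.

Lemma enorm_derive_le G H x (eps : R) v :
  differentiable G x -> differentiable H x ->
  (forall v, enorm v <= 1 -> enorm ('D_v G x - 'D_v H x) <= eps) ->
  enorm ('D_v G x - 'D_v H x) <= eps * enorm v.
Proof.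
move=> dG dH h.
have [->|v0] := eqVneq v 0.
  by rewrite -(scale0r (0 : V)) (derive_scale _ _ dG) (derive_scale _ _ dH) !scale0r subr0 enorm0 mulr0.
rewrite -{1 2}(scale_unitv v) (derive_scale (enorm v) (unitv v) dG) (derive_scale (enorm v) (unitv v) dH) -scalerBr enormZ ger0_norm ?enorm_ge0// mulrC.
rewrite ler_pM2r ?enorm_gt0//.
apply: h.
by rewrite (unitv_sphere v0).
Qed.

(** The mean value inequality for the difference of the radial extensions along a chord; the factor
    2 bounds 1/|p| there. Points more than 1 apart need only the uniform bound. *)
Lemma C1close_LC (eps : R) F A : (forall y, y != 0 -> A *m y != 0) ->
  C1map F -> C1close eps F (fA A) -> LC (2 * eps) F (fA A).
Proof.
move=> A0 C1F close; split=> [x sx|x y sx sy].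
  have [h _] := close _ sx; have := enorm_ge0 (F x - fA A x); lra.
have [xy1|xy1] := lerP (enorm (y - x)) 1; last first.
  have [h1 _] := close _ sx; have [h2 _] := close _ sy.
  have := ler_enormB (F x - fA A x) (F y - fA A y).
  have := enorm_ge0 (F x - fA A x); rewrite (enorm_distC x y); nra.
pose D := rad F - rad (fA A).
have DE z : sphere z -> F z - fA A z = D z.
  by move=> sz; rewrite /D -(rad_sphere F sz) -(rad_sphere (fA A) sz).
rewrite !DE// (enorm_distC (D x)) (enorm_distC x).
have yE : y = x + (y - x) by rewrite addrC subrK.
rewrite {1}yE -[X in enorm X]subr0.
apply: mean_value_ineq => t t01; rewrite subr0.
have pn : 2^-1 <= enorm (x + t *: (y - x)).
  by apply: sphere_segment => //; rewrite addrC subrK.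
set p := x + t *: (y - x) in pn *.
have p0 : p != 0 by rewrite -enorm_gt0; lra.
have sp := unitv_sphere p0.
have [dF _] := C1F _ p0; have dA := differentiable_rad_fA A0 p0.
split; first by apply: derivableB; exact: diff_derivable.
rewrite deriveB; [|exact: diff_derivable..].
rewrite (derive_unitv F)// (derive_unitv (fA A))//.
have [dFu _] := C1F _ (sphere_neq0 sp).
apply: le_trans (_ : eps * enorm ((enorm p)^-1 *: (y - x)) <= _).
  apply: enorm_derive_le => //.
    by apply: differentiable_rad_fA => //; exact: sphere_neq0.
  by move=> v v1; apply/ltW; apply: (close _ sp).2.
have eps0 : 0 < eps by have [+ _] := close _ sp; apply: le_lt_trans; exact: enorm_ge0.
rewrite enormZ -mulrA [leRHS]mulrCA ler_pM2l// ler_wpM2r ?enorm_ge0//.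
rewrite gtr0_norm ?invr_gt0 ?enorm_gt0// -[leRHS]invrK lef_pV2 ?posrE//; last lra.
Qed.

End LipschitzClose.

(** * Words and their perturbations *)

Section Words.
Context {R : realType} {n : nat}.
Local Notation V := 'cV[R]_n.+1.
Implicit Types (x y z v : V) (L : 'M[R]_n.+1) (g h : V -> V).

Lemma fin_max (I : finType) (P : I -> R -> Prop) :
  (forall i, exists K, forall K', K <= K' -> P i K') ->
  exists2 K, 1 <= K & forall i, P i K.
Proof.
move=> /choice[K PK]; exists (1 + \sum_i `|K i|).
  by rewrite lerDl sumr_ge0.
move=> i; apply: PK; apply: (le_trans (ler_norm _)).
rewrite (bigD1 i)//= addrCA lerDl addr_ge0// sumr_ge0//.
Qed.

Lemma fin_min (I : finType) (P : I -> R -> Prop) :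
  (forall i, exists2 e, 0 < e & forall e', 0 < e' <= e -> P i e') ->
  exists2 e, 0 < e & forall i, P i e.
Proof.
move=> h; have [i|K K1 PK] := @fin_max I (fun i K => 0 < K -> P i K^-1).
  have [e e0 Pe] := h i; exists e^-1 => K' eK K0; apply: Pe.
  by rewrite invr_gt0 K0 -[leRHS]invrK lef_pV2 ?posrE ?invr_gt0.
have K0 : 0 < K by apply: lt_le_trans K1.
by exists K^-1 => [|i]; [rewrite invr_gt0 | exact: PK].
Qed.

Definition lipS (K : R) g : Prop :=
  forall x y, sphere x -> sphere y -> enorm (g x - g y) <= K * enorm (x - y).

(** [bijS] only asserts that an inverse exists; choosing preimages makes inverse letters depend on
    the map alone. For such maps the default [x] is never taken at a point of the sphere. *)
Definition sphere_inv g x : V := xget x [set y | sphere y /\ g y = x].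

Lemma sphere_invP g : bijS g -> forall x, sphere x -> sphere (sphere_inv g x) /\ g (sphere_inv g x) = x.
Proof.
move=> [gS [h [hS hK]]] x sx; rewrite /sphere_inv; case: xgetP => [y -> []//|].
by move=> /(_ (h x))[]; split; [exact: hS | exact: (hK _ sx).2].
Qed.

Lemma sphere_invK g : bijS g -> forall x, sphere x -> sphere_inv g (g x) = x.
Proof.
move=> bg x sx; have [gS [h [hS hK]]] := bg.
have [s e] := sphere_invP bg (gS _ sx).
by rewrite -(hK _ s).1 e (hK _ sx).1.
Qed.

Variable I : finType.
Implicit Types (F : I -> V -> V) (w : seq (I * bool)) (l : I * bool).

(** A letter is a generator with a flag: [true] for the map, [false] for its inverse. In [wact] the
    head of the word acts last. *)
Definition lact F l : V -> V := if l.2 then F l.1 else sphere_inv (F l.1).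

Definition wact F w : V -> V := foldr (fun l h => lact F l \o h) id w.

Definition linv l : I * bool := (l.1, ~~ l.2).

Definition winv w := rev (map linv w).

Lemma wact_cat F w1 w2 x : wact F (w1 ++ w2) x = wact F w1 (wact F w2 x).
Proof. by elim: w1 => //= l w1 ->. Qed.

Definition bijF F := forall o, bijS (F o).

Lemma lact_sphere F l : bijF F -> forall x, sphere x -> sphere (lact F l x).
Proof.
move=> bF x sx; rewrite /lact; case: l.2; first exact: (bF _).1.
by have [] := sphere_invP (bF l.1) sx.
Qed.

Lemma wact_sphere F w : bijF F -> forall x, sphere x -> sphere (wact F w x).
Proof.
by move=> bF x sx; elim: w => //= l w IH; exact: lact_sphere.
Qed.

Lemma lactK F l : bijF F -> forall x, sphere x -> lact F (linv l) (lact F l x) = x.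
Proof.
move=> bF x sx; rewrite /lact /linv; case: l.2 => /=; first exact: sphere_invK.
by have [] := sphere_invP (bF l.1) sx.
Qed.

Lemma linvK : involutive linv. Proof. by case=> o b; rewrite /linv /= negbK. Qed.

Lemma winvK : involutive winv.
Proof.
by move=> w; rewrite /winv map_rev revK -map_comp map_id_in// => l _; exact: linvK.
Qed.

Lemma wactK F w : bijF F -> forall x, sphere x -> wact F (winv w) (wact F w x) = x.
Proof.
move=> bF; elim: w => //= l w IH x sx.
rewrite /winv map_cons rev_cons -cats1 wact_cat /= lactK ?IH//.
exact: wact_sphere.
Qed.

Lemma wactKV F w : bijF F -> forall x, sphere x -> wact F w (wact F (winv w) x) = x.
Proof. by move=> bF x sx; rewrite -{1}(winvK w) wactK. Qed.

Lemma lipS_wact F (K : R) w : bijF F -> 1 <= K ->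
  (forall l, lipS K (lact F l)) -> lipS (K ^+ size w) (wact F w).
Proof.
move=> bF K1 hK; elim: w => [|l w IH] x y sx sy /=; first by rewrite mul1r.
apply: (le_trans (hK _ _ _ _ _)); [exact: wact_sphere..|].
by rewrite exprS -mulrA ler_wpM2l ?IH// (le_trans ler01).
Qed.

Variable f : I -> V -> V.

Definition nb (eps : R) F : Prop := forall o, bijS (F o) /\ LC eps (F o) (f o).

Lemma nb_bij eps F : nb eps F -> bijF F.
Proof. by move=> nF o; have [] := nF o. Qed.

Lemma LC_le (e1 e2 : R) g h : e1 <= e2 -> LC e1 g h -> LC e2 g h.
Proof.
move=> e12 [h1 h2]; split=> [x sx|x y sx sy]; first exact: le_trans (h1 _ sx) _.
by apply: le_trans (h2 _ _ sx sy) _; rewrite ler_wpM2r ?enorm_ge0.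
Qed.

Lemma nb_le (e1 e2 : R) F : e1 <= e2 -> nb e1 F -> nb e2 F.
Proof. by move=> e12 nF o; have [b /(LC_le e12)] := nF o. Qed.

Hypothesis bij_f : bijF f.
Hypothesis bilip_f : forall o, exists K : R, forall x y, sphere x -> sphere y ->
  enorm (f o x - f o y) <= K * enorm (x - y) /\
  enorm (x - y) <= K * enorm (f o x - f o y).

(** An error of Lipschitz size 1/(2K) leaves half of the lower Lipschitz constant 1/K of a
    generator. Inverse letters therefore obey a bound uniform over the neighbourhood. *)
Lemma nb_bilip : exists2 K : R, 1 <= K & exists2 eps : R, 0 < eps &
  forall F, nb eps F -> forall l, lipS K (lact F l).
Proof.
have [i|K K1 hK] := @fin_max I (fun o K => forall x y, sphere x -> sphere y ->
  enorm (f o x - f o y) <= K * enorm (x - y) /\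
  enorm (x - y) <= K * enorm (f o x - f o y)).
  have [K hK] := bilip_f i; exists K => K' KK' x y sx sy.
  have [h1 h2] := hK _ _ sx sy.
  by split; [apply: (le_trans h1) | apply: (le_trans h2)]; rewrite ler_wpM2r ?enorm_ge0.
have K0 : 0 < K by apply: lt_le_trans K1.
exists (2 * K + 1); first lra.
exists (2 * K)^-1; first by rewrite invr_gt0 mulr_gt0.
move=> F nF l.
have key x y : sphere x -> sphere y ->
    enorm (F l.1 x - F l.1 y) <= (2 * K + 1) * enorm (x - y) /\
    enorm (x - y) <= (2 * K + 1) * enorm (F l.1 x - F l.1 y).
  move=> sx sy; have [_ [_ h]] := nF l.1; move: h => /(_ _ _ sx sy) h.
  have [h1 h2] := hK l.1 _ _ sx sy.
  rewrite subvACA in h.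
  move: h h1 h2; move: (F l.1 x - F l.1 y) (f l.1 x - f l.1 y) => a b h h1 h2.
  move: h; set e := (2 * K)^-1 => h3.
  have eK : K * e = 2^-1 by rewrite /e invfM mulrCA mulfV ?mulr1// gt_eqF.
  have h4 := ler_enormD (a - b) b; have h5 := ler_enormB a (a - b).
  move: h4 h5; rewrite subrK subKr => h4 h5.
  have d0 := enorm_ge0 (x - y); have a0 := enorm_ge0 a.
  have e1 : e <= 1 by nra.
  split; first by nra.
  have : K * enorm b <= K * (enorm a + e * enorm (x - y)) by rewrite ler_pM2l//; lra.
  by rewrite mulrDr mulrA eK; nra.
move=> x y sx sy; rewrite /lact; case: l.2; first by have [] := key _ _ sx sy.
have bF := nb_bij nF.
have [s1 e1] := sphere_invP (bF l.1) sx; have [s2 e2] := sphere_invP (bF l.1) sy.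
by have [_] := key _ _ s1 s2; rewrite e1 e2.
Qed.

Lemma wact_near w x (e' : R) : sphere x -> 0 < e' -> exists2 eps : R, 0 < eps &
  forall F, nb eps F -> enorm (wact F w x - wact f w x) <= e'.
Proof.
move=> sx; have [K K1 [e0 e00 hK]] := nb_bilip.
have K0 : 0 < K by apply: lt_le_trans K1.
elim: w e' => [|l w IH] e' e'0; first by exists 1 => // F _ /=; rewrite subrr enorm0 ltW.
have d0 : 0 < e' / (2 * K) by rewrite divr_gt0// mulr_gt0.
have [e1 e10 h1] := IH _ d0.
exists (Num.min e0 (Num.min e1 (e' / (2 * K)))); first by rewrite !lt_min e00 e10.
move=> F nF /=.
have {}h1 : enorm (wact F w x - wact f w x) <= e' / (2 * K).
  by apply/h1/(nb_le _ nF); rewrite !ge_min lexx orbT.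
have {}hK : forall l, lipS K (lact F l) by apply/hK/(nb_le _ nF); rewrite ge_min lexx.
have {}nF : nb (e' / (2 * K)) F by apply: nb_le nF; rewrite !ge_min lexx !orbT.
set e2 := e' / _ in h1 nF d0; have Ke2 : K * e2 = e' / 2.
  by rewrite /e2; field; rewrite gt_eqF.
have bF := nb_bij nF.
have sb : sphere (wact f w x) by apply: wact_sphere.
have sa : sphere (wact F w x) by apply: wact_sphere.
set a := wact F w x in h1 sa *; set b := wact f w x in h1 sb *.
apply: (le_trans (ler_enorm_add (lact F l b) _ _)).
have h2 : enorm (lact F l a - lact F l b) <= e' / 2.
  rewrite -Ke2; apply: le_trans (hK l _ _ sa sb) _; rewrite ler_pM2l//.
have h3 : enorm (lact F l b - lact f l b) <= K * e2.
  rewrite /lact; case E : l.2.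
    have [_ [h _]] := nF l.1; apply: (le_trans (h _ sb)).
    by rewrite ler_peMl// ltW.
  (* With b = f b', the two inverses at b are F^-1 (f b') and b' = F^-1 (F b'), which the Lipschitz
     bound of F^-1 compares. *)
  have [s2 e3] := sphere_invP (bij_f l.1) sb.
  set b' := sphere_inv (f l.1) b in s2 e3 *.
  rewrite -{1}e3 -{2}(sphere_invK (bF l.1) s2).
  have := hK (l.1, false) _ _ ((bij_f l.1).1 _ s2) ((bF l.1).1 _ s2).
  rewrite /lact /= => h; apply: le_trans h _.
  rewrite ler_pM2l// enorm_distC; have [_ [h' _]] := nF l.1; exact: h'.
move: h2 h3; rewrite Ke2; lra.
Qed.

End Words.

Section Reach.
Context {R : realType} {n : nat}.
Local Notation V := 'cV[R]_n.+1.
Implicit Types (x y z v : V) (L M : 'M[R]_n.+1) (g h : V -> V).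
Variables (I : finType) (f : I -> V -> V).
Implicit Types (F : I -> V -> V) (w : seq (I * bool)).

(* L is the derivative along the sphere at x, up to an arbitrarily small error, of some
   word whose perturbations share this property on a common neighbourhood of x. *)
Definition reach x x' L : Prop := forall e' : R, 0 < e' ->
  exists w, exists2 eps : R, 0 < eps & exists2 rho : R, 0 < rho &
  forall F, nb f eps F -> forall y z, sphere y -> sphere z ->
    enorm (y - x) <= rho -> enorm (z - x) <= rho ->
    enorm (wact F w y - x') <= e' /\
    enorm (wact F w y - wact F w z - L *m (y - z)) <= e' * enorm (y - z).

(** The chain rule for strict derivatives. The neighbourhood is uniform in F because the error [e1]
    of the first word makes it land in the ball where the second word is controlled. *)
Lemma reach_comp x x' x'' L L' :
  reach x x' L -> reach x' x'' L' -> reach x x'' (L' *m L).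
Proof.
move=> r1 r2 e' e'0.
have [K1 K11 hK1] := mulmx_bound L; have [K2 K21 hK2] := mulmx_bound L'.
have p1 : 0 < 2 * (K1 + 1) by rewrite mulr_gt0// addr_gt0// (lt_le_trans ltr01).
have p2 : 0 < 2 * K2 by rewrite mulr_gt0// (lt_le_trans ltr01).
have [|w2 [eps2 eps20 [rho2 rho20 h2]]] := r2 (e' / (2 * (K1 + 1))); first exact: divr_gt0.
pose e1 := Num.min rho2 (Num.min 1 (e' / (2 * K2))).
have e10 : 0 < e1 by rewrite !lt_min rho20 ltr01 divr_gt0.
have [w1 [eps1 eps10 [rho1 rho10 h1]]] := r1 _ e10.
exists (w2 ++ w1); exists (Num.min eps1 eps2); first by rewrite lt_min eps10.
exists rho1 => // F nF y z sy sz yx zx.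
have nF1 : nb f eps1 F by apply: nb_le nF; rewrite ge_min lexx.
have nF2 : nb f eps2 F by apply: nb_le nF; rewrite ge_min lexx orbT.
have bF := nb_bij nF1.
have [a1 a2] := h1 _ nF1 _ _ sy sz yx zx; have [b1 _] := h1 _ nF1 _ _ sz sy zx yx.
rewrite !wact_cat; have sa := wact_sphere w1 bF sy; have sb := wact_sphere w1 bF sz.
move: (wact F w1 y) (wact F w1 z) sa sb a1 a2 b1 => a b sa sb a1 a2 b1.
have [e1r [e11 e1K]] : e1 <= rho2 /\ e1 <= 1 /\ e1 <= e' / (2 * K2).
  by rewrite /e1 !ge_min !lexx !orbT.
have [c1 c2] := h2 _ nF2 _ _ sa sb (le_trans a1 e1r) (le_trans b1 e1r).
have K1e : (K1 + 1) * (e' / (2 * (K1 + 1))) = e' / 2 by field; rewrite gt_eqF// -(pmulr_rgt0 _ (ltr0Sn R 1)).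
have K2e : K2 * (e' / (2 * K2)) = e' / 2 by field; rewrite gt_eqF// -(pmulr_rgt0 _ (ltr0Sn R 1)).
move: (e' / (2 * (K1 + 1))) (e' / (2 * K2)) K1e K2e e1K c1 c2 => e2 e3 K1e K2e e1K c1 c2.
have e20 : 0 <= e2 by apply: le_trans c1; exact: enorm_ge0.
split; first by apply: (le_trans c1); nra.
have d0 := enorm_ge0 (y - z).
apply: (le_trans (ler_enorm_add (L' *m (a - b)) _ _)).
rewrite -mulmxA -mulmxBr; apply: (le_trans (lerD c2 (hK2 _))).
have h3 : enorm (a - b) <= (K1 + 1) * enorm (y - z).
  have h4 := ler_enormD (a - b - L *m (y - z)) (L *m (y - z)); rewrite subrK in h4.
  have h5 := hK1 (y - z); apply: (le_trans h4); rewrite mulrDl mul1r addrC lerD//.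
  by apply: (le_trans a2); rewrite ler_piMl.
have h6 : e2 * enorm (a - b) <= e' / 2 * enorm (y - z).
  by rewrite -K1e (mulrC (K1 + 1)) -mulrA ler_wpM2l.
have h7 : K2 * enorm (a - b - L *m (y - z)) <= e' / 2 * enorm (y - z).
  rewrite -K2e -mulrA ler_wpM2l; [by []|lra|].
  by apply: (le_trans a2); rewrite ler_wpM2r.
lra.
Qed.

Lemma reach_letter o x L : sphere x ->
  (exists K : R, lipS K (f o)) ->
  (forall e : R, 0 < e -> exists2 rho : R, 0 < rho & forall y z, sphere y -> sphere z ->
    enorm (y - x) <= rho -> enorm (z - x) <= rho ->
    enorm (f o y - f o z - L *m (y - z)) <= e * enorm (y - z)) ->
  reach x (f o x) L.
Proof.
move=> sx [K hK] h e' e'0; exists [:: (o, true)].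
have e20 : 0 < e' / 2 by rewrite divr_gt0.
have [rho rho0 hr] := h _ e20; exists (e' / 2) => //.
pose K' := Num.max K 1; have K'0 : 0 < K' by rewrite lt_max ltr01 orbT.
exists (Num.min rho (e' / 2 / K')); first by rewrite lt_min rho0 divr_gt0.
move=> F nF y z sy sz; rewrite !le_min => /andP[yr yK] /andP[zr zK] /=.
have [bo [l1 l2]] := nF o; rewrite /lact /=; split.
  apply: (le_trans (ler_enorm_add (f o y) _ _)).
  have := l1 _ sy; have := hK _ _ sy sx.
  have : K * enorm (y - x) <= e' / 2.
    rewrite ler_pdivlMr// in yK; apply: le_trans yK.
    by rewrite mulrC ler_wpM2l ?enorm_ge0// le_max lexx.
  lra.
have := hr _ _ sy sz yr zr; have := l2 _ _ sy sz.
move: (L *m _) => u; rewrite subvACA => h1 h2.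
have := ler_enormD (F o y - F o z - (f o y - f o z)) (f o y - f o z - u).
rewrite subrKA; lra.
Qed.

Definition orthogonal M : Prop := M^T *m M = 1%:M.

(* Isometries uniformly approximated, in the Lipschitz sense, by all perturbations of a word. *)
Definition LCword M : Prop := orthogonal M /\ exists w, forall e : R, 0 < e ->
  exists2 eps : R, 0 < eps & forall F, nb f eps F -> LC e (wact F w) (mulmx M).

Lemma orthogonal1 : orthogonal 1%:M.
Proof. by rewrite /orthogonal trmx1 mul1mx. Qed.

Lemma orthogonalM M L : orthogonal M -> orthogonal L -> orthogonal (M *m L).
Proof.
by rewrite /orthogonal => hM hL; rewrite trmx_mul -mulmxA (mulmxA _ M) hM mul1mx.
Qed.

Lemma orthogonal_unit M : orthogonal M -> M \in unitmx.
Proof. by move=> h; have [] := mulmx1_unit h. Qed.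

Lemma orthogonal_inv M : orthogonal M -> invmx M = M^T.
Proof.
move=> h; have uM := orthogonal_unit h.
by rewrite -[LHS]mul1mx -h -mulmxA mulmxV// mulmx1.
Qed.

Lemma orthogonal_invmx M : orthogonal M -> orthogonal (invmx M).
Proof.
move=> h; rewrite /orthogonal orthogonal_inv// trmxK -orthogonal_inv// mulmxV//.
exact: orthogonal_unit.
Qed.

Lemma LCword1 : LCword 1%:M.
Proof.
split; first exact: orthogonal1.
exists [::] => e e0; exists 1 => // F _; split=> [x _|x y _ _] /=; rewrite !mul1mx.
  by rewrite subrr enorm0 ltW.
by rewrite !subrr enorm0 mulr_ge0 ?enorm_ge0 ?ltW.
Qed.

(** Isometries do not enlarge the error made by the right factor, so errors merely add up along a
    word. *)
Lemma LCwordM M L : LCword M -> LCword L -> LCword (M *m L).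
Proof.
move=> [oM [w1 h1]] [oL [w2 h2]]; split; first exact: orthogonalM.
exists (w1 ++ w2) => e e0; pose e1 := Num.min 1 (e / 3).
have e10 : 0 < e1 by rewrite lt_min ltr01 divr_gt0.
have [eps1 eps10 {}h1] := h1 _ e10; have [eps2 eps20 {}h2] := h2 _ e10.
exists (Num.min eps1 eps2); first by rewrite lt_min eps10.
move=> F nF.
have [|a1 a2] := h1 F; first by apply: nb_le nF; rewrite ge_min lexx.
have [|b1 b2] := h2 F; first by apply: nb_le nF; rewrite ge_min lexx orbT.
have bF := nb_bij nF.
have [e11 e13] : e1 <= 1 /\ e1 <= e / 3 by rewrite /e1 !ge_min !lexx orbT.
have E x : wact F (w1 ++ w2) x - M *m L *m x =
   (wact F w1 (wact F w2 x) - M *m wact F w2 x) + M *m (wact F w2 x - L *m x).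
  by rewrite wact_cat -mulmxA mulmxBr subrKA.
split=> [x sx|x y sx sy]; rewrite !E.
  apply: (le_trans (ler_enormD _ _)); rewrite (orthogonal_enorm _ oM).
  have := a1 _ (wact_sphere w2 bF sx); have := b1 _ sx; lra.
have h3 := a2 _ _ (wact_sphere w2 bF sx) (wact_sphere w2 bF sy); have h4 := b2 _ _ sx sy.
rewrite opprD addrACA -mulmxBr; apply: (le_trans (ler_enormD _ _)).
rewrite (orthogonal_enorm _ oM).
have h5 := ler_enormD (wact F w2 x - L *m x - (wact F w2 y - L *m y)) (L *m x - L *m y).
rewrite {1}subvACA subrK -mulmxBr (orthogonal_enorm _ oL) in h5.
have d0 := enorm_ge0 (x - y).
have : e1 * enorm (wact F w2 x - wact F w2 y) <= e1 * (2 * enorm (x - y)).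
  rewrite ler_pM2l//; have := ler_piMl d0 e11; lra.
have := ler_piMl (mulr_ge0 (ltW e10) d0) e11; have := ler_wpM2r d0 e13; lra.
Qed.

Lemma LCword_letter o M : orthogonal M -> (forall x, sphere x -> f o x = M *m x) -> LCword M.
Proof.
move=> oM fM; split=> //; exists [:: (o, true)] => e e0; exists e => // F nF.
have [_ [h1 h2]] := nF o; split=> [x sx|x y sx sy]; rewrite /= /lact/= -!fM//.
  exact: h1.
exact: h2.
Qed.

Lemma LCword_inv_letter o M : orthogonal M -> (forall x, sphere x -> f o x = M *m x) ->
  LCword (invmx M).
Proof.
move=> oM fM; split; first exact: orthogonal_invmx.
exists [:: (o, false)] => e e0; pose e1 := Num.min 2^-1 (e / 2).
have e10 : 0 < e1 by rewrite lt_min invr_gt0 ltr0n divr_gt0.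
have [e11 e13] : e1 <= 2^-1 /\ e1 <= e / 2 by rewrite /e1 !ge_min !lexx orbT.
exists e1 => // F nF; have [bo [h1 h2]] := nF o.
have uM := orthogonal_unit oM; have oI := orthogonal_invmx oM.
(* The error of F^-1 at x is, up to sign and the isometry M^-1, the error of F at the preimage of
   x. *)
have E x : sphere x -> exists2 y, sphere y & F o y = x /\
    wact F [:: (o, false)] x - invmx M *m x = - (invmx M *m (F o y - f o y)).
  move=> sx; have [s e2] := sphere_invP bo sx; exists (sphere_inv (F o) x) => //; split => //.
  by rewrite /= /lact/= fM// mulmxBr mulKmx// opprB e2.
split=> [x sx|x y sx sy].
  have [a sa [_ ->]] := E _ sx; rewrite enormN (orthogonal_enorm _ oI).
  by apply: (le_trans (h1 _ sa)); lra.
have [a sa [ea ->]] := E _ sx; have [b sb [eb ->]] := E _ sy.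
rewrite opprK addrC -mulmxBr (orthogonal_enorm _ oI) [leLHS]enorm_distC.
have h3 := h2 _ _ sa sb; apply: (le_trans h3).
rewrite subvACA ea eb in h3.
have h4 := ler_enormB (x - y) (x - y - (f o a - f o b)); rewrite subKr in h4.
rewrite {1}fM// {1}fM// -mulmxBr (orthogonal_enorm _ oM) in h4.
have d0 := enorm_ge0 (a - b); have d1 := enorm_ge0 (x - y).
have : enorm (a - b) <= 2 * enorm (x - y) by nra.
nra.
Qed.

(** A mere limit of words is still reached, because [reach] allows a different word for each
    error. *)
Lemma reach_orthogonal x M : orthogonal M -> sphere x ->
  (forall e : R, 0 < e -> exists2 L, LCword L & forall v, enorm ((L - M) *m v) <= e * enorm v) ->
  reach x (M *m x) M.
Proof.
move=> oM sx h e e0; have e30 : 0 < e / 3 by rewrite divr_gt0.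
have [L [oL [w hw]] hL] := h _ e30.
have [eps eps0 {}hw] := hw _ e30; exists w, eps => //; exists (e / 3) => //.
move=> F nF y z sy sz yx zx; have [h1 h2] := hw _ nF; split.
  apply: (le_trans (ler_enorm_add (L *m y) _ _)).
  have h3 := ler_enorm_add (M *m y) (L *m y) (M *m x).
  rewrite -mulmxBl -mulmxBr (orthogonal_enorm _ oM) in h3.
  have := h1 _ sy; have := hL y; rewrite sy; lra.
have := h2 _ _ sy sz; rewrite subvACA -mulmxBr => h3.
apply: (le_trans (ler_enorm_add (L *m (y - z)) _ _)); rewrite -mulmxBl.
have := hL (y - z); have := mulr_ge0 (ltW e0) (enorm_ge0 (y - z)); lra.
Qed.

End Reach.

(** * Rotations built from reflections, and contraction transverse to a fixed vector *)

Section LinearAlgebra.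
Context {R : realType} {n : nat}.
Local Notation V := 'cV[R]_n.+1.
Implicit Types (x y z v e c u : V) (A M P Q : 'M[R]_n.+1).

Lemma sphere_net (X : set V) (delta : R) : X `<=` @sphere R n -> 0 < delta ->
  exists s : seq V, (forall y, y \in s -> X y) /\
    forall x, X x -> exists2 y, y \in s & enorm (x - y) <= delta.
Proof.
move=> XS d0; pose q := delta / n.+1%:R; have q0 : 0 < q by rewrite divr_gt0.
pose N := Num.truncn (2 / q).
(* Points are sorted by the grid cell of mesh [q] containing them, and one point of [X] is kept per
   occupied cell; the factor [n.+1] in [q] pays for passing from the maximum norm to the Euclidean
   one. *)
pose phi x : {ffun 'I_n.+1 -> 'I_N.+1} := [ffun i => inord (Num.truncn ((x i ord0 + 1) / q))].
pose rep a := xget 0 [set x | X x /\ phi x = a].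
exists [seq rep a | a <- [seq a <- enum {ffun 'I_n.+1 -> 'I_N.+1} | `[< exists x, X x /\ phi x = a >]]].
split=> [y /mapP[a + ->]|x Xx].
  rewrite mem_filter => /andP[/asboolP[x hx] _].
  by rewrite /rep; case: xgetP => [z _ []//|/(_ x)].
have [Xr er] : X (rep (phi x)) /\ phi (rep (phi x)) = phi x.
  by rewrite /rep; case: xgetP => [z _ //|/(_ x)[]].
exists (rep (phi x)).
  apply/mapP; exists (phi x) => //; rewrite mem_filter mem_enum andbT.
  by apply/asboolP; exists x.
move: (rep _) Xr er => y Xy /ffunP e.
apply: (le_trans (enorm_le_mx _)); rewrite mulrC -ler_pdivlMr ?ltr0n//.
apply: mx_le_coord; first exact: ltW.
move=> i; move: (e i); rewrite !ffunE => /(congr1 val); rewrite /= !inordK; last 2 first.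
- rewrite ltnS; apply: le_truncn.
  rewrite ler_pM2r ?invr_gt0//; have := coord_le_enorm x i.
  by rewrite (XS _ Xx) ler_norml; lra.
- rewrite ltnS; apply: le_truncn.
  rewrite ler_pM2r ?invr_gt0//; have := coord_le_enorm y i.
  by rewrite (XS _ Xy) ler_norml; lra.
have P z : X z -> 0 <= (z i ord0 + 1) / q.
  move=> Xz; rewrite divr_ge0 ?(ltW q0)//; have := coord_le_enorm z i.
  by rewrite (XS _ Xz) ler_norml; lra.
have /andP[x1 x2] := truncn_itv (P _ Xx); have /andP[y1 y2] := truncn_itv (P _ Xy).
move=> ee; rewrite ee in y1 y2; rewrite !mxE ler_norml.
move: x1 x2 y1 y2; rewrite ler_pdivlMr// ltr_pdivrMr// ler_pdivlMr// ltr_pdivrMr//.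
rewrite -natr1; move: (_%:R) => t; rewrite -/q; lra.
Qed.

Lemma mulmx_ext M P : (forall v, M *m v = P *m v) -> M = P.
Proof.
move=> h; apply/matrixP => i j.
by have := congr1 (fun u : V => u i ord0) (h (delta_mx j ord0)); rewrite -!colE !mxE.
Qed.

Definition householder c : 'M[R]_n.+1 := 1%:M - 2 *: (c *m c^T).

Lemma householderE c v : householder c *m v = v - (2 * dot c v) *: c.
Proof.
rewrite mulmxBl mul1mx -scalemxAl -mulmxA -scalerA; congr (_ - _ *: _).
by rewrite [c^T *m v]mx11_scalar mul_mx_scalar.
Qed.

Lemma householder_tr c : (householder c)^T = householder c.
Proof. by rewrite /householder linearB linearZ/= trmx1 trmx_mul trmxK. Qed.

Lemma householderK c : sphere c -> householder c *m householder c = 1%:M.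
Proof.
move=> sc; apply: mulmx_ext => v; rewrite mul1mx -mulmxA !householderE.
rewrite dotBr dotZr sphere_dot// mulr1 -addrA -opprD -scalerDl.
have -> : 2 * dot c v + 2 * (dot c v - 2 * dot c v) = 0 by lra.
by rewrite scale0r subr0.
Qed.

Lemma householder_orthogonal c : sphere c -> orthogonal (householder c).
Proof. by move=> sc; rewrite /orthogonal householder_tr householderK. Qed.

Lemma householder_swap x y : sphere x -> sphere y -> x != y ->
  householder (unitv (x - y)) *m x = y.
Proof.
move=> sx sy xy; rewrite householderE /unitv dotZl scalerA.
have n0 : enorm (x - y) != 0 by rewrite enorm_eq0 subr_eq0.
have e : enorm (x - y) ^+ 2 = 2 * dot (x - y) x.
  rewrite enorm_sq dotBr !dotBl !sphere_dot// (dotC y x); lra.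
have -> : 2 * ((enorm (x - y))^-1 * dot (x - y) x) * (enorm (x - y))^-1 = 1.
  have -> : dot (x - y) x = enorm (x - y) ^+ 2 / 2 by rewrite e; lra.
  by field.
by rewrite scale1r subKr.
Qed.

(** Two reflections are conjugate by the reflection exchanging their axes. Hence a product of two
    has determinant 1, without computing the determinant of either. *)
Lemma det_householder c c' : sphere c -> sphere c' ->
  \det (householder c) = \det (householder c').
Proof.
move=> sc sc'; have [->//|cc'] := eqVneq c c'.
set Q := householder (unitv (c - c')).
have su : sphere (unitv (c - c')) by apply: unitv_sphere; rewrite subr_eq0.
have QQ : Q *m Q = 1%:M by apply: householderK.
have Qc : Q *m c = c' by apply: householder_swap.
have -> : householder c' = Q *m householder c *m Q.
  apply: mulmx_ext => v; rewrite -!mulmxA [in RHS]householderE mulmxBr -scalemxAr Qc.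
  rewrite mulmxA QQ mul1mx householderE -Qc dot_mulmxl.
  by rewrite /Q householder_tr.
by rewrite !det_mulmx mulrAC -det_mulmx QQ det1 mul1r.
Qed.

Lemma householder2_SO c c' : sphere c -> sphere c' -> SO (householder c *m householder c').
Proof.
move=> sc sc'; split; first by apply: orthogonalM; exact: householder_orthogonal.
by rewrite det_mulmx (det_householder sc sc') -det_mulmx householderK// det1.
Qed.

Lemma SO1 : SO (1%:M : 'M[R]_n.+1).
Proof. by split; [exact: orthogonal1 | exact: det1]. Qed.

(** The reflection exchanging [v] and [v0] fixes [e]; a second one, along [v0], restores the
    determinant and reverses the sign. The sign cannot be prescribed: in the plane only the identity
    is a rotation fixing [e]. *)
Lemma rotation_fixing e v v0 : sphere v -> sphere v0 -> dot e v = 0 -> dot e v0 = 0 ->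
  exists Q, SO Q /\ Q *m e = e /\ (Q *m v = v0 \/ Q *m v = - v0).
Proof.
move=> sv sv0 ev ev0; have [->|vv0] := eqVneq v v0.
  by exists 1%:M; rewrite !mul1mx; split; [exact: SO1|split => //; left].
have su : sphere (unitv (v - v0)) by apply: unitv_sphere; rewrite subr_eq0.
exists (householder v0 *m householder (unitv (v - v0))); split; first exact: householder2_SO.
rewrite -!mulmxA householder_swap//; split; last first.
  right; rewrite householderE sphere_dot// mulr1.
  by rewrite scaler_nat mulr2n opprD addrA subrr add0r.
have -> : householder (unitv (v - v0)) *m e = e.
  by rewrite householderE dotZl dotBl !(dotC _ e) ev ev0 subr0 !mulr0 scale0r subr0.
by rewrite householderE dotC ev0 mulr0 scale0r subr0.
Qed.

Lemma exists_orthogonal_vector (hn : (1 <= n)%N) y : exists2 c, sphere c & dot c y = 0.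
Proof.
have [i1 i1v] : exists i : 'I_n.+1, val i = 1%N by exists (Ordinal (hn : (1 < n.+1)%N)).
have i10 : i1 != ord0 by rewrite -val_eqE /= i1v.
pose d (i : 'I_n.+1) : V := delta_mx i ord0.
have dE i x : dot (d i) x = x i ord0.
  rewrite dotE (bigD1 i)//= big1 ?addr0 => [|j ji].
    by rewrite mxE !eqxx mul1r.
  by rewrite mxE (negbTE ji) mul0r.
suff [c c0 cy] : exists2 c, c != 0 & dot c y = 0.
  by exists (unitv c); [exact: unitv_sphere | rewrite dotZl cy mulr0].
have [y0|y0] := eqVneq (y ord0 ord0) 0.
  exists (d ord0); last by rewrite dE.
  by apply/eqP => /matrixP/(_ ord0 ord0)/eqP; rewrite !mxE !eqxx oner_eq0.
exists (y i1 ord0 *: d ord0 - y ord0 ord0 *: d i1).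
  apply/eqP => /matrixP/(_ i1 ord0)/eqP; rewrite !mxE !eqxx (negbTE i10) mulr0 mulr1 add0r.
  by rewrite oppr_eq0 (negbTE y0).
by rewrite dotBl !dotZl !dE mulrC subrr.
Qed.

(** The reflection taking [x] to [y] is corrected by one along a vector orthogonal to [y], which
    exists because the ambient dimension is at least 2. *)
Lemma rotation_transitive (hn : (1 <= n)%N) x y : sphere x -> sphere y ->
  exists2 Q, SO Q & Q *m x = y.
Proof.
move=> sx sy; have [->|xy] := eqVneq x y.
  by exists 1%:M; [exact: SO1 | rewrite mul1mx].
have [c sc cy] := exists_orthogonal_vector hn y.
exists (householder c *m householder (unitv (x - y))).
  by apply: householder2_SO => //; apply: unitv_sphere; rewrite subr_eq0.
by rewrite -mulmxA householder_swap// householderE cy mulr0 scale0r subr0.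
Qed.

(* Contracts one net point of the unit sphere of e^perp after another: rotate its
   current image onto +-v0 and apply M again. *)
Lemma contraction_on_perp (Pr : 'M[R]_n.+1 -> Prop) e M v0 :
  sphere e -> sphere v0 -> dot e v0 = 0 -> enorm (M *m v0) < 1 ->
  M *m e = e -> (forall v, dot e (M *m v) = dot e v) ->
  (forall v, enorm (M *m v) <= enorm v) ->
  Pr 1%:M -> (forall P, Pr P -> Pr (M *m P)) ->
  (forall Q P, SO Q -> Q *m e = e -> Pr P -> Pr (Q *m P)) ->
  exists P, exists2 c : R, 0 < c < 1 &
    Pr P /\ P *m e = e /\ forall v, dot e v = 0 -> enorm (P *m v) <= c * enorm v.
Proof.
move=> se sv0 ev0 Mv0 Me eM Mle P1 PM PQ.
(* The 6 leaves room below: if |P y| >= 1 - 2 delta, then each v within delta of y has P v within 3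
   delta of the unit vector along P y, and the rotation followed by M brings it to norm at most 1 -
   6 delta + 3 delta. *)
pose delta := (1 - enorm (M *m v0)) / 6.
have Mv0_ge0 := enorm_ge0 (M *m v0).
have d0 : 0 < delta by rewrite divr_gt0// subr_gt0.
have dE : enorm (M *m v0) = 1 - 6 * delta by rewrite /delta; lra.
pose X := [set v | sphere v /\ dot e v = 0].
have XS : X `<=` @sphere R n by move=> v [].
have [s [sX sn]] := sphere_net XS d0.
suff [P [PP [Pe [eP [Ple Pc]]]]] : exists P, Pr P /\ P *m e = e /\
    (forall v, dot e (P *m v) = dot e v) /\ (forall v, enorm (P *m v) <= enorm v) /\
    forall v, X v -> (exists2 y, y \in s & enorm (v - y) <= delta) ->
      enorm (P *m v) <= 1 - delta.
  exists P, (1 - delta); first by lra.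
  split => //; split => // v ev; have [->|vn0] := eqVneq v 0.
    by rewrite mulmx0 enorm0 mulr0.
  rewrite -{1}(scale_unitv v) -scalemxAr enormZ ger0_norm ?enorm_ge0// mulrC.
  have Xu : X (unitv v) by split; [exact: unitv_sphere | rewrite dotZr ev mulr0].
  by rewrite ler_pM2r ?enorm_gt0//; apply: Pc => //; exact: sn.
clear sn; elim: s sX => [|y s IH] sX.
  exists 1%:M; split => //; rewrite mul1mx; split => //.
  by split=> [v|]; [rewrite mul1mx | split=> v; [rewrite mul1mx | move=> _ []]].
have [z zs|P [PP [Pe [eP [Ple Pc]]]]] := IH; first by apply: sX; rewrite in_cons zs orbT.
have [sy ey] : X y by apply: sX; rewrite mem_head.
(* If P already shrinks the net point y, nothing is composed; otherwise P y is nearly a unit vector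
   and is rotated onto the contracted direction. *)
have [Py|Py] := ltP (enorm (P *m y)) (1 - 2 * delta).
  exists P; do 4!split => //; move=> v Xv [z]; rewrite in_cons => /orP[/eqP -> vy|zs vz].
    have := ler_enorm_add (P *m y) (P *m v) 0; rewrite !subr0 -mulmxBr.
    have := Ple (v - y); lra.
  by apply: Pc => //; exists z.
have Py0 : P *m y != 0 by rewrite -enorm_gt0; lra.
have su := unitv_sphere Py0.
have [|Q [SQ [Qe Qu]]] := rotation_fixing su sv0 _ ev0.
  by rewrite dotZr eP ey mulr0.
have oQ : orthogonal Q by case: SQ.
exists (M *m (Q *m P)); split; first exact/PM/PQ.
split; first by rewrite -!mulmxA Pe Qe.
split=> [v|].
  by rewrite -!mulmxA eM -{1}Qe (orthogonal_dot _ _ oQ) eP.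
have le' v : enorm (M *m (Q *m P) *m v) <= enorm (P *m v).
  by rewrite -!mulmxA; apply: (le_trans (Mle _)); rewrite orthogonal_enorm.
split=> [v|v Xv]; first exact: le_trans (le' _) (Ple _).
move=> [z]; rewrite in_cons => /orP[/eqP -> vy|zs vz]; last first.
  by apply: (le_trans (le' _)); apply: Pc => //; exists z.
have MQu : enorm (M *m (Q *m unitv (P *m y))) = 1 - 6 * delta.
  by rewrite -dE; case: Qu => ->; rewrite ?mulmxN ?enormN.
have := ler_enorm_add (M *m (Q *m unitv (P *m y))) (M *m (Q *m (P *m v))) 0.
rewrite !subr0 MQu -!mulmxBr -!mulmxA => h1.
have h2 := Mle (Q *m (P *m v - unitv (P *m y))).
rewrite (orthogonal_enorm _ oQ) in h2.
have h3 := ler_enorm_add (P *m y) (P *m v) (unitv (P *m y)).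
rewrite -mulmxBr in h3; have h4 := Ple (v - y).
have : enorm (P *m y - unitv (P *m y)) = 1 - enorm (P *m y).
  rewrite -{1}(scale_unitv (P *m y)) -{2}(scale1r (unitv _)) -scalerBl enormZ su mulr1.
  have := Ple y; rewrite sy => h5.
  by rewrite distrC ger0_norm ?subr_ge0.
lra.
Qed.

End LinearAlgebra.

(** * Compactness and the direction of maximal stretch *)

Section Compactness.
Context {R : realType} {n : nat}.
Local Notation V := 'cV[R]_n.+1.
Implicit Types (x y z v e c u : V) (A M P Q : 'M[R]_n.+1).

Lemma lipschitz_continuous_at (U W : normedModType R) (g : U -> W) (K d : R) (p : U) :
  0 < d -> (forall q, `|p - q| < d -> `|g p - g q| <= K * `|p - q|) -> {for p, continuous g}.
Proof.
move=> d0 h; apply/cvgrPdist_le => e e0.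
pose K' := `|K| + 1; have K'0 : 0 < K' by rewrite ltr_wpDl.
near=> q.
have xy : `|p - q| <= e / K'.
  by near: q; apply: cvgr_dist_le; [exact: cvg_id | rewrite divr_gt0].
apply: le_trans (h _ _) _.
  by near: q; apply: cvgr_dist_lt => //; exact: cvg_id.
rewrite ler_pdivlMr// in xy; apply: le_trans xy.
rewrite mulrC ler_wpM2l// (le_trans (ler_norm _))// lerDl//.
Unshelve. all: by end_near. Qed.

Lemma lipschitz_continuous (U W : normedModType R) (g : U -> W) (K : R) :
  (forall p q, `|g p - g q| <= K * `|p - q|) -> continuous g.
Proof. by move=> h p; apply: (@lipschitz_continuous_at _ _ _ K 1). Qed.

Lemma continuous_enorm : continuous (@enorm R n).
Proof.
apply: (@lipschitz_continuous _ _ _ n.+1%:R) => x y.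
exact: le_trans (ler_enorm_dist _ _) (enorm_le_mx _).
Qed.

Lemma continuous_mulmx A : continuous (mulmx A : V -> V).
Proof.
have [K K1 hK] := mulmx_bound A.
apply: (@lipschitz_continuous _ _ _ (K * n.+1%:R)) => x y.
rewrite -mulmxBr; apply: (le_trans (mx_le_enorm _)); apply: (le_trans (hK _)).
by rewrite -mulrA ler_wpM2l ?enorm_le_mx// (le_trans ler01).
Qed.

Lemma norm_trmx m p (x : 'M[R]_(m.+1, p.+1)) : `|x^T| = `|x|.
Proof.
have le m' p' (y : 'M[R]_(m'.+1, p'.+1)) : `|y^T| <= `|y|.
  rewrite [leLHS]/Num.norm/= mx_normrE; apply/bigmax_leP; split; first exact: normr_ge0.
  move=> [i j] _ /=; rewrite mxE [leRHS]/Num.norm/= mx_normrE.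
  exact: (le_bigmax _ (fun ij : 'I_m'.+1 * 'I_p'.+1 => `|y ij.1 ij.2|) (j, i)).
by apply/eqP; rewrite eq_le le -{1}(trmxK x) le.
Qed.

Lemma compact_cV (K : set V) (M : R) : closed K -> (forall x, K x -> enorm x <= M) ->
  compact K.
Proof.
move=> cK bK.
have ct m p : continuous (@trmx R m.+1 p.+1).
  by apply: (@lipschitz_continuous _ _ _ 1) => x y; rewrite -linearB/= norm_trmx mul1r.
have -> : K = (@trmx R _ _) @` [set v : 'rV[R]_n.+1 | K v^T].
  apply/seteqP; split=> [x Kx|_ [v Kv <-]//].
  by exists x^T; rewrite /= trmxK.
apply: continuous_compact; first by apply: continuous_subspaceT; exact: ct.
apply: bounded_closed_compact; last by apply: preimage_closed => // v _; exact: ct.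
exists M; split; first exact: num_real.
move=> t Mt v /= Kv; apply: le_trans (ltW Mt); rewrite -norm_trmx.
by apply: le_trans (bK _ Kv); exact: mx_le_enorm.
Qed.

Lemma closed_sphere : closed (@sphere R n).
Proof.
have -> : @sphere R n = @enorm R n @^-1` [set 1] by [].
by apply: preimage_closed => [x _|]; [exact: continuous_enorm | exact: closed_eq].
Qed.

Lemma compact_sphere : compact (@sphere R n).
Proof. by apply: (@compact_cV _ 1); [exact: closed_sphere | move=> x ->]. Qed.

Lemma sphere_delta : sphere (delta_mx ord0 ord0 : V).
Proof.
rewrite /sphere/= enormE dotE (bigD1 ord0)//= big1 => [|i i0].
  by rewrite mxE !eqxx mulr1 addr0 sqrtr1.
by rewrite mxE (negbTE i0) mul0r.
Qed.

Lemma exists_max_stretch A : exists2 e : V, sphere e &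
  forall v, enorm (A *m v) <= enorm (A *m e) * enorm v.
Proof.
have [||e] := @compact_EVT_max V R (fun v => enorm (A *m v)) (@sphere R n) _ compact_sphere.
- by exists (delta_mx ord0 ord0); exact: sphere_delta.
- apply: continuous_subspaceT => x; apply: continuous_comp; first exact: continuous_mulmx.
  exact: continuous_enorm.
rewrite inE => se h; exists e => // v; have [->|v0] := eqVneq v 0.
  by rewrite mulmx0 enorm0 mulr0.
rewrite -{1}(scale_unitv v) -scalemxAr enormZ ger0_norm ?enorm_ge0// mulrC.
rewrite ler_pM2r ?enorm_gt0//; apply: h; rewrite inE; exact: unitv_sphere.
Qed.

(* First order condition at the maximum of |A v| / |v|. *)
Lemma max_stretch_dot A e : sphere e ->
  (forall v, enorm (A *m v) <= enorm (A *m e) * enorm v) ->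
  forall v, dot (A *m e) (A *m v) = enorm (A *m e) ^+ 2 * dot e v.
Proof.
move=> se h v; set s := enorm (A *m e).
have key (t : R) : 0 <= t * (2 * (s ^+ 2 * dot e v - dot (A *m e) (A *m v))) +
    t ^+ 2 * (s ^+ 2 * dot v v - dot (A *m v) (A *m v)).
  have := h (e + t *: v); rewrite -/s -(ler_pXn2r (ltn0Sn 1)) ?nnegrE ?mulr_ge0 ?enorm_ge0//.
  rewrite exprMn !enorm_sq mulmxDr -scalemxAr.
  rewrite !(dotDl, dotDr, dotZl, dotZr) (dotC v e) (dotC (A *m v)) (sphere_dot se).
  rewrite -[dot (A *m e) (A *m e)]enorm_sq -/s -subr_ge0 => h1.
  by apply: le_trans h1 _; rewrite le_eqVlt; apply/orP; left; apply/eqP; ring.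
move: key; set b := s ^+ 2 * _ - _; set a := s ^+ 2 * dot v v - _ => key.
have a0 : 0 <= a.
  have := h v; rewrite -/s -(ler_pXn2r (ltn0Sn 1)) ?nnegrE ?mulr_ge0 ?enorm_ge0//.
  by rewrite exprMn (enorm_sq v) (enorm_sq (A *m v)) -subr_ge0.
suff : b = 0 by move/eqP; rewrite subr_eq0 => /eqP.
have k1 : 0 < a + 1 by rewrite ltr_wpDl.
(* Close to the minimum of the quadratic in t, with a + 1 in place of a to allow a = 0; the value
   there is negative unless b = 0. *)
have := key (- b / (a + 1)).
have -> : - b / (a + 1) * (2 * b) + (- b / (a + 1)) ^+ 2 * a =
  - (b / (a + 1)) ^+ 2 * (a + 2) by field; rewrite gt_eqF.
rewrite mulNr oppr_ge0 pmulr_lle0 ?ltr_wpDl// => h1.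
have /eqP : (b / (a + 1)) ^+ 2 = 0 by apply/eqP; rewrite eq_le h1 sqr_ge0.
by rewrite sqrf_eq0 mulf_eq0 invr_eq0 (gt_eqF k1) orbF => /eqP.
Qed.

End Compactness.

(** * The projective action of an invertible matrix *)

Section ProjectiveAction.
Context {R : realType} {n : nat}.
Local Notation V := 'cV[R]_n.+1.
Implicit Types (x y z v e c u : V) (A B M P Q : 'M[R]_n.+1).

Lemma unitmx_neq0 B : B \in unitmx -> forall y, y != 0 -> B *m y != 0.
Proof.
move=> uB y; apply: contra_neq => h.
by rewrite -(mulKmx uB y) h mulmx0.
Qed.

Lemma fA_sphere B : B \in unitmx -> forall x, sphere x -> sphere (fA B x).
Proof. by move=> uB x sx; apply/unitv_sphere/unitmx_neq0 => //; exact: sphere_neq0. Qed.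

Lemma fAK B : B \in unitmx -> forall x, sphere x -> fA (invmx B) (fA B x) = x.
Proof.
move=> uB x sx; rewrite /fA -!scalemxAr mulKmx// -!/(unitv _) unitvZ ?unitv_id//.
by rewrite invr_gt0 enorm_gt0 unitmx_neq0// sphere_neq0.
Qed.

Lemma fA_bijS B : B \in unitmx -> bijS (fA B).
Proof.
move=> uB; split; first exact: fA_sphere.
exists (fA (invmx B)); split; first by apply: fA_sphere; rewrite unitmx_inv.
move=> x sx; split; first exact: fAK.
by rewrite -{1}(invmxK B) fAK// unitmx_inv.
Qed.

Lemma unitmx_lower B : B \in unitmx -> exists2 m : R, 0 < m &
  forall v, m * enorm v <= enorm (B *m v).
Proof.
move=> uB; have [K K1 hK] := mulmx_bound (invmx B).
have K0 : 0 < K by apply: lt_le_trans K1.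
exists K^-1; first by rewrite invr_gt0.
by move=> v; rewrite ler_pdivrMl//; apply: le_trans (hK _); rewrite mulKmx.
Qed.

Lemma fA_lip B : B \in unitmx -> exists2 K : R, 0 <= K & lipS K (fA B).
Proof.
move=> uB; have [K K1 hK] := mulmx_bound B; have [m m0 hm] := unitmx_lower uB.
exists (2 * K / m); first by rewrite divr_ge0 ?mulr_ge0 ?ltW// (lt_le_trans ltr01).
move=> x y sx sy; apply: (le_trans (enorm_unitvB _ _)).
  by apply: unitmx_neq0 => //; exact: sphere_neq0.
have := hm x; rewrite sx mulr1 => mx; have mx0 := lt_le_trans m0 mx.
rewrite -mulmxBr; apply: (@le_trans _ _ (2 * (K * enorm (x - y)) / m)); last first.
  by rewrite le_eqVlt; apply/orP; left; apply/eqP; ring.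
by rewrite ler_pM ?invr_ge0 ?enorm_ge0 ?mulr_ge0 ?enorm_ge0 ?ler_pM2l// lef_pV2.
Qed.

Lemma fA_bilip B : B \in unitmx -> exists K : R, forall x y, sphere x -> sphere y ->
  enorm (fA B x - fA B y) <= K * enorm (x - y) /\
  enorm (x - y) <= K * enorm (fA B x - fA B y).
Proof.
move=> uB; have [K K0 hK] := fA_lip uB.
have [|K' K'0 hK'] := @fA_lip (invmx B); first by rewrite unitmx_inv.
exists (K + K') => x y sx sy; split.
  by apply: (le_trans (hK _ _ sx sy)); rewrite ler_wpM2r ?enorm_ge0// lerDl.
rewrite -{1}(fAK uB sx) -{1}(fAK uB sy).
apply: (le_trans (hK' _ _ (fA_sphere uB sx) (fA_sphere uB sy))).
by rewrite ler_wpM2r ?enorm_ge0// lerDr.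
Qed.

Lemma fA_orthogonal M x : orthogonal M -> sphere x -> fA M x = M *m x.
Proof. by move=> oM sx; rewrite /fA orthogonal_enorm// sx invr1 scale1r. Qed.

(* At a critical point of |B x| on the sphere the normalisation contributes only to
   second order, so B / s is the derivative of the projective action. *)
Lemma fA_strict_derivative B e (s : R) : B \in unitmx -> sphere e -> enorm (B *m e) = s ->
  (forall v, enorm (B *m v) <= s * enorm v) ->
  (forall v, dot (B *m e) (B *m v) = s ^+ 2 * dot e v) ->
  forall eta : R, 0 < eta -> exists2 rho : R, 0 < rho & forall y z, sphere y -> sphere z ->
    enorm (y - e) <= rho -> enorm (z - e) <= rho ->
    enorm (fA B y - fA B z - (s^-1 *: B) *m (y - z)) <= eta * enorm (y - z).
Proof.
move=> uB se sE hs hd eta eta0; have [m m0 hm] := unitmx_lower uB.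
have s0 : 0 < s by have := hm e; rewrite se mulr1 sE; exact: lt_le_trans.
(* The 4 is 1 + 3: the difference of 1/|B y| and 1/s contributes 1 ([i1]), that of 1/|B y| and 1/|B
   z| contributes 3 ([i2]). *)
pose C := 4 * s ^+ 2 / m ^+ 2; have C0 : 0 < C by rewrite divr_gt0 ?mulr_gt0 ?exprn_gt0.
exists (eta / C); first exact: divr_gt0.
move=> y z sy sz ye ze; set rho := eta / C in ye ze.
have etaE : eta = C * rho by rewrite /rho mulrCA mulfV ?mulr1// gt_eqF.
have rho0 : 0 < rho by exact: divr_gt0.
have mle x : sphere x -> m <= enorm (B *m x) by move=> sx; have := hm x; rewrite sx mulr1.
have ma := mle _ sy; have mb := mle _ sz; have ms := mle _ se; rewrite sE in ms.
set a := enorm (B *m y) in ma; set b := enorm (B *m z) in mb.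
have a0 := lt_le_trans m0 ma; have b0 := lt_le_trans m0 mb.
have d0 := enorm_ge0 (y - z).
have -> : fA B y - fA B z - (s^-1 *: B) *m (y - z) =
    (a^-1 - s^-1) *: (B *m (y - z)) + (a^-1 - b^-1) *: (B *m z).
  rewrite /fA -/a -/b -scalemxAl mulmxBr !scalerBr !scalerBl.
  apply/matrixP => i j; rewrite !mxE; ring.
have hBd := hs (y - z).
have as_ : `|a - s| <= s * rho.
  rewrite /a -sE; apply: (le_trans (ler_enorm_dist _ _)); rewrite -mulmxBr.
  by apply: (le_trans (hs _)); rewrite sE ler_pM2l.
have ab_ : `|a - b| <= 3 * s ^+ 2 * rho / m * enorm (y - z).
  (* Criticality of e turns |B y|^2 - |B z|^2 into the component of y - z along e, small by
     [dot_sphereB], plus the product of B (y - z) with the image of a vector of size 2 rho. *)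
  have E : (a - b) * (a + b) = 2 * (s ^+ 2 * dot e (y - z)) +
      dot (B *m (y - z)) (B *m ((y - e) + (z - e))).
    rewrite -subr_sqr /a /b !enorm_sq -hd.
    have -> : (y - e) + (z - e) = (y + z) - (e + e) by rewrite addrACA opprD.
    rewrite !(mulmxBr, mulmxDr) !(dotBl, dotBr, dotDl, dotDr) (dotC (B *m z) (B *m y)).
    rewrite (dotC (B *m y) (B *m e)) (dotC (B *m z) (B *m e)); ring.
  have h1 : `|(a - b) * (a + b)| <= 6 * s ^+ 2 * rho * enorm (y - z).
    rewrite E; apply: (le_trans (ler_normD _ _)).
    have h2 := dot_sphereB e sy sz; rewrite (enorm_distC e) (enorm_distC e z) in h2.
    have h3 := normr_dot (B *m (y - z)) (B *m ((y - e) + (z - e))).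
    have h4 := hs ((y - e) + (z - e)); have h5 := ler_enormD (y - e) (z - e).
    have h6 : enorm (B *m (y - z)) * enorm (B *m (y - e + (z - e))) <=
        (s * enorm (y - z)) * (s * (2 * rho)).
      rewrite ler_pM ?enorm_ge0//; apply: (le_trans h4); rewrite ler_pM2l//; lra.
    have h7 : `|dot e (y - z)| <= 2 * rho * enorm (y - z).
      by apply: (le_trans h2); rewrite ler_wpM2r//; lra.
    rewrite (normrM 2) (normrM (s ^+ 2)) (ger0_norm (sqr_ge0 s)) (ger0_norm (ler0n R 2)).
    have := ler_wpM2l (sqr_ge0 s) h7; lra.
  have ab0 : 0 < a + b by rewrite addr_gt0.
  rewrite normrM (gtr0_norm ab0) in h1.
  rewrite mulrAC ler_pdivlMr//; have := normr_ge0 (a - b); nra.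
apply: (le_trans (ler_enormD _ _)); rewrite !enormZ -/b.
have i1 : `|a^-1 - s^-1| * enorm (B *m (y - z)) <= s ^+ 2 / m ^+ 2 * rho * enorm (y - z).
  have -> : a^-1 - s^-1 = (s - a) / (a * s) by field; rewrite !gt_eqF.
  have as0 : 0 < a * s by exact: mulr_gt0.
  rewrite normrM distrC normfV (gtr0_norm as0).
  apply: (@le_trans _ _ (s * rho / (m * m) * (s * enorm (y - z)))).
    apply: ler_pM; [by rewrite mulr_ge0// invr_ge0 ltW|exact: enorm_ge0| |exact: hBd].
    apply: ler_pM; [exact: normr_ge0|by rewrite invr_ge0 ltW|exact: as_|].
    by rewrite lef_pV2 ?posrE ?mulr_gt0// ler_pM// ltW.
  by rewrite le_eqVlt; apply/orP; left; apply/eqP; field; rewrite gt_eqF.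
have i2 : `|a^-1 - b^-1| * b <= 3 * s ^+ 2 / m ^+ 2 * rho * enorm (y - z).
  have -> : `|a^-1 - b^-1| * b = `|a - b| / a.
    have -> : a^-1 - b^-1 = (b - a) / (a * b) by field; rewrite !gt_eqF.
    have abp : 0 < a * b by exact: mulr_gt0.
    by rewrite normrM distrC normfV (gtr0_norm abp); field; rewrite !gt_eqF.
  apply: (@le_trans _ _ (3 * s ^+ 2 * rho / m * enorm (y - z) / m)).
    by rewrite ler_pM ?invr_ge0 ?(ltW a0)// lef_pV2.
  by rewrite le_eqVlt; apply/orP; left; apply/eqP; field; rewrite gt_eqF.
have : eta = s ^+ 2 / m ^+ 2 * rho + 3 * s ^+ 2 / m ^+ 2 * rho by rewrite etaE /C; ring.
move=> ->; lra.
Qed.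

End ProjectiveAction.

(** * The contracting cover and its stability *)

Section Key.
Context {R : realType} {n k : nat}.
Local Notation V := 'cV[R]_n.+1.
Variables (A : 'I_k -> 'M[R]_n.+1) (A0 : 'M[R]_n.+1).
Implicit Types (x y z v e c u : V) (M P Q L : 'M[R]_n.+1) (F : option 'I_k -> V -> V).
Hypothesis hn : (1 <= n)%N.
Hypothesis SO_A : forall i, SO (A i).
Hypothesis dense_A : dense_in_SO A.
Hypothesis det_A0 : \det A0 = 1.
Hypothesis nSO_A0 : ~ SO A0.

Definition pact (o : option 'I_k) : V -> V := fA (gens A0 A o).

Lemma gens_unit o : gens A0 A o \in unitmx.
Proof.
rewrite unitmxE; case: o => [i|] /=; last by rewrite det_A0 unitr1.
by have [_ ->] := SO_A i; rewrite unitr1.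
Qed.

Lemma pact_bij : bijF pact.
Proof. by move=> o; exact/fA_bijS/gens_unit. Qed.

Lemma pact_bilip o : exists K : R, forall x y, sphere x -> sphere y ->
  enorm (pact o x - pact o y) <= K * enorm (x - y) /\
  enorm (x - y) <= K * enorm (pact o x - pact o y).
Proof. exact/fA_bilip/gens_unit. Qed.

Lemma C1close_nb (eps : R) F :
  (forall o, Diff1 (F o) /\ C1close eps (F o) (fA (gens A0 A o))) -> nb pact (2 * eps) F.
Proof.
move=> h o; have [[C1 [S1 [g [_ gP]]]] cl] := h o; split.
  by split => //; exists g.
apply: C1close_LC => // y; apply: unitmx_neq0; exact: gens_unit.
Qed.

(** Density gives an element of the generated group entrywise close to Q, and the minimality of
    [gen_group] shows that all elements of that group satisfy [LCword]. *)
Lemma LCword_dense Q (e : R) : SO Q -> 0 < e ->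
  exists2 L, LCword pact L & forall v, enorm ((L - Q) *m v) <= e * enorm v.
Proof.
move=> SQ e0; pose N : R := n.+1%:R * n.+1%:R.
have N0 : 0 < N by rewrite mulr_gt0.
have [|L [gL LQ]] := dense_A SQ (B := ball Q (e / N)).
  by apply: nbhsx_ballx; rewrite divr_gt0.
exists L; last first.
  move=> v; apply: (le_trans (enorm_mulmx _ _)); rewrite ler_wpM2r ?enorm_ge0//.
  rewrite mulrC -ler_pdivlMr//; apply: ltW.
  by move: LQ; rewrite -ball_normE/= distrC.
suff : gen_group A `<=` LCword pact by exact.
apply: smallest_sub => [i M LM|_ ->]; last exact: LCword1.
have oA : orthogonal (A i) by have [] := SO_A i.
have E x : sphere x -> pact (Some i) x = A i *m x by exact: fA_orthogonal.
split; apply: LCwordM => //; [exact: LCword_letter E | exact: LCword_inv_letter E].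
Qed.

Lemma reach_SO Q x : SO Q -> sphere x -> reach pact x (Q *m x) Q.
Proof.
move=> SQ sx; apply: reach_orthogonal => //; first by case: SQ.
by move=> e; exact: LCword_dense.
Qed.

Lemma isometry_orthogonal M : (forall v, dot (M *m v) (M *m v) = dot v v) -> orthogonal M.
Proof.
move=> iM; apply: mulmx_ext => y; rewrite mul1mx; apply/eqP; rewrite -subr_eq0 -enorm_eq0.
have pol x : dot (M *m x) (M *m y) = dot x y.
  have := iM (x + y); rewrite mulmxDr !dotDr !dotDl !iM (dotC y x) (dotC (M *m y)); lra.
have h x : dot x ((M^T *m M) *m y - y) = 0.
  by rewrite dotBr -mulmxA -dot_mulmxl pol subrr.
by rewrite enormE h sqrtr0.
Qed.

(** M = K A0 / s, with the rotation K taking the image of e back to e, fixes e, keeps the component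
    along e and expands nothing. If it shrank no direction orthogonal to e it would be an isometry;
    its determinant would give s = 1, and A0 would lie in SO. *)
Lemma exists_contraction : exists e P, exists2 c : R, 0 < c < 1 &
  sphere e /\ reach pact e e P /\ P *m e = e /\
  forall v, dot e v = 0 -> enorm (P *m v) <= c * enorm v.
Proof.
have uA0 : A0 \in unitmx := gens_unit None.
have [e se hs] := exists_max_stretch A0; pose s := enorm (A0 *m e).
have hd := max_stretch_dot se hs; rewrite -/s in hs hd.
have s0 : 0 < s by rewrite enorm_gt0 unitmx_neq0// sphere_neq0.
have su : sphere (fA A0 e) by exact: fA_sphere.
have [K SK Ku] := rotation_transitive hn su se.
have oK : orthogonal K by case: SK.
pose M := K *m (s^-1 *: A0).
have ME v : M *m v = K *m (s^-1 *: (A0 *m v)) by rewrite /M -mulmxA -scalemxAl.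
have Me : M *m e = e by rewrite ME.
have nM v : dot (M *m v) (M *m v) = s ^- 2 * dot (A0 *m v) (A0 *m v).
  by rewrite ME orthogonal_dot// dotZl dotZr mulrA -exprVn expr2.
have eM v : dot e (M *m v) = dot e v.
  by rewrite -{1}Me !ME orthogonal_dot// dotZl dotZr hd; field; rewrite gt_eqF.
have Mle v : enorm (M *m v) <= enorm v.
  rewrite ME orthogonal_enorm// enormZ gtr0_norm ?invr_gt0//.
  by rewrite ler_pdivrMl//.
have [v0 [sv0 [ev0 Mv0]]] : exists v0, sphere v0 /\ dot e v0 = 0 /\ enorm (M *m v0) < 1.
  apply: contrapT => nex; apply: nSO_A0.
  have perp v : dot e v = 0 -> dot (M *m v) (M *m v) = dot v v.
    move=> ev; have [->|v0] := eqVneq v 0; first by rewrite mulmx0.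
    rewrite -!enorm_sq; congr (_ ^+ 2); apply/eqP; rewrite eq_le Mle leNgt/=.
    apply/negP => lt; apply: nex; exists (unitv v); split; first exact: unitv_sphere.
    split; first by rewrite dotZr ev mulr0.
    rewrite -scalemxAr enormZ gtr0_norm ?invr_gt0 ?enorm_gt0//.
    by rewrite ltr_pdivrMl ?enorm_gt0// mulr1.
  have oM : orthogonal M.
    apply: isometry_orthogonal => v; pose a := dot e v.
    have [w -> ew] : exists2 w, v = w + a *: e & dot e w = 0.
      by exists (v - a *: e); rewrite ?subrK// dotBr dotZr sphere_dot// mulr1 subrr.
    rewrite mulmxDr -scalemxAr Me !dotDl !dotDr !dotZl !dotZr perp//.
    by rewrite (dotC (M *m w) e) eM !(dotC w e) ew.
  have : (s^-1) ^+ (n.+1 * 2) = 1.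
    have := congr1 determinant oM.
    rewrite det_mulmx det_tr det1 /M det_mulmx detZ det_A0 mulr1.
    by have [_ ->] := SK; rewrite mul1r exprM expr2.
  move/eqP; rewrite pexpr_eq1 ?invr_ge0 ?ltW// => /eqP s1.
  split => //; apply: isometry_orthogonal => v.
  have := orthogonal_dot v v oM; rewrite nM -exprVn s1 expr1n mul1r.
  done.
have rA0 : reach pact e (fA A0 e) (s^-1 *: A0).
  apply: (@reach_letter _ _ _ pact None) => //.
    by have [K' _ hK'] := fA_lip uA0; exists K'.
  exact: fA_strict_derivative.
have [|||P [c c01 [rP [Pe hP]]]] :=
    @contraction_on_perp _ _ (reach pact e e) e M v0 se sv0 ev0 Mv0 Me eM Mle.
- by have := reach_SO SO1 se; rewrite mul1mx.
- move=> P rP; apply: (reach_comp rP); rewrite /M; apply: (reach_comp rA0).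
  by rewrite -{2}Ku; exact: reach_SO.
- by move=> Q P SQ Qe rP; apply: (reach_comp rP); rewrite -{2}Qe; exact: reach_SO.
by exists e, P, c.
Qed.

Definition contracting (lam rho : R) e (g : V -> V) : Prop :=
  forall y z, sphere y -> sphere z -> enorm (y - e) <= rho -> enorm (z - e) <= rho ->
    enorm (g y - g z) <= lam * enorm (y - z).

(** P is the identity along e, but the displacement of two sphere points near e has a component
    along e of at most 2 eta times its length. With the error of the word the rate is at most 3 eta
    + c, below (1 + c) / 2 for eta = (1 - c) / 8. *)
Lemma reach_contracting e P (c : R) : 0 < c < 1 -> sphere e -> reach pact e e P ->
  P *m e = e -> (forall v, dot e v = 0 -> enorm (P *m v) <= c * enorm v) ->
  exists w, exists2 eps : R, 0 < eps & exists2 rho : R, 0 < rho &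
    forall F, nb pact eps F -> contracting ((1 + c) / 2) rho e (wact F w).
Proof.
move=> /andP[c0 c1] se rP Pe hP; pose eta := (1 - c) / 8.
have eta0 : 0 < eta by rewrite divr_gt0// subr_gt0.
have [w [eps eps0 [rho rho0 h]]] := rP _ eta0; exists w, eps => //.
exists (Num.min rho eta); first by rewrite lt_min rho0.
move=> F nF y z sy sz; rewrite !le_min => /andP[yr yeta] /andP[zr zeta].
have [_ h1] := h _ nF _ _ sy sz yr zr.
have h2 := dot_sphereB e sy sz; rewrite (enorm_distC e y) (enorm_distC e z) in h2.
move: (y - z) h1 h2 => v h1 h2.
pose a := dot e v.
have [v' vE ev'] : exists2 v', v = v' + a *: e & dot e v' = 0.
  by exists (v - a *: e); rewrite ?subrK// dotBr dotZr sphere_dot// mulr1 subrr.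
have aE : dot e v = a by []; rewrite aE in h2; clearbody a.
have v'v : enorm v' <= enorm v.
  apply: ler_enorm; first exact: enorm_ge0.
  rewrite enorm_sq vE !dotDl !dotDr !dotZl !dotZr (dotC v' e) ev'.
  by rewrite (sphere_dot se) !mulr0 addr0 add0r mulr1 lerDl -expr2 sqr_ge0.
have v0 := enorm_ge0 v.
have h3 : enorm (P *m v) <= 2 * eta * enorm v + c * enorm v.
  rewrite {1}vE mulmxDr -scalemxAr Pe addrC; apply: (le_trans (ler_enormD _ _)).
  rewrite enormZ se mulr1 lerD//.
    by apply: (le_trans h2); rewrite ler_wpM2r//; lra.
  by apply: (le_trans (hP _ ev')); rewrite ler_pM2l.
have := ler_enormD (wact F w y - wact F w z - P *m v) (P *m v); rewrite subrK.
have e8 : eta = (1 - c) / 8 by [].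
have : eta * enorm v = (1 - c) / 8 * enorm v by rewrite e8.
nra.
Qed.

Lemma LC_orthogonal_lower (eta : R) L (g : V -> V) x y : eta <= 2^-1 -> orthogonal L ->
  LC eta g (mulmx L) -> sphere x -> sphere y -> enorm (x - y) <= 2 * enorm (g x - g y).
Proof.
move=> e2 oL [_ h] sx sy; have := h _ _ sx sy; rewrite subvACA -mulmxBr => h1.
have := ler_enormB (g x - g y) (g x - g y - L *m (x - y)); rewrite subKr orthogonal_enorm//.
have := ler_wpM2r (enorm_ge0 (x - y)) e2; lra.
Qed.

Lemma LC_orthogonal_upper (eta : R) L (g : V -> V) x y : orthogonal L ->
  LC eta g (mulmx L) -> sphere x -> sphere y ->
  enorm (g x - g y) <= (1 + eta) * enorm (x - y).
Proof.
move=> oL [_ h] sx sy; have := h _ _ sx sy; rewrite subvACA -mulmxBr => h1.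
have := ler_enormD (g x - g y - L *m (x - y)) (L *m (x - y)); rewrite subrK orthogonal_enorm//.
lra.
Qed.

(* One contracting word followed by finitely many near-rotations. *)
Lemma contracting_cover : exists e, exists2 lam : R, 0 < lam < 1 & exists2 rho : R, 0 < rho &
  sphere e /\ exists m (ws : 'I_m -> seq (option 'I_k * bool)), exists2 eps : R, 0 < eps &
  forall F, nb pact eps F ->
    (forall j, contracting lam rho e (wact F (ws j))) /\
    (forall x, sphere x -> exists j, enorm (wact F (winv (ws j)) x - e) <= rho / 4).
Proof.
have [e [P [c c01 [se [rP [Pe hP]]]]]] := exists_contraction.
have [w0 [eps0 eps00 [rho rho0 hw0]]] := reach_contracting c01 se rP Pe hP.
have [c0 c1] := andP c01; set lam0 := (1 + c) / 2 in hw0.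
have lam00 : 0 < lam0 < 1 by rewrite /lam0; lra.
(* The rate [lam0] of [w0] is relaxed to absorb the factor 1 + eta of the near-rotation that
   follows. *)
exists e, ((1 + lam0) / 2); first by lra.
exists rho => //; split => //.
have [K K1 [eps1 eps10 hK]] := nb_bilip pact_bilip.
pose Lam := K ^+ size (winv w0); have Lam0 : 0 < Lam by rewrite exprn_gt0// (lt_le_trans ltr01).
(* The inverse of [w0] is Lam-Lipschitz, so it sends points within 2 tau of the image of e into the
   quarter ball. *)
pose tau := rho / (8 * Lam); have tau0 : 0 < tau by rewrite divr_gt0// mulr_gt0.
have LamE : Lam * (2 * tau) = rho / 4 by rewrite /tau; field; rewrite gt_eqF.
have [eps2 eps20 hnear] := wact_near pact_bij pact_bilip w0 se tau0.
pose p := wact pact w0 e; have sp : sphere p by apply: wact_sphere => //; exact: pact_bij.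
have tau80 : 0 < tau / 8 by rewrite divr_gt0.
have [s [sS sn]] := @sphere_net _ _ (@sphere R n) _ (@subset_refl _ _) tau80.
pose eta := Num.min (tau / 4) ((1 - lam0) / 2).
have eta0 : 0 < eta by rewrite lt_min !divr_gt0//; lra.
have [eta1 eta2] : eta <= tau / 4 /\ eta <= (1 - lam0) / 2 by rewrite /eta !ge_min !lexx orbT.
have : forall j : 'I_(size s), exists r, exists2 eps : R, 0 < eps & forall F, nb pact eps F ->
    exists2 L, orthogonal L & enorm (L *m p - nth 0 s j) <= tau / 8 /\ LC eta (wact F r) (mulmx L).
  move=> j; have sy : sphere (nth 0 s j) by apply/sS/mem_nth.
  have [Q SQ Qp] := rotation_transitive hn sp sy.
  have [L [oL [r hr]] hL] := LCword_dense SQ tau80.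
  have [eps eps_0 {}hr] := hr _ eta0; exists r, eps => // F nF; exists L => //.
  split; last exact: hr.
  by have := hL p; rewrite mulmxBl Qp sp mulr1.
move=> /choice[r hr].
have [j|eps3 eps30 hr3] := @fin_min _ _ (fun (j : 'I_(size s)) eps => forall F, nb pact eps F ->
    exists2 L, orthogonal L & enorm (L *m p - nth 0 s j) <= tau / 8 /\ LC eta (wact F (r j)) (mulmx L)).
  have [eps eps_0 h] := hr j; exists eps => // e' /andP[_ e'e] F nF.
  by apply: h; exact: nb_le nF.
exists (size s), (fun j => r j ++ w0).
exists (Num.min eps0 (Num.min eps1 (Num.min eps2 eps3))).
  by rewrite !lt_min eps00 eps10 eps20.
move=> F nF.
have nF0 : nb pact eps0 F by apply: nb_le nF; rewrite ge_min lexx.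
have nF1 : nb pact eps1 F by apply: nb_le nF; rewrite !ge_min lexx !orbT.
have nF2 : nb pact eps2 F by apply: nb_le nF; rewrite !ge_min lexx !orbT.
have nF3 : nb pact eps3 F by apply: nb_le nF; rewrite !ge_min lexx !orbT.
have bF := nb_bij nF0; split.
  move=> j y z sy sz yr zr; rewrite !wact_cat.
  have [L oL [_ lc]] := hr3 j _ nF3.
  apply: (le_trans (LC_orthogonal_upper oL lc _ _)); [exact: wact_sphere..|].
  have h1 := hw0 _ nF0 _ _ sy sz yr zr; have v0 := enorm_ge0 (y - z).
  apply: (@le_trans _ _ ((1 + eta) * (lam0 * enorm (y - z)))).
    by rewrite ler_pM2l// addr_gt0.
  rewrite mulrA ler_wpM2r//; nra.
move=> x sx; have [y ys xy] := sn _ sx.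
have yi : (index y s < size s)%N by rewrite index_mem.
exists (Ordinal yi); have [L oL [/= Lp lc]] := hr3 (Ordinal yi) _ nF3.
rewrite nth_index// in Lp; set g := r _ in lc *.
have -> : winv (g ++ w0) = winv w0 ++ winv g by rewrite /winv map_cat rev_cat.
rewrite wact_cat; set z := wact F (winv g) x.
have sz : sphere z by exact: wact_sphere.
have zx : wact F g z = x by rewrite /z wactKV.
have sq : sphere (wact F w0 e) by exact: wact_sphere.
rewrite -{1}(wactK w0 bF se).
apply: (le_trans (@lipS_wact _ _ _ F K (winv w0) bF K1 (hK _ nF1) _ _ sz sq)).
rewrite -/Lam -LamE ler_pM2l//.
(* The distance 2 tau is spent as follows: tau for the displacement of p by the perturbation of
   [w0], and tau/8 + tau/8 + tau/4 for the net, the choice of L and the perturbation of the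
   near-rotation, doubled by its inverse. *)
have h1 := hnear _ nF2; rewrite -/p enorm_distC in h1.
have h2 := ler_enorm_add p z (wact F w0 e).
have eta3 : eta <= 2^-1 by lra.
have h3 := LC_orthogonal_lower eta3 oL lc sz sp.
have h4 := lc.1 _ sp.
have h5 := ler_enorm_add y x (wact F g p); have h6 := ler_enorm_add (L *m p) y (wact F g p).
rewrite (enorm_distC (L *m p) (wact F g p)) (enorm_distC y (L *m p)) in h6.
rewrite zx in h3; lra.
Qed.

End Key.

Section Minimality.
Context {R : realType} {n k : nat}.
Local Notation V := 'cV[R]_n.+1.

Lemma orbit_wact (I : finType) (F : I -> V -> V) (w : seq (I * bool)) (x z : V) :
  bijF F -> sphere z -> Defs.orbit F x z -> Defs.orbit F x (wact F w z).
Proof.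
move=> bF sz oz; elim: w => //= l w IH B [cB xB].
have {}IH := IH B (conj cB xB); have sw := wact_sphere w bF sz.
rewrite /lact; case: l.2; first by have [+ _] := cB l.1 _ sw; apply.
have [s e] := sphere_invP (bF l.1) sw.
by have [_] := cB l.1 _ s; apply; rewrite e.
Qed.

Lemma contracting_cover_minimal (I : finType) (F : I -> V -> V) e (lam rho : R) m
    (ws : 'I_m -> seq (I * bool)) :
  bijF F -> 0 < lam < 1 -> 0 < rho ->
  (forall j, contracting lam rho e (wact F (ws j))) ->
  (forall x, sphere x -> exists j, enorm (wact F (winv (ws j)) x - e) <= rho / 4) ->
  minimal F.
Proof.
move=> bF /andP[lam0 lam1] rho0 con cov x y sx sy eps eps0.
have [jx hx] := cov _ sx; set x' := wact F _ x in hx.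
have sx' : sphere x' by exact: wact_sphere.
have ox : Defs.orbit F x x by move=> B [_]; apply.
have ox' : Defs.orbit F x x' by exact: orbit_wact.
(* Since rho/4 + rho/2 < rho, the approximant of the pulled-back point z' still lies where the next
   word contracts. At N = 0 the points z' and x' are both in the quarter ball, hence within rho/2 of
   each other. *)
have approx N z : sphere z -> exists2 u, Defs.orbit F x u /\ sphere u &
    enorm (u - z) <= lam ^+ N * (lam * (rho / 2)).
  elim: N z => [|N IH] z sz; have [j hj] := cov _ sz; set z' := wact F _ z in hj.
    have sz' : sphere z' by exact: wact_sphere.
    exists (wact F (ws j) x').
      by split; [exact: orbit_wact | exact: wact_sphere].
    rewrite expr0 mul1r -{1}(wactKV (ws j) bF sz).
    apply: le_trans (con j _ _ sx' sz' _ _) _; [lra..|].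
    rewrite ler_pM2l//; have := ler_enorm_add e x' z'.
    rewrite (enorm_distC e); lra.
  have sz' : sphere z' by exact: wact_sphere.
  have [u [ou su] uz'] := IH _ sz'.
  have lN : lam ^+ N <= 1 by rewrite exprn_ile1// ltW.
  exists (wact F (ws j) u).
    by split; [exact: orbit_wact | exact: wact_sphere].
  rewrite -{1}(wactKV (ws j) bF sz).
  have lN0 : 0 <= lam ^+ N by rewrite exprn_ge0// ltW.
  have h : lam ^+ N * (lam * (rho / 2)) <= rho / 2.
    have h1 : 0 <= lam * (rho / 2) by rewrite mulr_ge0 ?divr_ge0 ?ltW.
    by apply: (le_trans (ler_piMl h1 lN)); rewrite ler_piMl ?divr_ge0 ?ltW.
  apply: le_trans (con j _ _ su sz' _ _) _; [|lra|].
    by have := ler_enorm_add z' u e; lra.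
  by rewrite exprS -mulrA ler_pM2l.
have [N hN] : exists N, lam ^+ N * (lam * (rho / 2)) < eps.
  have C0 : 0 < lam * (rho / 2) by rewrite mulr_gt0// divr_gt0.
  have lamn : `|lam| < 1 by rewrite gtr0_norm.
  have [N _ hN] : \forall N \near \oo, `|0 - GRing.exp lam N| < eps / (lam * (rho / 2)).
    by have /cvgrPdist_lt := cvg_expr lamn; apply; rewrite divr_gt0.
  exists N; have := hN N (leqnn N).
  by rewrite /= sub0r normrN ger0_norm ?exprn_ge0 ?ltW// ltr_pdivlMr.
have [u [ou su] uz] := approx N _ sy.
by exists u; split => //; exact: le_lt_trans uz hN.
Qed.

End Minimality.

(** * Volume as an outer measure *)

Section Covers.
Context {R : realType} {n : nat}.
Local Notation V := 'cV[R]_n.+1.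
Implicit Types (P Q : set V -> R -> Prop) (E F X Y : set V) (c : R).

(** For partial sums of rearranged double series: [f] sends an index to the term it stands for, if
    any, and no term is used twice. *)
Lemma sum_partial_inj (I J : finType) (f : I -> option J) (g : J -> R) :
  (forall j, 0 <= g j) -> (forall i i' j, f i = Some j -> f i' = Some j -> i = i') ->
  \sum_i oapp g 0 (f i) <= \sum_j g j.
Proof.
move=> g0 finj.
have -> : \sum_i oapp g 0 (f i) = \sum_i \sum_j (if f i == Some j then g j else 0).
  apply: eq_bigr => i _; case: (f i) => [j|] /=; last by rewrite big1.
  rewrite (bigD1 j)//= eqxx big1 ?addr0// => j' jj'.
  by rewrite ifF//; apply/negbTE; rewrite eq_sym; apply: contra jj' => /eqP[->].
rewrite exchange_big/=; apply: ler_sum => j _.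
have [[i0 /eqP fi0]|nf] := pselect (exists i0, f i0 == Some j).
  rewrite (bigD1 i0)//= fi0 eqxx big1 ?addr0// => i ii0; rewrite ifF//.
  by apply/negbTE; apply: contra ii0 => /eqP fi; apply/eqP/(finj _ _ j).
rewrite big1// => i _; rewrite ifF//; apply/negbTE/negP => fi; apply: nf; by exists i.
Qed.

(** An outer measure in the form of its upper bounds: [P X v] certifies that the piece X has size at
    most v. Stating real bounds c, instead of an infimum, avoids infinite values. *)
Definition gcov P E c : Prop := exists X : nat -> set V, exists v : nat -> R,
  (forall m, 0 <= v m /\ P (X m) (v m)) /\
  (E `<=` \bigcup_m X m) /\ (forall N, \sum_(m < N) v m <= c).

Lemma gcov_ge0 P E c : gcov P E c -> 0 <= c.
Proof. by move=> [X [v [_ [_ /(_ 0%N)]]]]; rewrite big_ord0. Qed.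

Lemma gcov_sub P E F c : E `<=` F -> gcov P F c -> gcov P E c.
Proof.
move=> EF [X [v [h [FX hv]]]]; exists X, v; split => //; split => //.
exact: subset_trans FX.
Qed.

Lemma gcov_le P E c c' : c <= c' -> gcov P E c -> gcov P E c'.
Proof.
move=> cc' [X [v [h [FX hv]]]]; exists X, v; split => //; split => // N.
exact: le_trans (hv N) cc'.
Qed.

Lemma gcov_bigcup P (E : nat -> set V) (c : nat -> R) (C : R) : P set0 0 ->
  (forall m, gcov P (E m) (c m)) -> (forall N, \sum_(m < N) c m <= C) ->
  gcov P (\bigcup_m E m) C.
Proof.
move=> P0 /choice[X /choice[v h]] hC.
pose Y p := if @pickle_inv (nat * nat)%type p is Some ij then X ij.1 ij.2 else set0.
pose w p := if @pickle_inv (nat * nat)%type p is Some ij then v ij.1 ij.2 else 0.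
exists Y, w; split.
  move=> p; rewrite /Y /w; case: pickle_inv => [[i j]|] //=.
  by have [+ _] := h i; apply.
split=> [x [i _ Ex]|N].
  have [_ [+ _]] := h i => /(_ _ Ex)[j _ Xx].
  by exists (pickle (i, j)) => //; rewrite /Y pickleK_inv.
(* The pairs coded by the first N integers lie in a square of side M. *)
have [M hM] : exists M, forall p i j, (p < N)%N -> pickle_inv p = Some (i, j) ->
    (i < M)%N /\ (j < M)%N.
  elim: N => [|N [M hM]]; first by exists 0%N.
  case EN : (@pickle_inv (nat * nat)%type N) => [[i0 j0]|].
    exists (maxn M (maxn i0 j0).+1) => p i j; rewrite ltnS leq_eqVlt => /orP[/eqP ->|pN e].
      by rewrite EN => -[<- <-]; rewrite !leq_max !ltnS !leq_max !leqnn !orbT.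
    by have [] := hM _ _ _ pN e; rewrite !leq_max => -> ->.
  by exists M => p i j; rewrite ltnS leq_eqVlt => /orP[/eqP ->|pN]; [rewrite EN | exact: hM].
pose f (p : 'I_N) : option ('I_M * 'I_M) :=
  if @pickle_inv (nat * nat)%type p is Some ij then
    (if insub ij.1 is Some i then if insub ij.2 is Some j then Some (i, j) else None else None)
  else None.
have fE p i j : f p = Some (i, j) -> @pickle_inv (nat * nat)%type p = Some (val i, val j).
  rewrite /f; case: pickle_inv => // -[i' j'] /=.
  case: insubP => // ii _ ei; case: insubP => // jj _ ej [<- <-].
  by rewrite ei ej.
have -> : \sum_(p < N) w p = \sum_(p < N) oapp (fun ij : 'I_M * 'I_M => v (val ij.1) (val ij.2)) 0 (f p).
  apply: eq_bigr => p _; rewrite /w /f; case EN : pickle_inv => [[i j]|] //=.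
  have [iM jM] := hM _ _ _ (ltn_ord p) EN.
  case: insubP => [ii _ ei|]; last by rewrite iM.
  by case: insubP => [jj _ ej|]; [rewrite /= ei ej | rewrite jM].
apply: (@le_trans _ _ (\sum_(ij : 'I_M * 'I_M) v (val ij.1) (val ij.2))).
  apply: sum_partial_inj => [ij|p p' [i j] /fE e1 /fE e2].
    by have [/(_ ij.2)[]] := h ij.1.
  apply: val_inj => /=; have := @pickle_invK (nat * nat)%type p; have := @pickle_invK (nat * nat)%type p'.
  by rewrite e1 e2 /= => <- <-.
rewrite -(pair_big xpredT xpredT (fun i j : 'I_M => v i j))/=.
apply: le_trans (hC M); apply: ler_sum => i _.
by have [_ [_]] := h i; apply.
Qed.

Lemma gcov_fin P (I : finType) (E : I -> set V) (c : I -> R) : P set0 0 ->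
  (forall i, gcov P (E i) (c i)) -> gcov P [set x | exists i, E i x] (\sum_i c i).
Proof.
move=> P0 h.
have g0 : gcov P set0 0.
  by exists (fun=> set0), (fun=> 0); split => //; split=> [x|N] //; rewrite big1.
pose E' m := if (insub m : option 'I_#|I|) is Some j then E (enum_val j) else set0.
pose c' m := if (insub m : option 'I_#|I|) is Some j then c (enum_val j) else 0.
apply: (@gcov_sub _ _ (\bigcup_m E' m)).
  move=> x [i Ex]; exists (val (enum_rank i)) => //.
  by rewrite /E' valK enum_rankK.
apply: (@gcov_bigcup _ _ c') => //.
  by move=> m; rewrite /E' /c'; case: insub.
move=> N.
have -> : \sum_i c i = \sum_(j < #|I|) c (enum_val j) by rewrite -(big_enum_val (A := I) c).
have -> : \sum_(m < N) c' m =
    \sum_(m < N) oapp (fun j : 'I_#|I| => c (enum_val j)) 0 (insub (val m)).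
  by apply: eq_bigr => m _; rewrite /c'; case: insub.
apply: sum_partial_inj => [j|i i' j]; first by have /gcov_ge0 := h (enum_val j).
case: insubP => // u _ eu [uj]; case: insubP => // u' _ eu' [u'j].
by apply: val_inj; rewrite -eu -eu' uj u'j.
Qed.

Lemma gcov_setU P E F c c' : P set0 0 -> gcov P E c -> gcov P F c' ->
  gcov P (E `|` F) (c + c').
Proof.
move=> P0 hE hF.
have := @gcov_fin P bool (fun b => if b then E else F) (fun b => if b then c else c') P0.
rewrite big_bool/= => h; apply: gcov_sub (h _); last by case.
by move=> x [Ex|Fx]; [exists true | exists false].
Qed.

Lemma geometric_slack (e : R) : 0 < e -> exists2 s : nat -> R, (forall m, 0 < s m) &
  forall N, \sum_(m < N) s m <= e.
Proof.
move=> e0; exists (fun m => e / 2 ^+ m.+1) => [m|N].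
  by rewrite divr_gt0// exprn_gt0.
suff -> : \sum_(m < N) e / 2 ^+ m.+1 = e - e / 2 ^+ N.
  by rewrite gerBl divr_ge0 ?exprn_ge0 ?ltW.
elim: N => [|N IH]; first by rewrite big_ord0 expr0 divr1 subrr.
by rewrite big_ord_recr/= IH exprS; field; rewrite expf_neq0.
Qed.

(** Substitution into covers: what T costs on one piece, up to arbitrary slack, it costs on a whole
    cover, the slack being shared geometrically. Subdivision into cubes and images under Lipschitz
    and linear maps are instances. *)
Lemma gcov_bind P Q E c (e : R) (T : set V -> set V) (kappa : R) : Q set0 0 -> 0 <= kappa ->
  (forall X v (e' : R), P X v -> 0 <= v -> 0 < e' -> gcov Q (T X) (kappa * v + e')) ->
  gcov P E c -> 0 < e ->
  exists X : nat -> set V, (E `<=` \bigcup_m X m) /\ gcov Q (\bigcup_m T (X m)) (kappa * c + e).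
Proof.
move=> Q0 k0 h [X [v [hX [EX hv]]]] e0; exists X; split => //.
have [s s0 hs] := geometric_slack e0.
apply: (@gcov_bigcup _ _ (fun m => kappa * v m + s m)) => //.
  by move=> m; have [v0 PX] := hX m; exact: h.
move=> N; rewrite big_split/= -mulr_sumr; apply: lerD; last exact: hs.
exact: (ler_wpM2l k0 (hv N)).
Qed.

(** A set with no cover of finite total gets the value 0, the infimum of the empty set; hence
    comparisons of [vol] carry a [gcov] hypothesis. *)
Definition vol P E : R := inf [set c | gcov P E c].

Lemma vol_ge0 P E : 0 <= vol P E.
Proof.
have [[c hc]|ne] := pselect (exists c, gcov P E c).
  by apply: lb_le_inf; [exists c | move=> x /gcov_ge0].
rewrite /vol (_ : [set c | _] = set0) ?inf0//.
by apply/seteqP; split => // x hx; apply: ne; exists x.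
Qed.

Lemma vol_le P E c : gcov P E c -> vol P E <= c.
Proof. by move=> h; apply: ge_inf => //; exists 0 => x /gcov_ge0. Qed.

Lemma vol_gcov P E c (e : R) : gcov P E c -> 0 < e -> gcov P E (vol P E + e).
Proof.
move=> h e0; have hi : has_inf [set c | gcov P E c].
  by split; [exists c | exists 0 => x /gcov_ge0].
have [c' hc' lt] := inf_adherent e0 hi.
by apply: gcov_le hc'; exact: ltW.
Qed.

Lemma vol_mono P E F c : E `<=` F -> gcov P F c -> vol P E <= vol P F.
Proof.
move=> EF h; apply/ler_addgt0Pr => e e0; apply: vol_le.
exact: gcov_sub EF (vol_gcov h e0).
Qed.

End Covers.

Section Boxes.
Context {R : realType} {n : nat}.
Local Notation V := 'cV[R]_n.+1.
Implicit Types (E F X Y Z : set V) (c : R) (a b x y : V).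

Definition boxP X (v : R) : Prop := exists a b, X `<=` box a b /\ boxvol a b <= v.

Definition cubeP (delta : R) X (v : R) : Prop := exists a, exists2 q : R, 0 <= q <= delta &
  X `<=` [set x | forall i, a i ord0 <= x i ord0 <= a i ord0 + q] /\ q ^+ n.+1 <= v.

Lemma boxvol_ge0 a b : 0 <= boxvol a b.
Proof. by apply: prodr_ge0 => i _; rewrite le_max lexx. Qed.

Lemma boxvolE a b : (forall i, a i ord0 <= b i ord0) ->
  boxvol a b = \prod_i (b i ord0 - a i ord0).
Proof.
by move=> h; apply: eq_bigr => i _; rewrite max_r// subr_ge0.
Qed.

Lemma boxP0 : boxP set0 0.
Proof.
exists 0, 0; split => //; rewrite /boxvol.
by rewrite (bigD1 ord0)//= subrr maxxx mul0r.
Qed.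

Lemma cubeP0 delta : 0 <= delta -> cubeP delta set0 0.
Proof. by move=> d0; exists 0, 0; rewrite ?lexx//; split => //; rewrite expr0n. Qed.

Lemma gcov1 (P : set V -> R -> Prop) X (v : R) : P set0 0 -> 0 <= v -> P X v -> gcov P X v.
Proof.
move=> P0 v0 PX.
exists (fun m => if m == 0%N then X else set0), (fun m => if m == 0%N then v else 0).
split; first by case.
split=> [x Xx|]; first by exists 0%N.
case=> [|N]; first by rewrite big_ord0.
by rewrite big_ord_recl/= big1 ?addr0.
Qed.

Lemma box_eq0_or a b : (forall i, a i ord0 <= b i ord0) \/ box a b = set0.
Proof.
have [h|/existsNP[i /negP]] := pselect (forall i, a i ord0 <= b i ord0); first by left.
rewrite -ltNge => bai; right; apply/seteqP; split => // x /(_ i)/andP[h1 h2].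
by have := le_lt_trans (le_trans h1 h2) bai; rewrite ltxx.
Qed.

Lemma grid1 (M : nat) (a h x : R) : 0 <= h -> a <= x <= a + M.+1%:R * h ->
  exists j : 'I_M.+1, a + j%:R * h <= x <= a + j.+1%:R * h.
Proof.
move=> h0; elim: M => [|M IH] /andP[ax xM].
  by exists ord0; rewrite mul0r addr0 ax.
have [xM'|xM'] := lerP x (a + M.+1%:R * h).
  have [|j hj] := IH; first by rewrite ax.
  by exists (widen_ord (leqnSn _) j).
by exists ord_max; rewrite /= ltW.
Qed.

Lemma grid (M : 'I_n.+1 -> nat) (a : V) (h : 'I_n.+1 -> R) x : (forall i, 0 <= h i) ->
  (forall i, a i ord0 <= x i ord0 <= a i ord0 + (M i).+1%:R * h i) ->
  exists f : {dffun forall i : 'I_n.+1, 'I_(M i).+1}, forall i,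
    a i ord0 + (f i)%:R * h i <= x i ord0 <= a i ord0 + (f i)%:R * h i + h i.
Proof.
move=> h0 hx.
have hj i : exists j : 'I_(M i).+1,
    a i ord0 + j%:R * h i <= x i ord0 <= a i ord0 + j.+1%:R * h i by exact: grid1.
exists [ffun i => projT1 (cid (hj i))] => i; rewrite ffunE.
by have := projT2 (cid (hj i)); rewrite -natr1 mulrDl mul1r addrA.
Qed.

Lemma card_grid (M : 'I_n.+1 -> nat) :
  #|{dffun forall i : 'I_n.+1, 'I_(M i).+1}| = (\prod_i (M i).+1)%N.
Proof.
rewrite card_dep_ffun foldrE big_image/=.
by apply: eq_bigr => i _; rewrite card_ord.
Qed.

(* The product is a convex function of q on [0, 1]. *)
Lemma prod_addr_le (I : Type) (s : seq I) (l : I -> R) (q : R) :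
  (forall i, 0 <= l i) -> 0 <= q <= 1 ->
  \prod_(i <- s) (l i + q) <= (1 - q) * \prod_(i <- s) l i + q * \prod_(i <- s) (l i + 1).
Proof.
move=> l0 /andP[q0 q1]; elim: s => [|i s IH]; first by rewrite !big_nil; lra.
rewrite !big_cons.
have P0 : 0 <= \prod_(i <- s) l i by exact: prodr_ge0.
have PC : \prod_(i <- s) l i <= \prod_(i <- s) (l i + 1).
  by apply: ler_prod => j _; rewrite l0 lerDl ler01.
move: (\prod_(j <- s) l j) (\prod_(j <- s) (l j + 1)) (\prod_(j <- s) (l j + q)) IH P0 PC
  => P C Q IH P0 PC.
have li := l0 i.
apply: (@le_trans _ _ ((l i + q) * ((1 - q) * P + q * C))).
  by rewrite ler_wpM2l// addr_ge0.
have : 0 <= q * (1 - q) * (C - P) by rewrite !mulr_ge0// subr_ge0.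
lra.
Qed.

Lemma prod_addr_limit (l : 'I_n.+1 -> R) (e : R) : (forall i, 0 <= l i) -> 0 < e ->
  exists2 q0 : R, 0 < q0 & forall q, 0 <= q <= q0 -> \prod_i (l i + q) <= \prod_i l i + e.
Proof.
move=> l0 e0; pose C := \prod_i (l i + 1).
have C0 : 0 < C by apply: prodr_gt0 => i _; rewrite ltr_wpDl.
exists (Num.min 1 (e / C)); first by rewrite lt_min ltr01 divr_gt0.
move=> q /andP[q0]; rewrite le_min => /andP[q1 qe].
apply: le_trans (prod_addr_le _ l0 _) _; first by rewrite q0.
rewrite ler_pdivlMr// in qe.
have : 0 <= q * \prod_i l i by rewrite mulr_ge0// prodr_ge0.
rewrite -/C; lra.
Qed.

(** A side of length l is cut into floor(l/q) + 1 intervals of length q, so the total is at most the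
    product of the l + q, close to the volume of the box. Cubes are wanted because a Lipschitz bound
    sees only diameters. *)
Lemma box_gcov_cubes X (v delta e : R) : boxP X v -> 0 < delta -> 0 < e ->
  gcov (cubeP delta) X (v + e).
Proof.
move=> [a [b [Xab abv]]] d0 e0.
have c0 := cubeP0 (ltW d0).
have v0 : 0 <= v := le_trans (boxvol_ge0 a b) abv.
have [ab|ab0] := box_eq0_or a b; last first.
  apply: (@gcov_sub _ _ _ _ set0); first by rewrite -ab0.
  apply: (gcov_le _ (gcov1 c0 (lexx 0) c0)); exact: addr_ge0 v0 (ltW e0).
pose l i := b i ord0 - a i ord0; have l0 i : 0 <= l i by rewrite subr_ge0.
have [q0 q00 hq] := prod_addr_limit l0 e0.
pose q := Num.min q0 delta; have qp : 0 < q by rewrite lt_min q00.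
pose M i := Num.truncn (l i / q).
have hM i : (M i)%:R * q <= l i < (M i).+1%:R * q.
  rewrite -ler_pdivlMr// -ltr_pdivrMr//; apply: truncn_itv.
  by rewrite divr_ge0// ltW.
pose piece (f : {dffun forall i : 'I_n.+1, 'I_(M i).+1}) : set V :=
  [set x | forall i, a i ord0 + (f i)%:R * q <= x i ord0 <= a i ord0 + (f i)%:R * q + q].
apply: (@gcov_sub _ _ _ _ [set x | exists f, piece f x]).
  move=> x /Xab xab; have [//|i|f hf] := @grid M a (fun=> q) x; [by move=> i; exact: ltW| |by exists f].
  have /andP[h1 h2] := xab i; rewrite h1/=.
  have /andP[_ /ltW] := hM i; rewrite /l; lra.
apply: (@gcov_le _ _ _ _ (\sum_(f : {dffun forall i : 'I_n.+1, 'I_(M i).+1}) q ^+ n.+1)); last first.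
  apply: gcov_fin => // f; apply: gcov1 => //; first by rewrite exprn_ge0// ltW.
  exists (\col_i (a i ord0 + (f i)%:R * q)), q; first by rewrite (ltW qp)/= ge_min lexx orbT.
  by split => // x hx i; rewrite !mxE; exact: hx.
rewrite sumr_const card_grid -[leLHS]mulr_natl natr_prod.
rewrite -[q ^+ _](_ : \prod_(i < n.+1) q = _); last by rewrite prodr_const card_ord.
rewrite -big_split/=; apply: (@le_trans _ _ (\prod_i (l i + q))).
  apply: ler_prod => i _; rewrite mulr_ge0 ?(ltW qp)//=.
  by rewrite -natr1 mulrDl mul1r lerD2r; have /andP[] := hM i.
apply: le_trans (hq _ _) _; first by rewrite (ltW qp)/= ge_min lexx.
by rewrite lerD2r -boxvolE.
Qed.

Lemma cube_box delta X (v : R) : cubeP delta X v -> boxP X v.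
Proof.
move=> [a [q /andP[q0 _] [Xa qv]]].
exists a, (\col_i (a i ord0 + q)); split.
  by move=> x /Xa h i; rewrite mxE.
apply: le_trans qv; rewrite boxvolE => [|i]; last by rewrite mxE lerDl.
rewrite (eq_bigr (fun=> q)); first by rewrite prodr_const card_ord.
by move=> i _; rewrite mxE addrAC subrr add0r.
Qed.

Lemma gcov_cubes E c (delta e : R) : gcov boxP E c -> 0 < delta -> 0 < e ->
  gcov (cubeP delta) E (c + e).
Proof.
move=> h d0 e0.
have hT X v e' : boxP X v -> 0 <= v -> 0 < e' -> gcov (cubeP delta) (id X) (1 * v + e').
  by move=> PX v0 e'0; rewrite mul1r; exact: box_gcov_cubes.
have [X [EX]] := gcov_bind (cubeP0 (ltW d0)) ler01 hT h e0.
by rewrite mul1r; exact: gcov_sub.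
Qed.

(** In the maximum norm a set of diameter K q fits in a cube of side K q; this gives the factor
    K^(n+1), close to 1 when K is. Comparing two parametrisations of one set spares the inverse of
    either. *)
Lemma lipschitz_gcov Z (phi psi : V -> V) (K : R) c e : 0 <= K ->
  (forall x y, Z x -> Z y -> `|phi x - phi y| <= K * `|psi x - psi y|) ->
  gcov boxP (psi @` Z) c -> 0 < e -> gcov boxP (phi @` Z) (K ^+ n.+1 * c + e).
Proof.
move=> K0 hK hc e0; pose kap := K ^+ n.+1; have kap0 : 0 <= kap by exact: exprn_ge0.
pose T (X : set V) := phi @` (Z `&` psi @^-1` X).
have e10 : 0 < e / (2 * (kap + 1)) by rewrite divr_gt0// mulr_gt0// ltr_wpDl.
have hc1 := gcov_cubes hc ltr01 e10.
have e20 : 0 < e / 2 by rewrite divr_gt0.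
have hT X v e' : cubeP 1 X v -> 0 <= v -> 0 < e' -> gcov boxP (T X) (kap * v + e').
  move=> [a [q /andP[q0 _] [Xa qv]]] v0 e'0.
  apply: (@gcov_le _ _ _ _ (kap * v)); first by rewrite lerDl ltW.
  apply: gcov1; [exact: boxP0|exact: mulr_ge0|].
  have [[x0 [Zx0 Xx0]]|ne] := pselect (exists x, Z x /\ X (psi x)); last first.
    have [a' [b' [h1 h2]]] := boxP0.
    exists a', b'; split; last by apply: (le_trans h2); exact: mulr_ge0.
    by move=> z [x [Zx Xx] zE]; case: ne; exists x.
  have diam x y : Z x -> X (psi x) -> Z y -> X (psi y) -> `|phi x - phi y| <= K * q.
    move=> Zx Xx Zy Xy; apply: (le_trans (hK _ _ Zx Zy)); rewrite ler_wpM2l//.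
    apply: mx_le_coord => // i; rewrite !mxE.
    have := Xa _ Xx i; have := Xa _ Xy i; rewrite ler_norml; lra.
  pose S i := [set t | exists2 x, Z x /\ X (psi x) & phi x i ord0 = t].
  have lbS i x : Z x -> X (psi x) -> lbound (S i) (phi x i ord0 - K * q).
    move=> Zx Xx _ [y [Zy Xy] <-]; have := diam _ _ Zx Xx Zy Xy.
    move/(le_trans (coord_le_mx _ i)); rewrite !mxE ler_norml; lra.
  exists (\col_i inf (S i)), (\col_i (inf (S i) + K * q)); split.
    move=> _ [x [Zx Xx] <-] i; rewrite !mxE; apply/andP; split.
      apply: ge_inf; last by exists x.
      by exists (phi x i ord0 - K * q); exact: lbS.
    rewrite -lerBlDr; apply: lb_le_inf; last exact: lbS.
    by exists (phi x0 i ord0); exists x0.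
  rewrite boxvolE => [|i]; last by rewrite !mxE lerDl mulr_ge0.
  rewrite (eq_bigr (fun=> K * q)) => [|i _]; last by rewrite !mxE addrAC subrr add0r.
  by rewrite prodr_const card_ord exprMn ler_wpM2l.
have [X [EX h]] := gcov_bind boxP0 kap0 hT hc1 e20.
apply: gcov_sub (gcov_le _ h).
  move=> _ [x Zx <-]; have [m _ Xx] := EX _ (imageP psi Zx).
  by exists m => //; exists x.
have : kap * (e / (2 * (kap + 1))) <= e / 2.
  rewrite -subr_ge0 (_ : _ - _ = e / (2 * (kap + 1))) ?ltW//.
  by field; rewrite gt_eqF// ltr_wpDl.
rewrite -/kap mulrDr; lra.
Qed.

(* Covers by cubes too small to meet both sets split into covers of each. *)
Lemma vol_separated E F c (delta : R) : 0 < delta ->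
  (forall x y, E x -> F y -> delta <= `|x - y|) -> gcov boxP (E `|` F) c ->
  vol boxP E + vol boxP F <= c.
Proof.
move=> d0 sep hc; apply/ler_addgt0Pr => e e0.
have d20 : 0 < delta / 2 by rewrite divr_gt0.
have [X [v [hX [EX hv]]]] := gcov_cubes hc d20 e0.
pose vE m := if `[< exists x, E x /\ X m x >] then v m else 0.
pose vF m := v m - vE m.
have v0 m : 0 <= v m by have [] := hX m.
have vE0 m : 0 <= vE m by rewrite /vE; case: ifP.
have vF0 m : 0 <= vF m by rewrite /vF /vE; case: ifP; rewrite ?subrr ?subr0.
(* The supremum of the partial sums serves as the sum of the series. *)
have bound (w : nat -> R) : (forall m, 0 <= w m) -> (forall m, w m <= v m) ->
    exists2 s, (forall N, \sum_(m < N) w m <= s) &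
      forall t, (forall N, \sum_(m < N) w m <= t) -> s <= t.
  move=> w0 wv; pose T := [set t | exists N, t = \sum_(m < N) w m].
  have hs : has_sup T.
    split; first by exists (\sum_(m < 0) w m); exists 0%N.
    exists (c + e) => _ [N ->]; apply: le_trans (hv N); exact: ler_sum.
  exists (sup T) => [N|t ht]; first by apply: sup_upper_bound => //; exists N.
  by apply: ge_sup; [case: hs | move=> _ [N ->]].
have [|sE hE1 hE2] := bound vE vE0.
  by move=> m; rewrite /vE; case: ifP.
have [|sF hF1 hF2] := bound vF vF0.
  by move=> m; rewrite /vF gerBl.
have tot N : \sum_(m < N) vE m + \sum_(m < N) vF m <= c + e.
  rewrite -big_split/= (eq_bigr (fun m : 'I_N => v m)) => [|m _]; first exact: hv.
  by rewrite addrC subrK.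
have mono (w : nat -> R) : (forall m, 0 <= w m) -> forall N M, (N <= M)%N ->
    \sum_(m < N) w m <= \sum_(m < M) w m.
  move=> w0 N M NM; rewrite -(subnKC NM) big_split_ord/= lerDl.
  by apply: sumr_ge0 => i _.
have sEF : sE + sF <= c + e.
  rewrite -lerBrDr; apply: hE2 => N; rewrite lerBrDr -lerBrDl; apply: hF2 => M.
  rewrite lerBrDl; apply: le_trans (tot (maxn N M)).
  by rewrite lerD// mono// ?leq_maxl ?leq_maxr.
apply: le_trans sEF; apply: lerD; apply: vol_le.
  exists (fun m => if `[< exists x, E x /\ X m x >] then X m else set0), vE; split.
    move=> m; split => //; rewrite /vE; have [_ cm] := hX m.
    by case: ifP => _; [exact: cube_box cm | exact: boxP0].
  split => // x Ex; have [m _ Xx] := EX x (or_introl Ex); exists m => //.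
  by rewrite ifT//; apply/asboolP; exists x.
exists (fun m => if `[< exists x, E x /\ X m x >] then set0 else X m), vF; split.
  move=> m; split => //; rewrite /vF /vE; have [_ cm] := hX m.
  by case: ifP => _; rewrite ?subrr ?subr0; [exact: boxP0 | exact: cube_box cm].
split => // y Fy; have [m _ Xy] := EX y (or_intror Fy); exists m => //.
case: ifP => // /asboolP[x [Ex Xx]].
have [_ [a [q /andP[q0 qd] [Xa _]]]] := hX m.
have := sep _ _ Ex Fy; rewrite leNgt => /negP[]; apply: (@le_lt_trans _ _ q); last lra.
apply: mx_le_coord => // i; rewrite !mxE.
have := Xa _ Xx i; have := Xa _ Xy i; rewrite ler_norml; lra.
Qed.

End Boxes.

(** * Linear maps scale volume *)

Section LinearVolume.
Context {R : realType} {n : nat}.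
Local Notation V := 'cV[R]_n.+1.
Implicit Types (E F X Y Z : set V) (c : R) (a b x y : V) (L T : 'M[R]_n.+1).

Definition scales (kappa : R) L : Prop := forall E c e, 0 < e -> gcov boxP E c ->
  gcov boxP (mulmx L @` E) (kappa * c + e).

(** Upper bounds for L and its inverse with reciprocal factors make the scaling exact. The factor is
    |det L|, but only its existence is recorded, since it cancels in distortion ratios. *)
Definition volume_scaling L : Prop := exists L' : 'M[R]_n.+1, exists2 kappa : R, 0 < kappa &
  L *m L' = 1%:M /\ L' *m L = 1%:M /\ scales kappa L /\ scales kappa^-1 L'.

Lemma box_scales (kappa : R) L : 0 <= kappa ->
  (forall X v e, boxP X v -> 0 < e -> gcov boxP (mulmx L @` X) (kappa * v + e)) ->
  scales kappa L.
Proof.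
move=> k0 h E c e e0 hc.
have hT X v e' : boxP X v -> 0 <= v -> 0 < e' -> gcov boxP (mulmx L @` X) (kappa * v + e').
  by move=> PX _; exact: h.
have [X [EX]] := gcov_bind boxP0 k0 hT hc e0.
apply: gcov_sub => _ [x Ex <-]; have [m _ Xx] := EX _ Ex.
by exists m => //; exists x.
Qed.

Lemma scales_comp (k1 k2 : R) L1 L2 : 0 <= k1 -> scales k1 L1 -> scales k2 L2 ->
  scales (k1 * k2) (L1 *m L2).
Proof.
move=> k10 h1 h2 E c e e0 hc.
have e10 : 0 < e / (2 * (k1 + 1)) by rewrite divr_gt0// mulr_gt0// ltr_wpDl.
have e20 : 0 < e / 2 by rewrite divr_gt0.
have h := h1 _ _ _ e20 (h2 _ _ _ e10 hc).
apply: gcov_sub (gcov_le _ h).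
  by move=> _ [x Ex <-]; exists (L2 *m x); [exists x | rewrite mulmxA].
have : k1 * (e / (2 * (k1 + 1))) <= e / 2.
  rewrite -subr_ge0 (_ : _ - _ = e / (2 * (k1 + 1))) ?ltW//.
  by field; rewrite gt_eqF// ltr_wpDl.
rewrite mulrDr; lra.
Qed.

Lemma volume_scaling1 : volume_scaling 1%:M.
Proof.
have s1 : scales 1 (1%:M : 'M[R]_n.+1).
  move=> E c e e0 hc; rewrite mul1r.
  apply: gcov_sub (gcov_le _ hc); last by rewrite lerDl ltW.
  by move=> _ [x Ex <-]; rewrite mul1mx.
by exists 1%:M, 1 => //; rewrite mulmx1 invr1.
Qed.

Lemma volume_scalingM L T : volume_scaling L -> volume_scaling T -> volume_scaling (L *m T).
Proof.
move=> [L' [k k0 [LL' [L'L [h1 h1']]]]] [T' [m m0 [TT' [T'T [h2 h2']]]]].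
exists (T' *m L'), (k * m); first exact: mulr_gt0.
split; first by rewrite -mulmxA (mulmxA T) TT' mul1mx.
split; first by rewrite -mulmxA (mulmxA L') L'L mul1mx.
split; first exact: scales_comp (ltW k0) h1 h2.
by rewrite invfM mulrC; apply: scales_comp => //; rewrite invr_ge0 ltW.
Qed.

Lemma perm_mx_coord (s : {perm 'I_n.+1}) x i : (perm_mx s *m x) i ord0 = x (s i) ord0.
Proof. by rewrite -row_permE mxE. Qed.

Lemma perm_scales (s : {perm 'I_n.+1}) : scales 1 (perm_mx s : 'M[R]_n.+1).
Proof.
apply: box_scales => // X v e [a [b [Xab abv]]] e0; rewrite mul1r.
have v0 : 0 <= v := le_trans (boxvol_ge0 a b) abv.
apply: (gcov_le _ (gcov1 boxP0 v0 _)); first by rewrite lerDl ltW.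
exists (\col_i a (s i) ord0), (\col_i b (s i) ord0); split.
  by move=> _ [x /Xab h <-] i; rewrite perm_mx_coord !mxE; exact: h.
apply: le_trans abv; rewrite /boxvol [leRHS](reindex_inj (@perm_inj _ s))/=.
by rewrite le_eqVlt; apply/orP; left; apply/eqP/eq_bigr => i _; rewrite !mxE.
Qed.

Lemma volume_scaling_perm (s : {perm 'I_n.+1}) : volume_scaling (perm_mx s).
Proof.
exists (perm_mx s^-1%g), 1 => //; rewrite -!perm_mxM mulgV mulVg perm_mx1 invr1.
by do 2!split => //; split; exact: perm_scales.
Qed.

Definition row_replace (k : 'I_n.+1) (r : 'rV[R]_n.+1) : 'M[R]_n.+1 :=
  \matrix_(i, j) if i == k then r ord0 j else (i == j)%:R.

Lemma row_replaceE k r (p : nat) (X : 'M[R]_(n.+1, p)) i j :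
  (row_replace k r *m X) i j = if i == k then \sum_l r ord0 l * X l j else X i j.
Proof.
rewrite mxE; case: eqP => [ik|/eqP ik].
  by apply: eq_bigr => l _; rewrite mxE ik eqxx.
rewrite (bigD1 i)//= big1 ?addr0 => [|l li]; first by rewrite mxE (negbTE ik) eqxx mul1r.
by rewrite mxE (negbTE ik) eq_sym (negbTE li) mul0r.
Qed.

(* Only coordinate k changes, so the box is cut into thin slices in all other directions. *)
Lemma row_replace_scales (k : 'I_n.+1) (r : 'rV[R]_n.+1) : scales `|r ord0 k| (row_replace k r).
Proof.
apply: box_scales => // X v e [a [b [Xab abv]]] e0.
have v0 : 0 <= v := le_trans (boxvol_ge0 a b) abv.
have [ab|ab0] := box_eq0_or a b; last first.
  apply: (@gcov_sub _ _ _ _ set0); first by move=> y [x /Xab + _]; rewrite ab0.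
  apply: (gcov_le _ (gcov1 boxP0 (lexx 0) boxP0)).
  by rewrite addr_ge0 ?mulr_ge0 ?(ltW e0).
pose l i := b i ord0 - a i ord0; have l0 i : 0 <= l i by rewrite subr_ge0.
pose Pk := \prod_(i | i != k) l i; have Pk0 : 0 <= Pk by exact: prodr_ge0.
pose C := \sum_(j | j != k) `|r ord0 j| * l j.
have C0 : 0 <= C by apply: sumr_ge0 => j _; exact: mulr_ge0.
pose M := Num.truncn (Pk * C / e).
have hM : Pk * C <= M.+1%:R * e.
  have /andP[_ /ltW] := truncn_itv (divr_ge0 (mulr_ge0 Pk0 C0) (ltW e0)).
  by rewrite ler_pdivrMr.
have M0 : 0 < M.+1%:R :> R by [].
pose Mi i := if i == k then 0%N else M.
pose h i := if i == k then l k else l i / M.+1%:R.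
have h0 i : 0 <= h i by rewrite /h; case: ifP => // _; exact: divr_ge0.
have hMi i : (Mi i).+1%:R * h i = l i.
  by rewrite /Mi /h; case: eqP => [->|_]; rewrite ?mul1r// mulrC divfK// gt_eqF.
pose G := {dffun forall i : 'I_n.+1, 'I_(Mi i).+1}.
pose a' (f : G) i := a i ord0 + (f i)%:R * h i.
pose w := \sum_j `|r ord0 j| * h j.
have w0 : 0 <= w by apply: sumr_ge0 => j _; exact: mulr_ge0.
pose mid (f : G) := \sum_j r ord0 j * (a' f j + h j / 2).
pose piece (f : G) : set V := [set x | forall i, a' f i <= x i ord0 <= a' f i + h i].
apply: (@gcov_sub _ _ _ _ [set y | exists f, (mulmx (row_replace k r) @` piece f) y]).
  move=> _ [x /Xab xab <-]; have [//|i|f hf] := @grid _ _ Mi a h x.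
    by rewrite hMi; have := xab i; rewrite /l; lra.
  by exists f, x.
pose u := \prod_i (if i == k then w else h i).
have u0 : 0 <= u by apply: prodr_ge0 => i _; case: ifP.
apply: (@gcov_le _ _ _ _ (\sum_(f : G) u)); last first.
  apply: gcov_fin => [|f]; first exact: boxP0.
  apply: gcov1 => //; first exact: boxP0.
  exists (\col_i if i == k then mid f - w / 2 else a' f i).
  exists (\col_i if i == k then mid f + w / 2 else a' f i + h i); split.
    move=> _ [x fx <-] i; rewrite row_replaceE !mxE; case: ifP => // _.
    suff : `|\sum_j r ord0 j * x j ord0 - mid f| <= w / 2 by rewrite ler_norml; lra.
    rewrite -sumrB mulr_suml; apply: (le_trans (ler_norm_sum _ _ _)).
    apply: ler_sum => j _; rewrite -mulrBr normrM -mulrA ler_wpM2l// ler_norml.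
    have := fx j; lra.
  rewrite boxvolE => [|i]; last first.
    by rewrite !mxE; case: ifP => _; [have := w0; lra | rewrite lerDl].
  rewrite le_eqVlt; apply/orP; left; apply/eqP/eq_bigr => i _.
  by rewrite !mxE; case: ifP => _; lra.
rewrite sumr_const card_grid -[leLHS]mulr_natl natr_prod -big_split/=.
rewrite (bigD1 k)//= eqxx (eq_bigr l) => [|i /negbTE ik]; last first.
  by rewrite ik hMi.
have wE : w = `|r ord0 k| * l k + C / M.+1%:R.
  rewrite /w (bigD1 k)//= /h eqxx; congr (_ + _); rewrite mulr_suml.
  by apply: eq_bigr => j /negbTE jk; rewrite jk mulrA.
have -> : Mi k = 0%N by rewrite /Mi eqxx.
rewrite mul1r -/Pk wE mulrDl.
have vE : boxvol a b = l k * Pk by rewrite boxvolE// (bigD1 k).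
apply: lerD.
  by rewrite -mulrA -vE ler_wpM2l.
by rewrite mulrAC ler_pdivrMr// mulrC (mulrC e).
Qed.

Lemma volume_scaling_row_replace (k : 'I_n.+1) (r : 'rV[R]_n.+1) : r ord0 k != 0 -> volume_scaling (row_replace k r).
Proof.
move=> rk0.
pose r' : 'rV[R]_n.+1 := \row_j if j == k then (r ord0 k)^-1 else - r ord0 j / r ord0 k.
have r'k : r' ord0 k = (r ord0 k)^-1 by rewrite mxE eqxx.
have sumE (q1 q2 : 'rV[R]_n.+1) j :
    \sum_l q1 ord0 l * row_replace k q2 l j =
    q1 ord0 k * q2 ord0 j + (if j == k then 0 else q1 ord0 j).
  rewrite (bigD1 k)//= mxE eqxx; congr (_ + _); case: eqP => [->|/eqP jk].
    by rewrite big1// => l lk; rewrite mxE (negbTE lk) mulr0.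
  rewrite (bigD1 j)//= mxE (negbTE jk) eqxx mulr1 big1 ?addr0// => l /andP[lk lj].
  by rewrite mxE (negbTE lk) (negbTE lj) mulr0.
exists (row_replace k r'), `|r ord0 k|; first by rewrite normr_gt0.
split.
  apply/matrixP => i j; rewrite row_replaceE [RHS]mxE; case: eqP => [->|/eqP ik].
    rewrite sumE mxE (eq_sym k); case: eqP => [_|_]; first by rewrite mulfV// addr0.
    by rewrite mulrC divfK// addNr.
  by rewrite mxE (negbTE ik).
split.
  apply/matrixP => i j; rewrite row_replaceE [RHS]mxE; case: eqP => [->|/eqP ik].
    rewrite sumE r'k (eq_sym k); case: eqP => [->|/eqP jk]; first by rewrite mulVf// addr0.
    by rewrite mxE (negbTE jk) mulNr mulrC subrr.
  by rewrite mxE (negbTE ik).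
split; first exact: row_replace_scales.
by rewrite -normfV -r'k; exact: row_replace_scales.
Qed.

Lemma volume_scaling_triangular (rk : 'I_n.+1 -> nat) T : injective rk ->
  (forall i j, T i j != 0 -> (rk i <= rk j)%N) -> (forall i, T i i != 0) ->
  volume_scaling T.
Proof.
move=> rk_inj Ttri Tdiag.
pose Tk m : 'M[R]_n.+1 := \matrix_(i, j) if (rk i < m)%N then T i j else (i == j)%:R.
have -> : T = Tk (\max_i rk i).+1.
  by apply/matrixP => i j; rewrite mxE ltnS (leq_bigmax i).
elim: (_.+1) => [|m IH].
  have -> : Tk 0%N = 1%:M by apply/matrixP => i j; rewrite !mxE.
  exact: volume_scaling1.
have [[i0 rki0]|nex] := pselect (exists i0, rk i0 = m); last first.
  have -> : Tk m.+1 = Tk m; last exact: IH.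
  apply/matrixP => i j; rewrite !mxE ltnS leq_eqVlt; case: eqP => //= im.
  by case: nex; exists i.
have -> : Tk m.+1 = row_replace i0 (row i0 T) *m Tk m; last first.
  by apply: volume_scalingM => //; apply: volume_scaling_row_replace; rewrite mxE.
apply/matrixP => i j; rewrite row_replaceE; case: eqP => [->|/eqP ii0].
  rewrite mxE rki0 ltnSn (bigD1 j)//= !mxE eqxx big1 => [|l lj].
    rewrite addr0; case: ifP => [rkj|_]; last by rewrite mulr1.
    have [->|T0] := eqVneq (T i0 j) 0; first by rewrite mul0r.
    by have := Ttri _ _ T0; rewrite rki0 leqNgt rkj.
  rewrite !mxE; case: ifP => [rkl|_]; last by rewrite (negbTE lj) mulr0.
  have [->|T0] := eqVneq (T i0 l) 0; first by rewrite mul0r.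
  by have := Ttri _ _ T0; rewrite rki0 leqNgt rkl.
rewrite !mxE ltnS leq_eqVlt; case: eqP => //= im.
by case/negP: ii0; apply/eqP/rk_inj; rewrite im.
Qed.

Lemma volume_scaling_unit T : T \in unitmx -> volume_scaling T.
Proof.
move=> uT; have := cormen_lup_correct T.
have := cormen_lup_perm T; have := @cormen_lup_lower _ _ T.
have := @cormen_lup_upper _ _ T; have := cormen_lup_detL T.
case: (cormen_lup T) => [[P L] U] /= dL hU hL /is_perm_mxP[s ->] PTLU.
have Udiag i : U i i != 0.
  have : \det U != 0.
    have := congr1 determinant PTLU; rewrite !det_mulmx dL mul1r => <-.
    by rewrite mulf_neq0// -?unitfE -?unitmxE// unitmx_perm.
  have -> : \det U = \prod_i U i i.
    rewrite -det_tr det_trig; first by apply: eq_bigr => j _; rewrite mxE.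
    by apply/is_trig_mxP => j l jl; rewrite mxE hU.
  by apply: contra_neq => Ui0; rewrite (bigD1 i)//= Ui0 mul0r.
have gU : volume_scaling U.
  apply: (@volume_scaling_triangular val U val_inj) => // i j Uij.
  by rewrite leqNgt; apply: contra Uij => ji; rewrite hU.
have gL : volume_scaling L.
  apply: (@volume_scaling_triangular (fun i => n - i)%N) => [i j ij|i j Lij|i].
  - apply: val_inj => /=; have := ltn_ord i; have := ltn_ord j; rewrite !ltnS => jn iN.
    by rewrite -(subKn jn) -(subKn iN) ij.
  - apply: leq_sub2l; rewrite leqNgt; apply: contra Lij => ij.
    by rewrite hL ?(ltnW ij)// -val_eqE/= ltn_eqF.
  - by rewrite hL// eqxx oner_eq0.
have -> : T = perm_mx s^-1%g *m (L *m U).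
  by rewrite -[L *m U]PTLU -[perm_mx s * T]/(perm_mx s *m T) mulmxA -perm_mxM mulVg perm_mx1 mul1mx.
by apply: volume_scalingM; [exact: volume_scaling_perm | exact: volume_scalingM].
Qed.

Lemma vol_mulmx T : T \in unitmx -> exists2 kappa : R, 0 < kappa &
  forall E c, gcov boxP E c -> (exists c', gcov boxP (mulmx T @` E) c') /\
    vol boxP (mulmx T @` E) = kappa * vol boxP E.
Proof.
move=> /volume_scaling_unit[T' [kappa k0 [TT' [T'T [h h']]]]]; exists kappa => // E c hc.
split; first by exists (kappa * c + 1); exact: h.
have half (k1 : R) T1 E1 c1 : 0 < k1 -> scales k1 T1 -> gcov boxP E1 c1 ->
    vol boxP (mulmx T1 @` E1) <= k1 * vol boxP E1.
  move=> k10 s1 g1; apply/ler_addgt0Pr => e e0.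
  have e20 : 0 < e / 2 by rewrite divr_gt0.
  have d0 : 0 < e / (2 * k1) by rewrite divr_gt0// mulr_gt0.
  apply: (le_trans (vol_le (s1 _ _ _ e20 (vol_gcov g1 d0)))).
  rewrite mulrDr (_ : k1 * (e / (2 * k1)) = e / 2); last by field; rewrite gt_eqF.
  by rewrite -addrA -splitr.
apply/eqP; rewrite eq_le (half _ _ _ _ k0 h hc)/=.
have hc' := h _ _ _ ltr01 hc.
have k0' : 0 < kappa^-1 by rewrite invr_gt0.
have := half _ _ _ _ k0' h' hc'; rewrite ler_pdivlMl// => h1; apply: le_trans h1; rewrite ler_pM2l//.
rewrite image_comp (_ : mulmx T' \o mulmx T = id) ?image_id//.
by apply/funext => x /=; rewrite mulmxA T'T mul1mx.
Qed.

End LinearVolume.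

(** * Regularity of measurable sets *)

Section Regularity.
Context {R : realType} {n : nat}.
Local Notation V := 'cV[R]_n.+1.
Implicit Types (E F X Y Z K : set V) (c e : R) (a b x y : V).

Definition ubox : set V := box (const_mx (- 1)) (const_mx 1).

(** Cutting down to the cube [-1, 1]^(n+1) makes the outer volume of every set finite; cones over
    subsets of the sphere lie in this cube. *)
Definition nu E : R := vol boxP (E `&` ubox).

Lemma gcov_ubox : gcov boxP ubox (boxvol (const_mx (- 1) : V) (const_mx 1)).
Proof.
apply: gcov1; [exact: boxP0|exact: boxvol_ge0|].
by exists (const_mx (- 1)), (const_mx 1); split.
Qed.

Lemma gcov_nu E : gcov boxP (E `&` ubox) (boxvol (const_mx (- 1) : V) (const_mx 1)).
Proof. by apply: gcov_sub gcov_ubox => x []. Qed.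

Lemma nu_gcov E e : 0 < e -> gcov boxP (E `&` ubox) (nu E + e).
Proof. exact: vol_gcov (gcov_nu E). Qed.

Lemma nu_le E c : gcov boxP (E `&` ubox) c -> nu E <= c.
Proof. exact: vol_le. Qed.

Lemma nu_ge0 E : 0 <= nu E. Proof. exact: vol_ge0. Qed.

Lemma nu_mono E F : E `<=` F -> nu E <= nu F.
Proof. by move=> EF; apply: vol_mono (gcov_nu F); exact: setSI. Qed.

Lemma nu0 : nu set0 = 0.
Proof.
apply/eqP; rewrite eq_le nu_ge0 andbT; apply: nu_le; rewrite set0I.
by apply: gcov1 => //; exact: boxP0.
Qed.

Lemma nu_bigcup (E : nat -> set V) c : (forall N, \sum_(m < N) nu (E m) <= c) ->
  nu (\bigcup_m E m) <= c.
Proof.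
move=> hc; apply/ler_addgt0Pr => e e0; have [s s0 hs] := geometric_slack e0.
apply: nu_le; rewrite setI_bigcupl.
apply: (@gcov_bigcup _ _ _ _ (fun m => nu (E m) + s m)).
- exact: boxP0.
- by move=> m; exact: nu_gcov.
- by move=> N; rewrite big_split/=; apply: lerD; [exact: hc | exact: hs].
Qed.

Lemma nu_setU E F : nu (E `|` F) <= nu E + nu F.
Proof.
apply/ler_addgt0Pr => e e0; have e20 : 0 < e / 2 by rewrite divr_gt0.
apply: nu_le; rewrite setIUl.
apply: (gcov_le _ (gcov_setU boxP0 (nu_gcov E e20) (nu_gcov F e20))); lra.
Qed.

Lemma nu_separated E F (delta : R) : 0 < delta ->
  (forall x y, E x -> ubox x -> F y -> ubox y -> delta <= `|x - y|) ->
  nu E + nu F <= nu (E `|` F).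
Proof.
move=> d0 sep; apply/ler_addgt0Pr => e e0.
apply: (@vol_separated _ _ _ _ _ delta) => //; last first.
  by rewrite -setIUl; exact: nu_gcov.
by move=> x y [Ex Ux] [Fy Uy]; exact: sep.
Qed.

(** Caratheodory's condition; the opposite inequality is subadditivity. *)
Definition carS E : Prop := forall X, nu (X `&` E) + nu (X `\` E) <= nu X.

Lemma carSC E : carS E -> carS (~` E).
Proof. by move=> h X; rewrite setDE setCK addrC -setDE. Qed.

Lemma carSI E F : carS E -> carS F -> carS (E `&` F).
Proof.
move=> hE hF X; apply: le_trans (hE X).
have h1 := hF (X `&` E).
have h2 : nu (X `\` (E `&` F)) <= nu (X `&` E `\` F) + nu (X `\` E).
  apply: (le_trans _ (nu_setU _ _)); apply: nu_mono => x [Xx nEF].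
  have [Ex|nEx] := pselect (E x); last by right.
  by left; split => // Fx; apply: nEF.
rewrite setIA; lra.
Qed.

Lemma carSU E F : carS E -> carS F -> carS (E `|` F).
Proof.
by move=> hE hF; rewrite -[E `|` F]setCK setCU; apply/carSC/carSI; exact: carSC.
Qed.

Lemma carS_bigsetU (E : nat -> set V) N : (forall m, carS (E m)) ->
  carS (\big[setU/set0]_(m < N) E m).
Proof.
move=> hE; elim: N => [|N IH]; last by rewrite big_ord_recr; exact: carSU.
by rewrite big_ord0 => X; rewrite setI0 setD0 nu0 add0r.
Qed.

(** The disjoint increments [D m] have bounded partial sums of measures, and what the first N sets
    miss is covered by the increments from N on, the tail of a convergent series. *)
Lemma carS_tail (E : nat -> set V) e : (forall m, carS (E m)) -> 0 < e ->
  exists N, nu (\bigcup_m E m `\` \big[setU/set0]_(m < N) E m) <= e.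
Proof.
move=> hE e0; pose E' N := \big[setU/set0]_(m < N) E m.
pose D m := E m `\` E' m; pose s N := \sum_(m < N) nu (D m).
have sE N : s N <= nu (E' N).
  elim: N => [|N IH]; first by rewrite /s big_ord0 nu_ge0.
  rewrite /s big_ord_recr/= -/(s N); apply: le_trans (carS_bigsetU N hE (E' N.+1)).
  rewrite -/(E' N); apply: lerD.
    by apply: (le_trans IH); apply: nu_mono => x E'x; split => //; rewrite /E' big_ord_recr; left.
  by apply: nu_mono => x [Ex nE'x]; split => //; rewrite /E' big_ord_recr; right.
pose T := [set t | exists N, t = s N].
have hT : has_sup T.
  split; first by exists (s 0%N); exists 0%N.
  by exists (nu setT) => _ [N ->]; apply: (le_trans (sE N)); exact: nu_mono.
have [_ [N ->] hN] := sup_adherent e0 hT.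
exists N; apply: (@le_trans _ _ (sup T - s N)); last lra.
apply: (@le_trans _ _ (nu (\bigcup_m D (N + m)%N))).
  apply: nu_mono => x [[m0 _ Em0] nE'x].
  have ex : exists m, `[< E m x >] by exists m0; apply/asboolP.
  case: (ex_minnP ex) => m /asboolP Em mmin.
  have nE' M : (forall j, (j < M)%N -> ~ E j x) -> ~ E' M x.
    by move=> h; rewrite /E' -(bigcup_mkord _ E) => -[j jM Ejx]; exact: h Ejx.
  have Nm : (N <= m)%N.
    rewrite leqNgt; apply/negP => mN; apply: nE'x.
    by rewrite -(bigcup_mkord _ E); exists m.
  exists (m - N)%N => //; rewrite subnKC//; split => //; apply: nE' => j jm Ejx.
  by have := mmin j; rewrite leqNgt jm => h; have := h (asboolT Ejx).
apply: nu_bigcup => M.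
have -> : \sum_(m < M) nu (D (N + m)%N) = s (N + M)%N - s N.
  by rewrite /s big_split_ord/= addrAC subrr add0r.
by rewrite lerD2r; apply: sup_upper_bound => //; exists (N + M)%N.
Qed.

Lemma closed_separated K K' : compact K -> closed K' -> K `&` K' = set0 ->
  exists2 delta : R, 0 < delta & forall x y, K x -> K' y -> delta <= `|x - y|.
Proof.
move=> cK cK' KK'.
have hn : \forall d \near 0^'+, K `<=` [set x | forall y, K' y -> d <= `|x - y|].
  apply: ((compact_near_coveringP K).1 cK R 0^'+ (fun d x => forall y, K' y -> d <= `|x - y|)).
  move=> x Kx.
  have nK'x : ~ K' x by move=> K'x; have : (K `&` K') x by []; rewrite KK'.
  have /nbhs_ballP[r r0 hr] : nbhs x (~` K') by apply: open_nbhs_nbhs; split => //; exact: closed_openC.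
  have r20 : 0 < r / 2 by rewrite divr_gt0.
  near=> x' d => /= y K'y.
  have h1 : r <= `|x - y|.
    rewrite leNgt; apply/negP => lt; apply: (hr y) => //.
    by rewrite -ball_normE.
  have h2 : `|x - x'| < r / 2.
    by near: x'; apply: cvgr_dist_lt => //; exact: cvg_id.
  have h3 : d < r / 2 by near: d; exact: nbhs_right_lt.
  have := ler_distD x' x y; lra.
near (0:R)^'+ => d; exists d; first by near: d; exact: nbhs_right_gt.
move=> x y Kx; apply: (_ : K `<=` [set x | forall y, K' y -> d <= `|x - y|]) => //.
by near: d.
Unshelve. all: by end_near. Qed.

(** Closed approximation from inside of the set and of its complement. The symmetry gives stability
    under complements at once, and within the cube the two approximations are a positive distance
    apart. *)
Definition Reg E : Prop := forall e : R, 0 < e -> exists K K', closed K /\ closed K' /\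
  K `<=` E /\ K' `<=` ~` E /\ nu (~` (K `|` K')) <= e.

Lemma RegC E : Reg E -> Reg (~` E).
Proof.
move=> h e e0; have [K [K' [c1 [c2 [KE [K'E he]]]]]] := h _ e0.
by exists K', K; do 3!split => //; rewrite setCK (setUC K').
Qed.

Lemma compact_ubox K : closed K -> compact (K `&` ubox).
Proof.
move=> cK; apply: (@compact_cV _ _ _ (n.+1%:R)).
  apply: closedI => //; rewrite /ubox.
  have -> : box (const_mx (- 1) : V) (const_mx 1) =
      \bigcap_(i in setT) (fun x : V => x i ord0) @^-1` [set t | - 1 <= t <= 1].
    by apply/seteqP; split=> [x h i _|x h i]; have := h i; rewrite /= !mxE//; apply.
  apply: closed_bigI => i _; apply: preimage_closed; first by move=> x _; exact: coord_continuous.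
  have -> : [set t : R | - 1 <= t <= 1] = [set t | - 1 <= t] `&` [set t | t <= 1].
    by apply/seteqP; split=> t /=; [move/andP | move=> [-> ->]].
  by apply: closedI; [exact: closed_ge | exact: closed_le].
move=> x [_ Ux]; apply: (le_trans (enorm_le_mx _)); rewrite ler_piMr//.
by apply: mx_le_coord => // i; have := Ux i; rewrite !mxE ler_norml.
Qed.

Lemma Reg_carS E : Reg E -> carS E.
Proof.
move=> h X; apply/ler_addgt0Pr => e e0; have e20 : 0 < e / 2 by rewrite divr_gt0.
have [K [K' [c1 [c2 [KE [K'E he]]]]]] := h _ e20.
have [|d d0 sep] := closed_separated (compact_ubox c1) c2.
  by apply/seteqP; split => // x [[/KE + _] /K'E].
have h1 : nu (X `&` K) + nu (X `&` K') <= nu X.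
  apply: (@le_trans _ _ (nu ((X `&` K) `|` (X `&` K')))); last first.
    by apply: nu_mono => x [[]|[]].
  by apply: (nu_separated d0) => x y [_ Kx] Ux [_ K'y] _; exact: sep.
have h2 : nu (X `&` E) <= nu (X `&` K) + nu (~` (K `|` K')).
  apply: (le_trans _ (nu_setU _ _)); apply: nu_mono => x [Xx Ex].
  have [Kx|nKx] := pselect (K x); [by left | right => -[//|/K'E]]; exact.
have h3 : nu (X `\` E) <= nu (X `&` K') + nu (~` (K `|` K')).
  apply: (le_trans _ (nu_setU _ _)); apply: nu_mono => x [Xx nEx].
  have [Kx|nKx] := pselect (K' x); [by left | right => -[/KE|//]]; exact.
lra.
Qed.

Lemma Reg_bigcup (E : nat -> set V) : (forall m, Reg (E m)) -> Reg (\bigcup_m E m).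
Proof.
move=> hE e e0; have e20 : 0 < e / 2 by rewrite divr_gt0.
have [s s0 hs] := geometric_slack e20.
have /choice[K /choice[K' hK]] := fun m => hE m (s m) (s0 m).
have [N hN] := carS_tail (fun m => Reg_carS (hE m)) e20.
(* A countable union of closed sets need not be closed, so only N of the [K m] are kept; [carS_tail]
   bounds what is lost. *)
exists (\big[setU/set0]_(m < N) K m), (\bigcap_m K' m).
split; first by apply: closed_bigsetU => m _; have [] := hK m.
split; first by apply: closed_bigI => m _; have [_ []] := hK m.
split.
  rewrite -(bigcup_mkord N K) => x [m _ Kx]; exists m => //.
  by have [_ [_ [KE _]]] := hK m; exact: KE.
split.
  move=> x K'x [m _ Ex]; have [_ [_ [_ [K'E _]]]] := hK m.
  exact: K'E (K'x m I) Ex.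
apply: (@le_trans _ _ (nu (\bigcup_m ~` (K m `|` K' m)) +
    nu (\bigcup_m E m `\` \big[setU/set0]_(m < N) E m))); last first.
  have h1 : nu (\bigcup_m ~` (K m `|` K' m)) <= e / 2.
    apply: nu_bigcup => M; apply: le_trans (hs M); apply: ler_sum => m _.
    by have [_ [_ [_ [_]]]] := hK m.
  lra.
apply: (le_trans _ (nu_setU _ _)); apply: nu_mono => x.
rewrite setCU -(bigcup_mkord N K) -(bigcup_mkord N E) => -[nK nK'].
have [h|h] := pselect (exists m, ~ (K m x \/ K' m x)).
  by left; have [m hm] := h; exists m.
have {}h m : K m x \/ K' m x by apply: contrapT => hm; apply: h; exists m.
right; have /existsNP[m hm] : ~ (forall m, K' m x) by move=> h'; apply: nK' => m _.
split; first by exists m => //; have [_ [_ [KE _]]] := hK m; apply: KE; case: (h m).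
move=> [j jN Ejx]; have [_ [_ [_ [K'E _]]]] := hK j.
case: (h j) => [Kjx|K'jx]; last exact: K'E K'jx Ejx.
by apply: nK; exists j.
Qed.

Lemma Reg0 : Reg set0.
Proof.
move=> e e0; exists set0, setT; split; first exact: closed0.
by split; [exact: closedT | rewrite setUT setCT nu0 setC0; do !split => //; exact: ltW].
Qed.

Lemma RegU E F : Reg E -> Reg F -> Reg (E `|` F).
Proof.
move=> hE hF; have -> : E `|` F = \bigcup_m (if m == 0%N then E else F).
  apply/seteqP; split=> [x [Ex|Fx]|x [m _]]; [by exists 0%N|by exists 1%N|].
  by case: ifP => _ ?; [left | right].
by apply: Reg_bigcup => m; case: ifP.
Qed.

Lemma RegI E F : Reg E -> Reg F -> Reg (E `&` F).
Proof.
by move=> hE hF; rewrite -[E `&` F]setCK setCI; apply/RegC/RegU; exact: RegC.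
Qed.

Lemma Reg_halfspace (i : 'I_n.+1) (s c : R) : `|s| = 1 -> Reg [set x : V | s * x i ord0 < c].
Proof.
(* Inside the cube the gap between the two closed sets lies in a box with one side 2 d and n sides
   2, of volume d W = e. *)
move=> s1 e e0; pose W : R := 2 * 2 ^+ n; have W0 : 0 < W by rewrite mulr_gt0// exprn_gt0.
pose d := e / W; have d0 : 0 < d by rewrite divr_gt0.
have cont : continuous (fun x : V => s * x i ord0).
  move=> x; apply: differentiable_continuous.
  by apply: (@differentiableZ _ _ _ (fun y : V => y i ord0 : R) s); exact: differentiable_coord.
exists [set x | s * x i ord0 <= c - d], [set x | c <= s * x i ord0].
split.
  apply: (@preimage_closed _ _ (fun x : V => s * x i ord0) [set t | t <= c - d]); last exact: closed_le.
  by move=> x _; exact: cont.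
split.
  apply: (@preimage_closed _ _ (fun x : V => s * x i ord0) [set t | c <= t]); last exact: closed_ge.
  by move=> x _; exact: cont.
split; first by move=> x /=; lra.
split; first by move=> x /= h; apply/negP; rewrite -leNgt.
have ss : s * s = 1 by rewrite -expr2 -real_normK ?num_real// s1 expr1n.
pose a : V := \col_j if j == i then s * c - d else - 1.
pose b : V := \col_j if j == i then s * c + d else 1.
apply: (@nu_le _ e); apply: gcov1; [exact: boxP0|exact: ltW|].
exists a, b; split.
  move=> x [nx Ux] j; rewrite !mxE; case: eqP => [->|_]; last by have := Ux j; rewrite !mxE.
  have h1 : c - d < s * x i ord0.
    by rewrite ltNge; apply/negP => h; apply: nx; left.
  have h2 : s * x i ord0 < c.
    by rewrite ltNge; apply/negP => h; apply: nx; right.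
  suff : `|x i ord0 - s * c| <= d by rewrite ler_norml; lra.
  have -> : x i ord0 - s * c = s * (s * x i ord0 - c) by rewrite mulrBr mulrA ss mul1r.
  rewrite normrM s1 mul1r ler_norml; lra.
rewrite boxvolE => [|j]; last by rewrite !mxE; case: ifP => _; lra.
rewrite (bigD1 i)//= (eq_bigr (fun=> 2)) => [|j /negbTE ji]; last by rewrite !mxE ji; lra.
rewrite prodr_const !mxE eqxx.
have -> : #|[pred j : 'I_n.+1 | j != i]| = n.
  by rewrite cardC1 card_ord.
have -> : s * c + d - (s * c - d) = 2 * d by lra.
by rewrite le_eqVlt; apply/orP; left; apply/eqP; rewrite /d /W; field; rewrite expf_neq0.
Qed.

Definition obox (q : V) (r : R) : set V := [set x | forall i, `|x i ord0 - q i ord0| < r].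

Lemma Reg_obox q r : Reg (obox q r).
Proof.
suff h (s : seq 'I_n.+1) : Reg [set x : V | forall i, i \in s -> `|x i ord0 - q i ord0| < r].
  have -> : obox q r = [set x : V | forall i, i \in enum 'I_n.+1 -> `|x i ord0 - q i ord0| < r].
    by apply/seteqP; split=> x h' i; [move=> _; exact: h' | apply: h'; rewrite mem_enum].
  exact: h.
elim: s => [|i s IH].
  have -> : [set x : V | forall i, i \in [::] -> `|x i ord0 - q i ord0| < r] = ~` set0.
    by apply/seteqP; split=> [x _|x _ i] //; case.
  exact/RegC/Reg0.
have -> : [set x : V | forall j, j \in i :: s -> `|x j ord0 - q j ord0| < r] =
    ([set x : V | 1 * x i ord0 < q i ord0 + r] `&` [set x : V | (- 1) * x i ord0 < r - q i ord0])
    `&` [set x : V | forall i, i \in s -> `|x i ord0 - q i ord0| < r].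
  apply/seteqP; split=> [x h|x [[h1 h2] h3] j].
    split; last by move=> j js; apply: h; rewrite in_cons js orbT.
    by have := h i (mem_head _ _); rewrite ltr_norml /=; lra.
  rewrite in_cons => /orP[/eqP ->|]; last exact: h3.
  by move: h1 h2 => /=; rewrite ltr_norml; lra.
by apply: RegI => //; apply: RegI; apply: Reg_halfspace; rewrite ?normrN normr1.
Qed.

Lemma Reg_open E : open E -> Reg E.
Proof.
move=> oE; pose I := ({ffun 'I_n.+1 -> rat} * nat)%type.
pose ctr (p : I) : V := \col_i ratr (p.1 i); pose rad_ (p : I) : R := p.2.+1%:R^-1.
pose B m := if @unpickle I m is Some p then
  (if `[< obox (ctr p) (rad_ p) `<=` E >] then obox (ctr p) (rad_ p) else set0) else set0.
have -> : E = \bigcup_m B m.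
  apply/seteqP; split=> [x Ex|x [m _]]; last first.
    by rewrite /B; case: unpickle => // p; case: ifP => // /asboolP h; exact: h.
  have /nbhs_ballP[r /= r0 hr] : nbhs x E by apply: open_nbhs_nbhs.
  pose j := Num.truncn (2 / r).
  have rj : j.+1%:R^-1 < r / 2 :> R.
    have /andP[_] := truncn_itv (divr_ge0 (ler0n R 2) (ltW r0)).
    rewrite -/j => h; rewrite -[ltRHS]invrK ltf_pV2 ?posrE ?invr_gt0 ?divr_gt0//.
    by rewrite invf_div.
  have j0 : 0 < j.+1%:R^-1 :> R by rewrite invr_gt0.
  have /choice[q hq] : forall i, exists q : rat, `|x i ord0 - ratr q| < j.+1%:R^-1.
    move=> i; have [|q] := @rat_in_itvoo R (x i ord0 - j.+1%:R^-1) (x i ord0 + j.+1%:R^-1).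
      by rewrite ltrBlDr -addrA ltrDl addr_gt0.
    rewrite in_itv/= => /andP[q1 q2]; exists q; rewrite ltr_norml.
    move: j0 q1 q2; move: (_^-1) (ratr q) => t u j0 q1 q2; lra.
  pose p : I := ([ffun i => q i], j).
  have xp : obox (ctr p) (rad_ p) x by move=> i; rewrite /ctr mxE ffunE; exact: hq.
  exists (pickle p) => //; rewrite /B pickleK ifT//; apply/asboolP => y hy; apply: hr.
  rewrite -ball_normE /=; move: xp hy; rewrite /rad_/= => xp hy.
  move: (_^-1) rj j0 xp hy => t rj j0 xp hy; apply: (@le_lt_trans _ _ (2 * t)); last lra.
  apply: mx_le_coord => [|i]; first by rewrite mulr_ge0 ?(ltW j0).
  rewrite !mxE; have := xp i; have := hy i; rewrite ltr_norml ltr_norml ler_norml mxE; lra.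
apply: Reg_bigcup => m; rewrite /B; case: unpickle => [p|]; last exact: Reg0.
by case: ifP => _; [exact: Reg_obox | exact: Reg0].
Qed.

Lemma Reg_borel E : borel E -> Reg E.
Proof.
apply: smallest_sub => [|F]; last exact: Reg_open.
split; [exact: Reg0 | move=> F hF; rewrite setTD; exact: RegC | exact: Reg_bigcup].
Qed.

End Regularity.

(** * The measure of subsets of the sphere *)

Section SphereMeasure.
Context {R : realType} {n : nat}.
Local Notation V := 'cV[R]_n.+1.
Local Notation S := (@sphere R n).
Implicit Types (A C E F X Y Z K : set V) (c e : R) (a b x y : V) (g h : V -> V).

Lemma lnull_gcov E : lnull E <-> forall e, 0 < e -> gcov boxP E e.
Proof.
split=> h e e0.
  have [a [b [Eab hs]]] := h _ e0.
  exists (fun m => box (a m) (b m)), (fun m => boxvol (a m) (b m)); split => // m.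
  by split; [exact: boxvol_ge0 | exists (a m), (b m); split].
have [X [v [hX [EX hv]]]] := h _ e0.
have /choice[ab hab] : forall m, exists ab : V * V, X m `<=` box ab.1 ab.2 /\ boxvol ab.1 ab.2 <= v m.
  by move=> m; have [_ [a [b [h1 h2]]]] := hX m; exists (a, b).
exists (fun m => (ab m).1), (fun m => (ab m).2); split.
  by move=> x /EX[m _ Xx]; exists m => //; have [h1 _] := hab m; exact: h1.
by move=> N; apply: le_trans (hv N); apply: ler_sum => m _; have [] := hab m.
Qed.

Lemma open_coord_box (a b : V) (q : R) :
  open [set x : V | forall i, a i ord0 - q < x i ord0 < b i ord0 + q].
Proof.
rewrite openE => x hx; apply/nbhs_ballP.
have [i|r r0 hr] := @fin_min R _ (fun (i : 'I_n.+1) r =>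
    a i ord0 - q + r <= x i ord0 <= b i ord0 + q - r).
  have /andP[h1 h2] := hx i.
  exists (Num.min (x i ord0 - (a i ord0 - q)) (b i ord0 + q - x i ord0)).
    by rewrite lt_min !subr_gt0 h1.
  move=> r; rewrite le_min => /andP[_ /andP[r1 r2]]; lra.
exists r => // y; rewrite -ball_normE /= => xy i.
have := hr i; have := le_lt_trans (coord_le_mx _ i) xy; rewrite !mxE ltr_norml; lra.
Qed.

Lemma box_open X (v e : R) : boxP X v -> 0 < e -> exists W, open W /\ X `<=` W /\ boxP W (v + e).
Proof.
move=> [a [b [Xab abv]]] e0; have [ab|ab0] := box_eq0_or a b; last first.
  exists set0; split; first exact: open0.
  split; first by rewrite -ab0.
  have [a' [b' [h1 h2]]] := @boxP0 R n; exists a', b'; split => //.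
  by apply: (le_trans h2); rewrite addr_ge0 ?(ltW e0)// (le_trans (boxvol_ge0 a b)).
have l0 i : 0 <= b i ord0 - a i ord0 by rewrite subr_ge0.
have [q q0 hq] := prod_addr_limit l0 e0.
exists [set x : V | forall i, a i ord0 - q / 2 < x i ord0 < b i ord0 + q / 2].
split; first exact: open_coord_box.
split; first by move=> x /Xab hx i; have := hx i; lra.
exists (\col_i (a i ord0 - q / 2)), (\col_i (b i ord0 + q / 2)); split.
  by move=> x hx i; rewrite !mxE; have := hx i; lra.
rewrite boxvolE => [|i]; last by rewrite !mxE; have := l0 i; lra.
apply: le_trans (lerD abv (lexx e)); rewrite boxvolE//.
apply: le_trans (hq q _); last by rewrite lexx ltW.
by rewrite le_eqVlt; apply/orP; left; apply/eqP/eq_bigr => i _; rewrite !mxE; lra.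
Qed.

Lemma null_open E e : lnull E -> 0 < e -> exists W, open W /\ E `<=` W /\ gcov boxP W e.
Proof.
move=> /lnull_gcov hE e0; have e20 : 0 < e / 2 by rewrite divr_gt0.
have [X [v [hX [EX hv]]]] := hE _ e20.
have [s s0 hs] := geometric_slack e20.
have /choice[W hO] := fun m => box_open (hX m).2 (s0 m).
exists (\bigcup_m W m); split; first by apply: bigcup_open => m _; have [] := hO m.
split; first by move=> x /EX[m _ Xx]; exists m => //; have [_ [h _]] := hO m; exact: h.
exists W, (fun m => v m + s m); split.
  by move=> m; split; [rewrite addr_ge0 ?(ltW (s0 m))//; have [] := hX m | have [_ []] := hO m].
split => // N; rewrite big_split/=; have := hv N; have := hs N; lra.
Qed.

Lemma Reg_lmeasurable E : lmeasurable E -> Reg E.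
Proof.
move=> [B [/Reg_borel hB nD]] e e0; have e20 : 0 < e / 2 by rewrite divr_gt0.
have [K [K' [c1 [c2 [KB [K'B he]]]]]] := hB _ e20.
have [W [oO [DO gO]]] := null_open nD e20.
(* Removing an open neighbourhood of the symmetric difference keeps both sets closed and puts them
   on the right sides of E instead of B. *)
exists (K `\` W), (K' `\` W).
have cO : closed (~` W) by exact: open_closedC.
split; first exact: closedI.
split; first exact: closedI.
split.
  move=> x [/KB Bx nOx]; apply: contrapT => nEx; apply/nOx/DO; by right.
split.
  move=> x [/K'B nBx nOx] Ex; apply/nOx/DO; by left.
apply: (@le_trans _ _ (nu (~` (K `|` K')) + nu W)); last first.
  have : nu W <= e / 2 by apply: nu_le; apply: gcov_sub gO => x [].
  lra.
apply: (le_trans _ (nu_setU _ _)); apply: nu_mono => x nKK.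
have [Ox|nOx] := pselect (W x); [by right | left].
by move=> [Kx|K'x]; apply: nKK; [left | right].
Qed.

Lemma coneS E F : E `<=` F -> cone E `<=` cone F.
Proof. by move=> EF _ [t [x [t01 [Ex ->]]]]; exists t, x; split => //; split => //; exact: EF. Qed.

Lemma coneP E y : E `<=` S -> cone E y <-> y != 0 /\ enorm y <= 1 /\ E (unitv y).
Proof.
move=> ES; split=> [[t [x [/andP[t0 t1] [Ex ->]]]]|[y0 [y1 Ey]]].
  have sx := ES _ Ex; split; first by rewrite scaler_eq0 negb_or gt_eqF ?sphere_neq0.
  by rewrite enormZ gtr0_norm// sx mulr1 unitvZ// unitv_id.
by exists (enorm y), (unitv y); rewrite enorm_gt0 y0 y1 scale_unitv.
Qed.

Lemma cone_ubox E : E `<=` S -> cone E `<=` ubox.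
Proof.
move=> ES y /(coneP _ ES)[_ [y1 _]] i; rewrite !mxE -ler_norml.
exact: le_trans (coord_le_enorm _ _) y1.
Qed.

Definition mu E : R := nu (cone E).

Lemma mu_ge0 E : 0 <= mu E. Proof. exact: nu_ge0. Qed.

Lemma mu_mono E F : E `<=` F -> mu E <= mu F.
Proof. by move=> EF; exact/nu_mono/coneS. Qed.

Lemma mu_setU E F : mu (E `|` F) <= mu E + mu F.
Proof.
apply: (le_trans _ (nu_setU _ _)); apply: nu_mono => _ [t [x [t01 [[Ex|Fx] ->]]]].
  by left; exists t, x.
by right; exists t, x.
Qed.

Lemma mu0 : mu set0 = 0.
Proof.
rewrite /mu (_ : cone set0 = set0) ?nu0//.
by apply/seteqP; split => // y [t [x [_ []]]].
Qed.

Lemma mu_bigcup (E : nat -> set V) c : (forall N, \sum_(m < N) mu (E m) <= c) ->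
  mu (\bigcup_m E m) <= c.
Proof.
move=> hc; apply: (le_trans _ (@nu_bigcup _ _ (fun m => cone (E m)) c hc)); apply: nu_mono.
by move=> _ [t [x [t01 [[m _ Ex] ->]]]]; exists m => //; exists t, x.
Qed.

Lemma mu_fin (I : finType) (E : I -> set V) :
  mu [set x | exists i, E i x] <= \sum_i mu (E i).
Proof.
have h (s : seq I) : mu [set x | exists2 i, i \in s & E i x] <= \sum_(i <- s) mu (E i).
  elim: s => [|i s IH].
    rewrite big_nil (_ : [set x | _] = set0) ?mu0//.
    by apply/seteqP; split => // x [].
  rewrite big_cons; apply: le_trans (lerD (lexx _) IH); apply: (le_trans _ (mu_setU _ _)).
  apply: mu_mono => x [j]; rewrite in_cons => /orP[/eqP ->|js] Ex; first by left.
  by right; exists j.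
apply: le_trans (h (index_enum I)); apply: mu_mono => x [i Ex].
by exists i; rewrite ?mem_index_enum.
Qed.

Lemma mu_snull E : E `<=` S -> mu E = 0 -> snull E.
Proof.
move=> ES E0; apply/lnull_gcov => e e0; have := nu_gcov (cone E) e0.
rewrite -/(mu E) E0 add0r; apply: gcov_sub => x Ex; split => //.
exact: cone_ubox Ex.
Qed.

Definition carMu C : Prop := forall X, X `<=` S -> mu (X `&` C) + mu (X `\` C) <= mu X.

Lemma carMuC C : carMu C -> carMu (~` C).
Proof. by move=> h X XS; rewrite setDE setCK addrC -setDE; exact: h. Qed.

Lemma carMuI C C' : carMu C -> carMu C' -> carMu (C `&` C').
Proof.
move=> hE hF X XS; apply: le_trans (hE X XS).
have h1 := hF (X `&` C) (fun x Xx => XS x Xx.1).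
have h2 : mu (X `\` (C `&` C')) <= mu (X `&` C `\` C') + mu (X `\` C).
  apply: (le_trans _ (mu_setU _ _)); apply: mu_mono => x [Xx nEF].
  have [Ex|nEx] := pselect (C x); last by right.
  by left; split => // Fx; apply: nEF.
rewrite setIA; lra.
Qed.

Lemma carMu_of_Reg C : C `<=` S -> Reg (cone C) -> carMu C.
Proof.
move=> CS /Reg_carS hC X XS; apply: le_trans (hC (cone X)).
have XCS : X `&` C `<=` S by move=> x [/XS].
have XDS : X `\` C `<=` S by move=> x [/XS].
apply: lerD; apply: nu_mono => y.
  by move=> /(coneP _ XCS)[y0 [y1 [Xy Cy]]]; split; apply/coneP.
move=> /(coneP _ XDS)[y0 [y1 [Xy nCy]]]; split; first exact/coneP.
by move/(coneP _ CS) => [_ [_]].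
Qed.

Lemma carMu_sum (I : finType) (C : I -> set V) X : X `<=` S -> (forall i, carMu (C i)) ->
  (forall i j x, C i x -> C j x -> i = j) -> \sum_i mu (X `&` C i) <= mu X.
Proof.
move=> XS hC dC; suff h (s : seq I) : uniq s -> forall Y, Y `<=` S ->
    \sum_(i <- s) mu (Y `&` C i) <= mu Y by apply: h => //; exact: index_enum_uniq.
elim: s => [|i s IH] /=; first by move=> _ Y _; rewrite big_nil mu_ge0.
move=> /andP[is_ us] Y YS; rewrite big_cons; apply: le_trans (hC i Y YS); apply: lerD => //.
have YDS : Y `\` C i `<=` S by move=> x [/YS].
apply: le_trans (IH us _ YDS); rewrite big_seq [leRHS]big_seq; apply: ler_sum => j js.
apply: mu_mono => x [Yx Cjx]; split => //; split => // Cix.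
by move: is_; rewrite (dC _ _ _ Cix Cjx) js.
Qed.

Lemma continuous_unitv x : x != 0 -> {for x, continuous (@unitv R n)}.
Proof.
move=> x0; have nx : 0 < enorm x by rewrite enorm_gt0.
apply: (@lipschitz_continuous_at R V V _ (2 * n.+1%:R / enorm x) 1) => // y _.
apply: (le_trans (mx_le_enorm _)); apply: (le_trans (enorm_unitvB _ x0)).
rewrite [leRHS]mulrAC ler_pM2r ?invr_gt0// -mulrA ler_pM2l//; exact: enorm_le_mx.
Qed.

Lemma lipS_continuous (k : R) h x : (forall y, sphere y -> sphere (h y)) -> lipS k h -> x != 0 ->
  {for x, continuous (fun y : V => h (unitv y))}.
Proof.
move=> hS lh x0; have nx : 0 < enorm x by rewrite enorm_gt0.
have d0 : 0 < enorm x / n.+1%:R by rewrite divr_gt0.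
apply: (@lipschitz_continuous_at R V V _ (`|k| * (2 * n.+1%:R / enorm x)) _ _ d0) => y xy.
have y0 : y != 0.
  apply/eqP => y0; move: xy; rewrite y0 subr0 ltr_pdivlMr// mulrC => h1.
  by have := le_lt_trans (enorm_le_mx x) h1; rewrite ltxx.
apply: (le_trans (mx_le_enorm _)).
apply: (le_trans (lh _ _ (unitv_sphere x0) (unitv_sphere y0))).
apply: (@le_trans _ _ (`|k| * enorm (unitv x - unitv y))).
  by rewrite ler_wpM2r ?enorm_ge0 ?ler_norm.
rewrite -[leRHS]mulrA ler_wpM2l//; apply: (le_trans (enorm_unitvB _ x0)).
rewrite [leRHS]mulrAC ler_pM2r ?invr_gt0// -mulrA ler_pM2l//; exact: enorm_le_mx.
Qed.

Lemma open_neq0 : open [set y : V | y != 0].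
Proof.
have -> : [set y : V | y != 0] = (@enorm R n) @^-1` [set t | 0 < t].
  by apply/seteqP; split=> y /=; rewrite enorm_gt0.
by apply: open_comp; [move=> y _; exact: continuous_enorm | exact: open_gt].
Qed.

Lemma Reg_coneS : Reg (cone S).
Proof.
have -> : cone S = [set y : V | y != 0] `&` ~` [set y | 1 < enorm y].
  apply/seteqP; split=> [y /(coneP _ (@subset_refl _ _))[y0 [y1 _]]|y [y0 y1]].
    by split => //=; apply/negP; rewrite -leNgt.
  apply/(coneP _ (@subset_refl _ _)); split => //; split; last exact: unitv_sphere.
  by rewrite leNgt; apply/negP.
apply: RegI; first by apply: Reg_open; exact: open_neq0.
apply/RegC/Reg_open; apply: (@open_comp _ _ (@enorm R n) [set t | 1 < t]); last exact: open_gt.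
by move=> y _; exact: continuous_enorm.
Qed.

Lemma carMu_ball (k : R) h (e : V) (t : R) : (forall y, sphere y -> sphere (h y)) -> lipS k h ->
  carMu [set x | sphere x /\ enorm (h x - e) < t].
Proof.
move=> hS lh; apply: carMu_of_Reg; first by move=> x [].
set C := [set x | _]; have CS : C `<=` S by move=> x [].
pose f (y : V) : R := enorm (h (unitv y) - e).
have -> : cone C = cone S `&` ([set y : V | y != 0] `&` f @^-1` [set s | s < t]).
  apply/seteqP; split=> [y /(coneP _ CS)[y0 [y1 [sy hy]]]|y].
    by split => //; apply/(coneP _ (@subset_refl _ _)).
  move=> [/(coneP _ (@subset_refl _ _))[y0 [y1 sy]] [_ hy]].
  by apply/(coneP _ CS).
apply: RegI; first exact: Reg_coneS.
apply: Reg_open; rewrite openE => y [y0 fy].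
have : {for y, continuous f}.
  apply: (@continuous_comp _ _ _ (fun y : V => h (unitv y)) (fun z : V => enorm (z - e))).
    exact: (lipS_continuous hS lh y0).
  apply: (@lipschitz_continuous _ _ _ _ n.+1%:R) => u w.
  apply: (le_trans (ler_enorm_dist _ _)).
  rewrite opprB addrA subrK; exact: enorm_le_mx.
move=> cf; apply: filterI; first by apply: open_nbhs_nbhs; split => //; exact: open_neq0.
by apply: cf; apply: open_nbhs_nbhs; split => //; exact: open_lt.
Qed.

Lemma smeasurable_compl A : A `<=` S -> smeasurable A -> Reg (cone A) /\ Reg (cone (S `\` A)).
Proof.
move=> AS /Reg_lmeasurable rA; split => //.
have -> : cone (S `\` A) = cone S `&` ~` cone A.
  have SAS : S `\` A `<=` S by move=> x [].
  apply/seteqP; split=> [y /(coneP _ SAS)[y0 [y1 [sy nAy]]]|y].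
    split; first exact/(coneP _ (@subset_refl _ _)).
    by move/(coneP _ AS) => [_ [_]].
  move=> [/(coneP _ (@subset_refl _ _))[y0 [y1 sy]] nAy].
  apply/(coneP _ SAS); split => //; split => //; split => // Ay; apply: nAy.
  exact/(coneP _ AS).
by apply: RegI; [exact: Reg_coneS | exact: RegC].
Qed.

(** A closed subset of the cone is projected radially; it avoids the origin, so the projection is
    continuous on it. The cone over the image contains that subset again, hence nothing more is
    lost. *)
Lemma inner_regular A e : A `<=` S -> Reg (cone A) -> 0 < e ->
  exists2 K, compact K & K `<=` A /\ mu (A `\` K) <= e.
Proof.
move=> AS rA e0; have [K [K' [c1 [c2 [KA [K'A he]]]]]] := rA _ e0.
have K0 x : K x -> x != 0 by move/KA/(coneP _ AS) => [].
exists (@unitv R n @` (K `&` ubox)).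
  apply: continuous_compact; last exact: compact_ubox.
  apply: continuous_in_subspaceT => x; rewrite inE => -[Kx _].
  exact/continuous_unitv/K0.
split; first by move=> _ [x [/KA + _] <-] => /(coneP _ AS)[_ []].
apply: (le_trans _ he); apply: nu_mono => y.
have AKS : A `\` (@unitv R n @` (K `&` ubox)) `<=` S by move=> x [/AS].
move=> /(coneP _ AKS)[y0 [y1 [Ay nK]]]; have cy : cone A y by apply/coneP.
move=> [Ky|/K'A]; last exact.
by apply: nK; exists y => //; split => //; exact: (cone_ubox AS).
Qed.

Lemma polar_dist x y (a b : R) : sphere x -> sphere y -> 0 <= a -> 0 <= b ->
  `|a - b| <= enorm (a *: x - b *: y) /\ b * enorm (x - y) <= 2 * enorm (a *: x - b *: y).
Proof.
move=> sx sy a0 b0.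
have h1 : `|a - b| <= enorm (a *: x - b *: y).
  have := ler_enorm_dist (a *: x) (b *: y).
  by rewrite !enormZ sx sy !mulr1 (ger0_norm a0) (ger0_norm b0).
split => //; have := ler_enorm_add (a *: x) (b *: x) (b *: y).
rewrite -scalerBr -scalerBl !enormZ sx mulr1 (ger0_norm b0) distrC; lra.
Qed.

(** Of degree one, so that the cone over E goes to the cone over g(E); [rad], constant on rays,
    would flatten it onto the sphere. *)
Definition homext g (x : V) : V := enorm x *: g (unitv x).

Lemma homext_cone g E : (forall x, sphere x -> sphere (g x)) -> E `<=` S ->
  homext g @` cone E = cone (g @` E).
Proof.
move=> gS ES; apply/seteqP; split=> [_ [_ [t [x [/andP[t0 t1] [Ex ->]]]] <-]|].
  have sx := ES _ Ex; exists t, (g x); rewrite t0 t1; split => //; split; first by exists x.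
  by rewrite /homext enormZ sx mulr1 gtr0_norm// unitvZ// unitv_id.
move=> _ [t [_ [/andP[t0 t1] [[x Ex <-] ->]]]]; have sx := ES _ Ex.
exists (t *: x); first by exists t, x; rewrite t0 t1.
by rewrite /homext enormZ sx mulr1 gtr0_norm// unitvZ// unitv_id.
Qed.

Lemma mu_gcov E e : E `<=` S -> 0 < e -> gcov boxP (cone E) (mu E + e).
Proof.
move=> ES e0; apply: gcov_sub (nu_gcov (cone E) e0) => x cx; split => //.
exact: (cone_ubox ES).
Qed.

Lemma mu_vol E : E `<=` S -> mu E = vol boxP (cone E).
Proof. by move=> ES; rewrite /mu /nu setIidl//; exact: cone_ubox. Qed.

Lemma mu_image_le (k : R) g : (forall x, sphere x -> sphere (g x)) -> 0 <= k -> lipS k g ->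
  exists2 C : R, 0 <= C & forall E, E `<=` S -> mu (g @` E) <= C * mu E.
Proof.
move=> gS k0 lg; pose L : R := (1 + 2 * k) * n.+1%:R.
have L0 : 0 <= L by rewrite mulr_ge0// addr_ge0// mulr_ge0.
exists (L ^+ n.+1); first exact: exprn_ge0.
move=> E ES; have gES : g @` E `<=` S by move=> _ [x /ES sx <-]; exact: gS.
apply/ler_addgt0Pr => e e0.
pose kap := L ^+ n.+1; have kap0 : 0 <= kap by exact: exprn_ge0.
have e10 : 0 < e / (2 * (kap + 1)) by rewrite divr_gt0// mulr_gt0// ltr_wpDl.
have e20 : 0 < e / 2 by rewrite divr_gt0.
have hl x y : cone E x -> cone E y -> `|homext g x - homext g y| <= L * `|id x - id y|.
  move=> /(coneP _ ES)[x0 [_ Ex]] /(coneP _ ES)[y0 [_ Ey]]; rewrite /= /homext.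
  have sx := ES _ Ex; have sy := ES _ Ey.
  have [h1 h2] := polar_dist sx sy (enorm_ge0 x) (enorm_ge0 y).
  rewrite !scale_unitv in h1 h2.
  apply: (le_trans (mx_le_enorm _)); rewrite -mulrA.
  apply: (@le_trans _ _ ((1 + 2 * k) * enorm (x - y))); last first.
    by rewrite ler_wpM2l ?enorm_le_mx// addr_ge0// mulr_ge0.
  have -> : enorm x *: g (unitv x) - enorm y *: g (unitv y) =
      (enorm x - enorm y) *: g (unitv x) + enorm y *: (g (unitv x) - g (unitv y)).
    by rewrite scalerBl scalerBr addrA subrK.
  apply: (le_trans (ler_enormD _ _)); rewrite !enormZ (gS _ sx) mulr1 (ger0_norm (enorm_ge0 y)).
  have h3 := ler_wpM2l (enorm_ge0 y) (lg _ _ sx sy).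
  have h4 := ler_wpM2l k0 h2; lra.
have hc := mu_gcov ES e10; rewrite -(image_id (cone E)) in hc.
have := lipschitz_gcov L0 hl hc e20; rewrite homext_cone// => h.
rewrite mu_vol//; apply: (le_trans (vol_le h)).
have : kap * (e / (2 * (kap + 1))) <= e / 2.
  rewrite -subr_ge0 (_ : _ - _ = e / (2 * (kap + 1))) ?ltW//.
  by field; rewrite gt_eqF// ltr_wpDl.
rewrite -/kap mulrDr; lra.
Qed.

End SphereMeasure.

(** * Volume distortion *)

Section Distortion.
Context {R : realType} {n : nat}.
Local Notation V := 'cV[R]_n.+1.
Local Notation S := (@sphere R n).
Implicit Types (A C E F X Y Z K : set V) (x y : V) (g h f : V -> V).
Variable alpha : R.
Hypothesis alpha01 : 0 < alpha <= 1.

Lemma alpha_gt0 : 0 < alpha. Proof. by have /andP[] := alpha01. Qed.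

Lemma powR_alpha_le (s t : R) : 0 <= s -> s <= t -> s `^ alpha <= t `^ alpha.
Proof.
move=> s0 st; apply: ge0_ler_powR => //; first exact: ltW alpha_gt0.
by rewrite nnegrE (le_trans s0).
Qed.

Lemma powR_small (eta : R) : 0 < eta -> exists2 s0 : R, 0 < s0 <= 2^-1 &
  forall s, 0 <= s <= s0 -> s `^ alpha <= eta.
Proof.
move=> eta0; have a0 := alpha_gt0.
exists (Num.min 2^-1 (eta `^ alpha^-1)).
  by rewrite lt_min invr_gt0 ltr0n powR_gt0//= ge_min lexx.
move=> s /andP[s0]; rewrite le_min => /andP[_ s1].
have -> : eta = (eta `^ alpha^-1) `^ alpha.
  by rewrite -powRrM mulVf ?gt_eqF// powRr1// ltW.
exact: powR_alpha_le.
Qed.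

(** Absorbs errors of order s into the Hoelder error s^alpha; this uses alpha <= 1. *)
Lemma le_powR_alpha (s : R) : 0 <= s <= 1 -> s <= s `^ alpha.
Proof.
move=> /andP[s0 s1]; have /andP[a0 a1] := alpha01.
have [->|sn0] := eqVneq s 0; first by rewrite powR_ge0.
by rewrite -{1}(powRr1 s0) ger_powR// s1 lt_def sn0 s0.
Qed.

Lemma linear_mulmx (f : {linear V -> V}) : exists M : 'M[R]_n.+1, forall v, f v = M *m v.
Proof.
exists (\matrix_(i, j) f (delta_mx j ord0) i ord0) => v.
have vE : v = \sum_j v j ord0 *: delta_mx j ord0.
  apply/matrixP => i j; rewrite (ord1 j) summxE (bigD1 i)//= big1 ?addr0 => [|k ki].
    by rewrite !mxE !eqxx mulr1.
  by rewrite !mxE eq_sym (negbTE ki) mulr0.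
rewrite {1}vE linear_sum; apply/matrixP => i j; rewrite (ord1 j) summxE mxE.
by apply: eq_bigr => k _; rewrite linearZ/= !mxE mulrC.
Qed.

Lemma derive_mulmx f x : differentiable f x ->
  exists M : 'M[R]_n.+1, forall v, 'D_v f x = M *m v.
Proof.
move=> df; have [M hM] := linear_mulmx ('d f x).
by exists M => v; rewrite deriveE.
Qed.

(** D is the derivative of [rad f] at y; it kills y because [rad f] is constant on rays. The bound
    for all pairs near y comes from the mean value inequality along chords, whose points are first
    normalised to make the Hoelder condition applicable. *)
Lemma Hoelder_expansion f : C1map f -> Hoelder_deriv alpha f -> exists2 C : R, 0 <= C &
  forall y, sphere y -> exists D : 'M[R]_n.+1, D *m y = 0 /\
    forall (s : R) x z, 0 <= s <= 2^-1 -> sphere x -> sphere z ->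
      enorm (x - y) <= s -> enorm (z - y) <= s ->
      enorm (f x - f z - D *m (x - z)) <= C * s `^ alpha * enorm (x - z).
Proof.
move=> C1f [C0 hC0]; pose C := `|C0|.
have a0 := alpha_gt0; have /andP[_ a1] := alpha01.
have hC x y v : sphere x -> sphere y -> enorm v <= 1 ->
    enorm ('D_v (rad f) x - 'D_v (rad f) y) <= C * enorm (x - y) `^ alpha.
  move=> sx sy v1; apply: (le_trans (hC0 _ _ _ sx sy v1)).
  by rewrite ler_wpM2r ?powR_ge0// ler_norm.
have df x : sphere x -> differentiable (rad f) x.
  by move=> sx; have [] := C1f x (sphere_neq0 sx).
have hCv x y v : sphere x -> sphere y ->
    enorm ('D_v (rad f) x - 'D_v (rad f) y) <= C * enorm (x - y) `^ alpha * enorm v.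
  move=> sx sy; have [->|v0] := eqVneq v 0.
    rewrite -(scale0r (0 : V)) (derive_scale _ _ (df _ sx)) (derive_scale _ _ (df _ sy)) !scale0r.
    by rewrite subrr enorm0 mulr0.
  rewrite -{1 2}(scale_unitv v) (derive_scale _ _ (df _ sx)) (derive_scale _ _ (df _ sy)).
  rewrite -scalerBr enormZ ger0_norm ?enorm_ge0// mulrC ler_pM2r ?enorm_gt0//.
  by apply: hC => //; rewrite (unitv_sphere v0).
pose y0 : V := delta_mx ord0 ord0; have sy0 : sphere y0 by exact: sphere_delta.
have [M0 hM0] := derive_mulmx (df _ sy0); have [K0 K01 hK0] := mulmx_bound M0.
have Cge0 : 0 <= C by exact: normr_ge0.
have K0ge0 : 0 <= K0 by apply: le_trans K01.
(* A uniform bound on the derivative: its size at [y0] plus the Hoelder variation over distances at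
   most 2. *)
pose B := 2 * C + K0; have B0 : 0 <= B by rewrite addr_ge0 ?mulr_ge0.
have hB y v : sphere y -> enorm ('D_v (rad f) y) <= B * enorm v.
  move=> sy; have h1 := hCv _ _ v sy sy0.
  have h2 : enorm (y - y0) <= 2 by apply: (le_trans (ler_enormB _ _)); rewrite sy sy0; lra.
  have h3 : enorm (y - y0) `^ alpha <= 2.
    apply: (@le_trans _ _ (2 `^ alpha)).
      by apply: powR_alpha_le => //; exact: enorm_ge0.
    by rewrite -[leRHS](powRr1 (ler0n R 2)) ler_powR// ler1n.
  have := ler_enormD ('D_v (rad f) y - 'D_v (rad f) y0) ('D_v (rad f) y0); rewrite subrK.
  have h4 := hK0 v; rewrite -hM0 in h4.
  have : C * enorm (y - y0) `^ alpha * enorm v <= C * 2 * enorm v.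
    by rewrite ler_wpM2r ?enorm_ge0// ler_wpM2l.
  rewrite /B; lra.
(* 10 C is the factor 1/|p| <= 2 times the variation over the distance 5 s from y to the normalised
   point; 4 B comes from the deviation of 1/|p| from 1. *)
exists (10 * C + 4 * B); first by rewrite addr_ge0// mulr_ge0.
move=> y sy; have [D hD] := derive_mulmx (df _ sy); exists D; split.
  rewrite -hD.
  apply/eqP; rewrite -enorm_eq0 eq_le enorm_ge0 andbT.
  apply/ler_addgt0Pr => e e0; rewrite add0r.
  have dd : derivable (rad f) y y by apply: diff_derivable; exact: df.
  have /cvgrPdist_le : (fun h : R => h^-1 *: ((rad f \o shift y) (h *: y) - rad f y)) @ 0^'
      --> 'D_y (rad f) y by exact: dd.
  have en0 : 0 < e / n.+1%:R by rewrite divr_gt0.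
  move=> /(_ _ en0) hn.
  near (0 : R)^' => t.
  have ht : `|'D_y (rad f) y - t^-1 *: ((rad f \o shift y) (t *: y) - rad f y)| <= e / n.+1%:R.
    by near: t.
  have t1 : `|t| < 1.
    by near: t; apply: dnbhs0_lt.
  have z : (rad f \o shift y) (t *: y) = rad f y.
    rewrite /= -{2}(scale1r y) -scalerDl radZ//; move: t1; rewrite ltr_norml; lra.
  rewrite z subrr scaler0 subr0 in ht.
  by apply: (le_trans (enorm_le_mx _)); rewrite mulrC -ler_pdivlMr.
move=> s x z /andP[s0 s2] sx sz xy zy.
have sa0 := powR_ge0 s alpha.
have ssa : s <= s `^ alpha by apply: le_powR_alpha; rewrite s0; lra.
pose v := x - z; have vs : enorm v <= 2 * s.
  have := ler_enorm_add y x z; rewrite (enorm_distC y z) -/v; lra.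
have xE : x = z + v by rewrite /v addrC subrK.
rewrite -(rad_sphere f sx) -(rad_sphere f sz) {1}xE.
apply: mean_value_ineq => t t01; have /andP[t0 t1] := t01.
have pn : 2^-1 <= enorm (z + t *: v).
  by apply: sphere_segment => //; rewrite -?xE//; lra.
have pz : enorm (z - (z + t *: v)) <= enorm v.
  rewrite opprD addrA subrr add0r enormN enormZ ger0_norm// ler_piMl ?enorm_ge0//.
set p := z + t *: v in pn pz *.
have pn0 : 0 < enorm p by lra.
have p0 : p != 0 by rewrite -enorm_gt0.
have sp := unitv_sphere p0.
split; first by apply: diff_derivable; have [] := C1f _ p0.
rewrite derive_unitv// -hD (derive_scale _ _ (df _ sp)).
have upy : enorm (unitv p - y) <= 5 * s.
  have := enorm_unitvB p (sphere_neq0 sz); rewrite sz divr1 (unitv_id sz) => h1.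
  have := ler_enorm_add z (unitv p) y; rewrite (enorm_distC (unitv p) z); lra.
have upa : enorm (unitv p - y) `^ alpha <= 5 * s `^ alpha.
  apply: (@le_trans _ _ ((5 * s) `^ alpha)).
    by apply: powR_alpha_le => //; exact: enorm_ge0.
  rewrite powRM// ler_wpM2r//.
  by rewrite -[leRHS](powRr1 (ler0n R 5)) ler_powR// ler1n.
have q0 : 0 < (enorm p)^-1 by rewrite invr_gt0.
have q2 : (enorm p)^-1 <= 2 by rewrite -[leRHS]invrK lef_pV2 ?posrE//; lra.
have q1 : `|(enorm p)^-1 - 1| <= 4 * s.
  have -> : (enorm p)^-1 - 1 = (enorm p)^-1 * (1 - enorm p).
    by rewrite mulrBr mulr1 mulVf// gt_eqF.
  rewrite normrM gtr0_norm//.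
  have h1 : `|1 - enorm p| <= enorm v.
    by rewrite -sz; apply: le_trans (ler_enorm_dist _ _) pz.
  have := ler_pM (ltW q0) (normr_ge0 _) q2 h1; lra.
have -> : (enorm p)^-1 *: 'D_v (rad f) (unitv p) - 'D_v (rad f) y =
   (enorm p)^-1 *: ('D_v (rad f) (unitv p) - 'D_v (rad f) y) +
   ((enorm p)^-1 - 1) *: 'D_v (rad f) y.
  by rewrite scalerBr scalerBl scale1r addrA subrK.
apply: (le_trans (ler_enormD _ _)); rewrite !enormZ (gtr0_norm q0).
have v0 := enorm_ge0 v.
have i1 : (enorm p)^-1 * enorm ('D_v (rad f) (unitv p) - 'D_v (rad f) y) <=
    2 * (C * (5 * s `^ alpha) * enorm v).
  apply: ler_pM => //; [exact: ltW|exact: enorm_ge0|].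
  apply: (le_trans (hCv _ _ v sp sy)); rewrite ler_wpM2r// ler_wpM2l//.
have i2 : `|(enorm p)^-1 - 1| * enorm ('D_v (rad f) y) <= (4 * s `^ alpha) * (B * enorm v).
  apply: ler_pM; [exact: normr_ge0|exact: enorm_ge0| |exact: hB].
  by apply: (le_trans q1); rewrite ler_pM2l.
lra.
Unshelve. all: by end_near. Qed.

End Distortion.

Section BoundedDistortion.
Context {R : realType} {n : nat}.
Local Notation V := 'cV[R]_n.+1.
Local Notation S := (@sphere R n).
Implicit Types (E F : set V) (x y z v X Y Z : V) (g h f : V -> V) (L : 'M[R]_n.+1).
Variable alpha : R.
Hypothesis alpha01 : 0 < alpha <= 1.

Lemma inj_unitmx L : (forall v, L *m v = 0 -> v = 0) -> L \in unitmx.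
Proof.
move=> h; rewrite -unitmx_tr -row_free_unit; apply: inj_row_free => v vL.
by rewrite -[v]trmxK (h v^T) ?trmx0// -[L]trmxK -trmx_mul vL trmx0.
Qed.

Lemma homextE f x (a : R) : sphere x -> 0 < a -> homext f (a *: x) = a *: f x.
Proof.
by move=> sx a0; rewrite /homext enormZ sx mulr1 gtr0_norm// unitvZ// unitv_id.
Qed.

Lemma homext_expansion f : (forall x, sphere x -> sphere (f x)) ->
  C1map f -> Hoelder_deriv alpha f -> exists2 C : R, 0 <= C &
  forall y, sphere y -> exists L, forall (s : R) X Z, 0 <= s <= 2^-1 ->
    X != 0 -> Z != 0 -> enorm (unitv X - y) <= s -> enorm (unitv Z - y) <= s ->
    enorm (homext f X - homext f Z - L *m (X - Z)) <= C * s `^ alpha * enorm (X - Z).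
Proof.
move=> fS C1f Hf; have [C C0 hC] := Hoelder_expansion alpha01 C1f Hf.
exists (3 * (C + 2)); first by rewrite mulr_ge0// addr_ge0.
move=> y sy; have [D [Dy hD]] := hC _ sy.
(* The derivative of the extension at y: it sends the radial vector y to f(y) and acts as D on
   tangent vectors. *)
exists (f y *m y^T + D) => s X Z s01 X0 Z0 Xy Zy.
have LE v : (f y *m y^T + D) *m v = dot y v *: f y + D *m v.
  by rewrite mulmxDl -mulmxA [y^T *m v]mx11_scalar mul_mx_scalar.
have /andP[s0 s2] := s01.
have ssa : s <= s `^ alpha by apply: le_powR_alpha => //; rewrite s0; lra.
have sa0 := powR_ge0 s alpha.
set a := enorm X; set b := enorm Z; set x := unitv X in Xy *; set z := unitv Z in Zy *.
have a0 : 0 < a by rewrite enorm_gt0.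
have b0 : 0 < b by rewrite enorm_gt0.
have sx : sphere x by exact: unitv_sphere.
have sz : sphere z by exact: unitv_sphere.
have XE : X = a *: x by rewrite scale_unitv.
have ZE : Z = b *: z by rewrite scale_unitv.
have [p1 p2] := polar_dist sx sz (ltW a0) (ltW b0); rewrite -XE -ZE in p1 p2.
rewrite {1}XE {1}ZE !homextE//.
have -> : a *: f x - b *: f z - (f y *m y^T + D) *m (X - Z) =
    (a - b) *: (f x - (f y *m y^T + D) *m x) +
    b *: (f x - f z - (f y *m y^T + D) *m (x - z)).
  rewrite XE ZE; move: (f y *m y^T + D) => M; rewrite !mulmxBr -!scalemxAr.
  move: (M *m x) (M *m z) => u w.
  by apply/matrixP => i j; rewrite !mxE; ring.
have h1 : enorm (f x - (f y *m y^T + D) *m x) <= (C + 1) * s `^ alpha.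
  have -> : f x - (f y *m y^T + D) *m x =
      (f x - f y - D *m (x - y)) + dot y (y - x) *: f y.
    rewrite LE mulmxBr Dy subr0 dotBr (sphere_dot sy) scalerBl scale1r.
    by move: (D *m x) (dot y x) => u t; apply/matrixP => i j; rewrite !mxE; ring.
  apply: (le_trans (ler_enormD _ _)); rewrite enormZ (fS _ sy) mulr1 mulrDl mul1r.
  apply: lerD.
    apply: (le_trans (hD s x y s01 sx sy Xy _)); first by rewrite subrr enorm0.
    by rewrite ler_piMr ?mulr_ge0//; lra.
  apply: (le_trans (normr_dot _ _)); rewrite sy mul1r enorm_distC; lra.
have h2 : enorm (f x - f z - (f y *m y^T + D) *m (x - z)) <= (C + 2) * s `^ alpha * enorm (x - z).
  rewrite LE opprD addrCA addrC; apply: (le_trans (ler_enormD _ _)).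
  have i1 := hD s x z s01 sx sz Xy Zy.
  have i2 := dot_sphereB y sx sz; rewrite (enorm_distC y) (enorm_distC y z) in i2.
  rewrite enormN enormZ (fS _ sy) mulr1.
  have i3 : (enorm (x - y) + enorm (z - y)) * enorm (x - z) <= 2 * s `^ alpha * enorm (x - z).
    by rewrite ler_wpM2r ?enorm_ge0//; lra.
  lra.
apply: (le_trans (ler_enormD _ _)); rewrite !enormZ (gtr0_norm b0).
have CC : 0 <= (C + 2) * s `^ alpha by rewrite mulr_ge0// addr_ge0.
have i1 : `|a - b| * enorm (f x - (f y *m y^T + D) *m x) <= enorm (X - Z) * ((C + 2) * s `^ alpha).
  apply: ler_pM => //; [exact: enorm_ge0|].
  by apply: (le_trans h1); rewrite ler_wpM2r//; lra.
have i2 : b * enorm (f x - f z - (f y *m y^T + D) *m (x - z)) <=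
    (C + 2) * s `^ alpha * (2 * enorm (X - Z)).
  apply: (@le_trans _ _ ((C + 2) * s `^ alpha * (b * enorm (x - z)))).
    by rewrite mulrCA ler_pM2l.
  by rewrite ler_wpM2l.
lra.
Qed.

(** Cross-multiplied so that null sets cause no division. One constant governs the exponent and,
    through its inverse, the radius of validity, so enlarging it weakens the statement. *)
Definition distortion (C : R) g : Prop := forall y (s : R) E F, sphere y -> 0 < s <= C^-1 ->
  E `<=` [set x | sphere x /\ enorm (x - y) <= s] ->
  F `<=` [set x | sphere x /\ enorm (x - y) <= s] ->
  mu (g @` E) * mu F <= expR (C * s `^ alpha) * (mu (g @` F) * mu E).

Lemma distortion_le (C C' : R) g : 0 < C -> C <= C' -> distortion C g -> distortion C' g.
Proof.
move=> C0 CC h y s E F sy /andP[s0 sC] hE hF.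
have C'0 : 0 < C' by apply: lt_le_trans CC.
apply: (le_trans (h y s E F sy _ hE hF)).
  by rewrite s0 (le_trans sC)// lef_pV2.
by rewrite ler_wpM2r ?mulr_ge0 ?mu_ge0// ler_expR ler_wpM2r// powR_ge0.
Qed.

Lemma vol_lipschitz (phi psi : V -> V) (Z : set V) (K c : R) : 0 <= K ->
  (forall x y, Z x -> Z y -> `|phi x - phi y| <= K * `|psi x - psi y|) ->
  gcov boxP (psi @` Z) c -> vol boxP (phi @` Z) <= K ^+ n.+1 * vol boxP (psi @` Z).
Proof.
move=> K0 hK hc; set kap := K ^+ n.+1; have kap0 : 0 <= kap by exact: exprn_ge0.
apply/ler_addgt0Pr => e e0.
have e10 : 0 < e / (2 * (kap + 1)) by rewrite divr_gt0// mulr_gt0// ltr_wpDl.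
have e20 : 0 < e / 2 by rewrite divr_gt0.
apply: (le_trans (vol_le (lipschitz_gcov K0 hK (vol_gcov hc e10) e20))).
have : kap * (e / (2 * (kap + 1))) <= e / 2.
  rewrite -subr_ge0 (_ : _ - _ = e / (2 * (kap + 1))) ?ltW//.
  by field; rewrite gt_eqF// ltr_wpDl.
rewrite -/kap mulrDr; lra.
Qed.

Lemma homext_lip (k : R) g : (forall x, sphere x -> sphere (g x)) -> 0 <= k -> lipS k g ->
  forall X Z, X != 0 -> Z != 0 -> enorm (homext g X - homext g Z) <= (1 + 2 * k) * enorm (X - Z).
Proof.
move=> gS k0 lg x y x0 y0; have sx := unitv_sphere x0; have sy := unitv_sphere y0.
have [h1 h2] := polar_dist sx sy (enorm_ge0 x) (enorm_ge0 y).
rewrite !scale_unitv in h1 h2; rewrite /homext.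
have -> : enorm x *: g (unitv x) - enorm y *: g (unitv y) =
    (enorm x - enorm y) *: g (unitv x) + enorm y *: (g (unitv x) - g (unitv y)).
  by rewrite scalerBl scalerBr addrA subrK.
apply: (le_trans (ler_enormD _ _)); rewrite !enormZ (gS _ sx) mulr1 (ger0_norm (enorm_ge0 y)).
have h3 := ler_wpM2l (enorm_ge0 y) (lg _ _ sx sy).
have h4 := ler_wpM2l k0 h2; lra.
Qed.

Lemma homext_lower (k : R) g h : (forall x, sphere x -> sphere (g x)) ->
  (forall x, sphere x -> sphere (h x)) -> (forall x, sphere x -> h (g x) = x) ->
  0 <= k -> lipS k h -> forall X Z, X != 0 -> Z != 0 ->
  enorm (X - Z) <= (1 + 2 * k) * enorm (homext g X - homext g Z).
Proof.
move=> gS hS hg k0 lh X Z X0 Z0.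
have E Y : Y != 0 -> homext g Y != 0 /\ homext h (homext g Y) = Y.
  move=> Y0; have sY := unitv_sphere Y0; have nY : 0 < enorm Y by rewrite enorm_gt0.
  split; first by rewrite scaler_eq0 negb_or gt_eqF//=; exact/sphere_neq0/gS.
  by rewrite [homext g Y]/homext homextE// ?hg ?scale_unitv//; exact: gS.
have [gX0 eX] := E _ X0; have [gZ0 eZ] := E _ Z0.
by rewrite -{1}eX -{1}eZ; exact: homext_lip.
Qed.

(** On the cone over a small ball the extension of g and its linear model L are Lipschitz functions
    of each other with constant K = 1 + 2 theta. Volumes then compare up to K^(n+1) both ways, and
    the factor by which L scales volume cancels in the ratio. *)
Lemma Hoelder_distortion (k : R) g h : (forall x, sphere x -> sphere (g x)) ->
  (forall x, sphere x -> sphere (h x)) -> (forall x, sphere x -> h (g x) = x) ->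
  0 <= k -> lipS k h -> C1map g -> Hoelder_deriv alpha g ->
  exists2 C : R, 0 < C & distortion C g.
Proof.
move=> gS hS hg k0 lh C1g Hg.
have [C C0 hC] := homext_expansion gS C1g Hg.
pose c1 : R := 2 * (1 + 2 * k); have c10 : 0 < c1 by rewrite /c1; lra.
pose Q : R := C * c1 * n.+1%:R; have Q0 : 0 <= Q by exact: (mulr_ge0 (mulr_ge0 C0 (ltW c10)) (ler0n _ _)).
have Q20 : 0 < (2 * (Q + 1))^-1 by rewrite invr_gt0 mulr_gt0// ltr_wpDl.
have [s0 /andP[s00 s02] hs0] := powR_small alpha01 Q20.
have s0i : 0 < s0^-1 by rewrite invr_gt0.
pose N := n.+1.
have NQ0 : 0 <= 4 * N%:R * Q by exact: (mulr_ge0 (mulr_ge0 (ler0n _ 4) (ler0n _ _)) Q0).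
have CN0 : 0 < s0^-1 + 4 * N%:R * Q by lra.
(* The term [s0^-1] forces s <= s0; the other comes from K^N K^N <= exp(4 N theta) with theta = Q
   s^alpha. *)
exists (s0^-1 + 4 * N%:R * Q) => //.
move=> y s E F sy /andP[sp sC] hE hF.
have ss0 : s <= s0.
  apply: (le_trans sC); rewrite -[leRHS]invrK lef_pV2 ?posrE ?invr_gt0//.
  by rewrite lerDl.
have [L hL] := hC _ sy.
(* L inherits the lower bound of the extension of g. It is tested at y + t v, with t v so short that
   the expansion error takes at most half, whence the 2 in [c1]; homogeneity removes t. *)
have lower v : enorm v <= c1 * enorm (L *m v).
  have [->|v0] := eqVneq v 0; first by rewrite mulmx0 enorm0 mulr0.
  have nv : 0 < enorm v by rewrite enorm_gt0.
  have k1 : 0 < 1 + 2 * k by lra.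
  have e0 : 0 < (2 * (C + 1) * (1 + 2 * k))^-1 by rewrite invr_gt0 !mulr_gt0// ltr_wpDl.
  have [s1 /andP[s10 s12] /(_ s1)] := powR_small alpha01 e0.
  rewrite lexx ltW// => /(_ isT) hs1.
  pose t := s1 / (2 * enorm v); have t0 : 0 < t by rewrite divr_gt0// mulr_gt0.
  have tv : enorm (t *: v) = s1 / 2.
    by rewrite enormZ gtr0_norm// /t; field; rewrite gt_eqF.
  have X0 : y + t *: v != 0.
    rewrite -enorm_gt0; have := ler_enormB (y + t *: v) (t *: v); rewrite addrK sy tv; lra.
  have uX : enorm (unitv (y + t *: v) - y) <= s1.
    have := enorm_unitvB (y + t *: v) (sphere_neq0 sy); rewrite sy divr1 (unitv_id sy).
    by rewrite opprD addrA subrr add0r enormN tv enorm_distC; lra.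
  have h1 := hL s1 _ _ _ X0 (sphere_neq0 sy) uX.
  have h2 := homext_lower gS hS hg k0 lh X0 (sphere_neq0 sy).
  rewrite [y + _]addrC addrK in h1 h2.
  have {}h1 : enorm (homext g (t *: v + y) - homext g y - L *m (t *: v)) <=
      C * s1 `^ alpha * enorm (t *: v).
    by apply: h1; [rewrite ltW|rewrite (unitv_id sy) subrr enorm0 ltW].
  have h3 := ler_enormD (homext g (t *: v + y) - homext g y - L *m (t *: v)) (L *m (t *: v)).
  rewrite subrK in h3.
  have h4 : C * s1 `^ alpha * (1 + 2 * k) <= 2^-1.
    apply: (@le_trans _ _ ((C + 1) * (2 * (C + 1) * (1 + 2 * k))^-1 * (1 + 2 * k))).
      rewrite ler_wpM2r ?(ltW k1)//; apply: ler_pM => //; first exact: powR_ge0.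
      by rewrite lerDl.
    rewrite le_eqVlt; apply/orP; left; apply/eqP; field.
    by rewrite !gt_eqF// ltr_wpDl.
  have tv0 := enorm_ge0 (t *: v).
  have h5 : enorm (t *: v) <= c1 * enorm (L *m (t *: v)).
    have h6 := ler_wpM2r tv0 h4.
    have h7 := le_trans h2 (ler_wpM2l (ltW k1) (le_trans h3 (lerD h1 (lexx _)))).
    rewrite /c1; move: h6 h7; lra.
  move: h5; rewrite -scalemxAr !enormZ (gtr0_norm t0) mulrCA ler_pM2l//.
have uL : L \in unitmx.
  apply: inj_unitmx => v Lv; apply/eqP; rewrite -enorm_eq0 eq_le enorm_ge0 andbT.
  by have := lower v; rewrite Lv enorm0 mulr0.
have [kappa kap0 hkap] := vol_mulmx uL.
have sa0 := powR_ge0 s alpha; pose theta := Q * s `^ alpha.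
have th0 : 0 <= theta by exact: mulr_ge0.
have th2 : theta <= 2^-1.
  have := hs0 s; rewrite ltW//= ss0 => /(_ isT) h1.
  apply: (@le_trans _ _ ((Q + 1) * (2 * (Q + 1))^-1)).
    by apply: ler_pM => //; rewrite lerDl.
  by rewrite le_eqVlt; apply/orP; left; apply/eqP; field; rewrite gt_eqF// ltr_wpDl.
pose K := 1 + 2 * theta; have K0 : 0 <= K by rewrite addr_ge0// mulr_ge0.
have s012 : 0 <= s <= 2^-1 by rewrite ltW//= (le_trans ss0).
pose B := [set x | sphere x /\ enorm (x - y) <= s].
have BS : B `<=` S by move=> x [].
have err X Z : cone B X -> cone B Z ->
    `|(homext g X - homext g Z) - (L *m X - L *m Z)| <= theta * `|L *m X - L *m Z|.
  move=> /(coneP _ BS)[X0 [_ [_ BX]]] /(coneP _ BS)[Z0 [_ [_ BZ]]].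
  rewrite -mulmxBr; apply: (le_trans (mx_le_enorm _)).
  apply: (le_trans (hL s X Z s012 X0 Z0 BX BZ)).
  apply: (@le_trans _ _ (C * s `^ alpha * (c1 * (n.+1%:R * `|L *m (X - Z)|)))).
    rewrite ler_wpM2l ?mulr_ge0//; apply: (le_trans (lower _)).
    by rewrite ler_pM2l// enorm_le_mx.
  by rewrite le_eqVlt; apply/orP; left; apply/eqP; rewrite /theta /Q; ring.
have lip1 X Z : cone B X -> cone B Z ->
    `|homext g X - homext g Z| <= K * `|L *m X - L *m Z|.
  move=> BX BZ; have h1 := err _ _ BX BZ.
  move: (homext g X - _) (L *m X - _) h1 => p q h1.
  have := ler_normD (p - q) q; rewrite subrK /K.
  have := mulr_ge0 th0 (normr_ge0 q); lra.
have lip2 X Z : cone B X -> cone B Z ->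
    `|L *m X - L *m Z| <= K * `|homext g X - homext g Z|.
  move=> BX BZ; have h1 := err _ _ BX BZ.
  move: (homext g X - _) (L *m X - _) h1 => p q h1.
  have h2 := ler_normB p (p - q); rewrite subKr in h2.
  have h3 : (1 - theta) * `|q| <= `|p| by lra.
  have q0 := normr_ge0 q.
  have h4 : 1 <= K * (1 - theta) by rewrite /K; nra.
  apply: (@le_trans _ _ (K * (1 - theta) * `|q|)); first by rewrite ler_peMl.
  by rewrite -mulrA ler_wpM2l.
have ES : E `<=` S by move=> x /hE[].
have FS : F `<=` S by move=> x /hF[].
have cE := mu_gcov ES ltr01; have cF := mu_gcov FS ltr01.
have [[cE' gE'] vE] := hkap _ _ cE; have [_ vF] := hkap _ _ cF.
have gSE : g @` E `<=` S by move=> _ [x /ES sx <-]; exact: gS.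
have gSF : g @` F `<=` S by move=> _ [x /FS sx <-]; exact: gS.
have u1 : mu (g @` E) <= K ^+ N * (kappa * mu E).
  rewrite (mu_vol ES) -vE (mu_vol gSE) -homext_cone//.
  apply: (vol_lipschitz K0 _ gE') => X Z cX cZ; apply: lip1; exact: (coneS hE).
have u2 : kappa * mu F <= K ^+ N * mu (g @` F).
  have := mu_gcov gSF ltr01; rewrite (mu_vol FS) -vF (mu_vol gSF) -homext_cone// => cgF.
  apply: (vol_lipschitz K0 _ cgF) => X Z cX cZ; apply: lip2; exact: (coneS hF).
have KN0 : 0 <= K ^+ N by exact: exprn_ge0.
have u3 : mu (g @` E) * mu F <= K ^+ N * K ^+ N * (mu (g @` F) * mu E).
  rewrite -(ler_pM2l kap0) mulrCA.
  apply: (le_trans (ler_pM (mu_ge0 _) (mulr_ge0 (ltW kap0) (mu_ge0 _)) u1 u2)).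
  by rewrite le_eqVlt; apply/orP; left; apply/eqP; ring.
apply: (le_trans u3); rewrite ler_wpM2r ?mulr_ge0 ?mu_ge0//.
have KE : K <= expR (2 * theta) by exact: expR_ge1Dx.
have : K ^+ N * K ^+ N <= expR (2 * theta) ^+ N * expR (2 * theta) ^+ N.
  by rewrite ler_pM// lerXn2r// nnegrE expR_ge0.
move=> hK; apply: (le_trans hK); rewrite -expRM_natl -expRD ler_expR.
rewrite mulrDl; have := mulr_ge0 (ltW s0i) sa0.
rewrite /theta; lra.
Qed.

End BoundedDistortion.

Section WordDistortion.
Context {R : realType} {n : nat}.
Local Notation V := 'cV[R]_n.+1.
Local Notation S := (@sphere R n).
Implicit Types (E F : set V) (x y z v : V) (g h : V -> V).
Variable alpha : R.
Hypothesis alpha01 : 0 < alpha <= 1.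

(** The product of the bounds a/a' <= X b/b' and b/b' <= Y c/c', written without division. The two
    implications take the place of cancellation when b or b' vanishes. *)
Lemma cancel_ratio (a a' b b' c c' X Y : R) : 0 <= a -> 0 <= a' -> 0 <= b -> 0 <= b' ->
  0 <= c -> 0 <= c' -> 0 <= X -> 0 <= Y ->
  a * b' <= X * (a' * b) -> b * c' <= Y * (b' * c) ->
  (b = 0 -> a = 0) -> (b' = 0 -> c' = 0) -> a * c' <= X * Y * (a' * c).
Proof.
move=> a0 a'0 b0 b'0 c0 c'0 X0 Y0 h1 h2 hb hb'.
have rhs : 0 <= X * Y * (a' * c) by rewrite !mulr_ge0.
have [bz|bn] := eqVneq b 0; first by rewrite hb// mul0r.
have [bz'|bn'] := eqVneq b' 0; first by rewrite hb'// mulr0.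
have bp : 0 < b * b' by rewrite mulr_gt0 // lt_def ?bn ?bn'.
rewrite -(ler_pM2l bp).
have := ler_pM (mulr_ge0 a0 b'0) (mulr_ge0 b0 c'0) h1 h2.
have -> : a * b' * (b * c') = b * b' * (a * c') by ring.
by have -> : X * (a' * b) * (Y * (b' * c)) = b * b' * (X * Y * (a' * c)) by ring.
Qed.

Lemma image_sphere g E : (forall x, sphere x -> sphere (g x)) -> E `<=` S -> g @` E `<=` S.
Proof. by move=> gS ES _ [x /ES sx <-]; exact: gS. Qed.

Lemma image_ball (k s : R) g y E : (forall x, sphere x -> sphere (g x)) -> lipS k g -> 0 <= k ->
  sphere y ->
  E `<=` [set x | sphere x /\ enorm (x - y) <= s] ->
  g @` E `<=` [set x | sphere x /\ enorm (x - g y) <= k * s].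
Proof.
move=> gS lg k0 sy hE _ [x /hE[sx xy] <-]; split; first exact: gS.
by apply: (le_trans (lg _ _ sx sy)); exact: ler_wpM2l.
Qed.

Lemma mu_image_null (k : R) g E : (forall x, sphere x -> sphere (g x)) -> 0 <= k -> lipS k g ->
  E `<=` S -> mu E = 0 -> mu (g @` E) = 0.
Proof.
move=> gS k0 lg ES E0; have [C C0 hC] := mu_image_le gS k0 lg.
by apply/eqP; rewrite eq_le mu_ge0 andbT; have := hC _ ES; rewrite E0 mulr0.
Qed.

Lemma imageK g h E : (forall x, sphere x -> h (g x) = x) -> E `<=` S -> h @` (g @` E) = E.
Proof.
move=> hg ES; apply/seteqP; split=> [_ [_ [x Ex <-] <-]|x Ex].
  by rewrite hg//; exact: ES.
by exists (g x); [exists x | rewrite hg//; exact: ES].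
Qed.

Lemma distortion_id : distortion alpha 1 (@id V).
Proof.
move=> y s E F sy /andP[s0 _] _ _; rewrite !image_id mulrC.
rewrite -[leLHS]mul1r ler_wpM2r ?mulr_ge0 ?mu_ge0//.
rewrite -[leLHS]expR0 ler_expR mul1r; exact: powR_ge0.
Qed.

Lemma distortion_comp (k C1 C2 : R) g h h' :
  (forall x, sphere x -> sphere (g x)) -> (forall x, sphere x -> sphere (h x)) ->
  (forall x, sphere x -> sphere (h' x)) -> (forall x, sphere x -> h' (h x) = x) ->
  1 <= k -> lipS k g -> lipS k h -> lipS k h' -> 0 < C1 -> 0 < C2 ->
  distortion alpha C1 h -> distortion alpha C2 g ->
  exists2 C : R, 0 < C & distortion alpha C (g \o h).
Proof.
move=> gS hS h'S hh k1 lg lh lh' C10 C20 d1 d2.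
have k0 : 0 < k by apply: lt_le_trans k1.
have ka : 0 <= k `^ alpha by exact: powR_ge0.
have C2ka : 0 <= C2 * k `^ alpha by rewrite mulr_ge0// ltW.
have kC2 : 0 < k * C2 by rewrite mulr_gt0.
(* h sends balls of radius s into balls of radius k s: the term k C2 keeps these in the range of
   validity for g, and C2 k^alpha is the distortion of g on them. *)
exists (C1 + k * C2 + C2 * k `^ alpha); first lra.
move=> y s E F sy /andP[s0 sC] hE hF.
have C0 : 0 < C1 + k * C2 + C2 * k `^ alpha by lra.
have sC1 : s <= C1^-1 by apply: (le_trans sC); rewrite lef_pV2//; lra.
have sC2 : k * s <= C2^-1.
  have : s <= (k * C2)^-1 by apply: (le_trans sC); rewrite lef_pV2//; lra.
  by rewrite invfM mulrC ler_pdivlMr// mulrC.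
have ES : E `<=` S by move=> x /hE[].
have FS : F `<=` S by move=> x /hF[].
have c1 : 0 < s <= C1^-1 by rewrite s0 sC1.
have i1 := d1 y s E F sy c1 hE hF.
have c2 : 0 < k * s <= C2^-1 by rewrite mulr_gt0.
have i2 := d2 (h y) (k * s) _ _ (hS _ sy) c2 (image_ball hS lh (ltW k0) sy hE)
  (image_ball hS lh (ltW k0) sy hF).
rewrite -(image_comp h g E) -(image_comp h g F).
have null_h E1 : E1 `<=` S -> mu (h @` E1) = 0 -> mu E1 = 0.
  move=> E1S; rewrite -{2}(imageK hh E1S); apply: (mu_image_null h'S (ltW k0) lh').
  exact: image_sphere.
have := cancel_ratio (mu_ge0 _) (mu_ge0 _) (mu_ge0 _) (mu_ge0 _) (mu_ge0 _) (mu_ge0 _)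
  (expR_ge0 _) (expR_ge0 _) i2 i1
  (mu_image_null gS (ltW k0) lg (image_sphere hS ES)) (null_h _ FS).
move=> i3; apply: (le_trans i3); rewrite ler_wpM2r ?mulr_ge0 ?mu_ge0//.
rewrite -expRD ler_expR powRM ?(ltW s0) ?(ltW k0)//.
have sa := powR_ge0 s alpha; have := mulr_ge0 (ltW kC2) sa; lra.
Qed.

(** The bound for g, applied to the images of E and F under h in exchanged order, is the bound for
    h. *)
Lemma distortion_inv (k C : R) g h :
  (forall x, sphere x -> sphere (h x)) -> (forall x, sphere x -> g (h x) = x) ->
  1 <= k -> lipS k h -> 0 < C -> distortion alpha C g ->
  exists2 C' : R, 0 < C' & distortion alpha C' h.
Proof.
move=> hS gh k1 lh C0 d; have k0 : 0 < k by apply: lt_le_trans k1.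
have kC : 0 < k * C by rewrite mulr_gt0.
have Cka : 0 <= C * k `^ alpha by rewrite mulr_ge0 ?powR_ge0// ltW.
exists (k * C + C * k `^ alpha); first lra.
move=> y s E F sy /andP[s0 sC] hE hF.
have ES : E `<=` S by move=> x /hE[].
have FS : F `<=` S by move=> x /hF[].
have c2 : 0 < k * s <= C^-1.
  rewrite mulr_gt0//=; have : s <= (k * C)^-1.
    by apply: (le_trans sC); rewrite lef_pV2// ?posrE; lra.
  by rewrite invfM mulrC ler_pdivlMr// mulrC.
have := d (h y) (k * s) _ _ (hS _ sy) c2 (image_ball hS lh (ltW k0) sy hF)
  (image_ball hS lh (ltW k0) sy hE).
rewrite !imageK// => i; rewrite mulrC; apply: (le_trans i).
rewrite (mulrC (mu E)) ler_wpM2r ?mulr_ge0 ?mu_ge0// ler_expR powRM ?(ltW s0) ?(ltW k0)//.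
have sa := powR_ge0 s alpha; have := mulr_ge0 (ltW kC) sa; lra.
Qed.

(** This constant depends on the word and serves for the finitely many [ws j]; the bound uniform in
    the depth comes from contraction, in [good_step]. *)
Lemma wact_distortion (I : finType) (F : I -> V -> V) (k : R) (w : seq (I * bool)) :
  bijF F -> 1 <= k -> (forall l, lipS k (lact F l)) ->
  (forall o, C1map (F o) /\ Hoelder_deriv alpha (F o)) ->
  exists2 C : R, 0 < C & distortion alpha C (wact F w).
Proof.
move=> bF k1 lF hF; elim: w => [|[i b] w [C2 C20 d2]] /=.
  by exists 1 => //; exact: distortion_id.
have k0 : 0 <= k by apply: le_trans k1.
have [C1 C10 d1] : exists2 C : R, 0 < C & distortion alpha C (lact F (i, b)).
  have [C1F HF] := hF i.
  have K1 x : sphere x -> lact F (i, false) (lact F (i, true) x) = x by exact: (lactK (i, true)).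
  have K2 x : sphere x -> lact F (i, true) (lact F (i, false) x) = x by exact: (lactK (i, false)).
  have [C C0 d] : exists2 C : R, 0 < C & distortion alpha C (lact F (i, true)).
    apply: (Hoelder_distortion alpha01 _ _ K1 k0 (lF _)) => //; exact: lact_sphere.
  case: b; first by exists C.
  by apply: (distortion_inv _ K2 k1 (lF _) C0 d); exact: lact_sphere.
have kp : 1 <= Num.max k (k ^+ size w) by rewrite le_max k1.
have lip_le g (k' : R) : k' <= Num.max k (k ^+ size w) -> lipS k' g -> lipS (Num.max k (k ^+ size w)) g.
  by move=> kk lg x y sx sy; apply: (le_trans (lg _ _ sx sy)); rewrite ler_wpM2r ?enorm_ge0.
apply: (@distortion_comp (Num.max k (k ^+ size w)) C2 C1 _ _ (wact F (winv w))) => //.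
- exact: lact_sphere.
- exact: wact_sphere.
- exact: wact_sphere.
- exact: wactK.
- by apply: (lip_le _ k) => //; rewrite le_max lexx.
- by apply: (lip_le _ (k ^+ size w)); [rewrite le_max lexx orbT | exact: lipS_wact].
- apply: (lip_le _ (k ^+ size (winv w))); last exact: lipS_wact.
  by rewrite /winv size_rev size_map le_max lexx orbT.
Qed.

End WordDistortion.

(** * Cells and ergodicity *)

Section Cells.
Context {R : realType} {n : nat}.
Local Notation V := 'cV[R]_n.+1.
Local Notation S := (@sphere R n).
Implicit Types (E : set V) (x y z v : V).
Variable alpha : R.
Hypothesis alpha01 : 0 < alpha <= 1.
Variables (J : finType) (F : J -> V -> V).
Local Notation word := (seq (J * bool)).
Variables (e : V) (lam rho k : R) (m : nat) (ws : 'I_m -> word).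
Hypothesis bF : bijF F.
Hypothesis lam01 : 0 < lam < 1.
Hypothesis rho0 : 0 < rho.
Hypothesis k1 : 1 <= k.
Hypothesis lF : forall l, lipS k (lact F l).
Hypothesis con : forall j, contracting lam rho e (wact F (ws j)).
Hypothesis cov : forall x, sphere x -> exists j, enorm (wact F (winv (ws j)) x - e) <= rho / 4.
Variables (Lam C : R).
Hypothesis Lam1 : 1 <= Lam.
Hypothesis lip_inv : forall j, lipS Lam (wact F (winv (ws j))).
Hypothesis C0 : 0 < C.
Hypothesis dist : forall j, distortion alpha C (wact F (ws j)).

Definition sball (z : V) (s : R) : set V := [set p | sphere p /\ enorm (p - z) <= s].

Lemma sball_sphere z s : sball z s `<=` S. Proof. by move=> x []. Qed.

(** The image under the word of an open ball about e, written through the inverse so that membership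
    is a single inequality. *)
Definition wball (w : word) (t : R) : set V :=
  [set x | sphere x /\ enorm (wact F (winv w) x - e) < t].

Lemma carMu_wball w t : carMu (wball w t).
Proof.
apply: (carMu_ball _ _ _ (@lipS_wact _ _ _ F k (winv w) bF k1 lF)); exact: wact_sphere.
Qed.

Lemma carMu_all (I : eqType) (s : seq I) (E : I -> set V) : (forall i, carMu (E i)) ->
  carMu [set x | forall i, i \in s -> E i x].
Proof.
move=> hE; elim: s => [|i s IH].
  have -> : [set x | forall i, i \in [::] -> E i x] = ~` set0.
    by apply/seteqP; split=> [x _|x _ i] //; case.
  by apply: carMuC => X XS; rewrite setI0 setD0 mu0 add0r.
have -> : [set x | forall j, j \in i :: s -> E j x] =
    E i `&` [set x | forall i, i \in s -> E i x].
  apply/seteqP; split=> [x h|x [h1 h2] j].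
    by split=> [|j js]; apply: h; rewrite in_cons ?eqxx ?js ?orbT.
  by rewrite in_cons => /orP[/eqP ->|]; [exact: h1 | exact: h2].
exact: carMuI.
Qed.

Lemma pigeonhole (M : nat) (f : 'I_M.+1 -> R) (T : R) :
  \sum_i f i <= T -> exists i, f i <= T / M.+1%:R.
Proof.
move=> h; apply: contrapT => /forallNP hn; have M0 : 0 < M.+1%:R :> R by [].
have : \sum_(i < M.+1) (T / M.+1%:R) < \sum_i f i.
  apply: ltr_sum => [|i _]; first by apply/hasP; exists ord0; rewrite ?mem_index_enum.
  by rewrite ltNge; apply/negP; exact: hn.
rewrite sumr_const card_ord -[X in X < _]mulr_natl mulrCA mulfV ?mulr1 ?gt_eqF// => h2.
by have := le_lt_trans h h2; rewrite ltxx.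
Qed.

(* The annuli around different radii are disjoint, so one of them has small measure. *)
Lemma good_radius (w : word) X (delta : R) : X `<=` S -> 0 < delta -> delta <= rho / 8 ->
  exists2 t, rho / 4 < t /\ t <= rho / 2 &
    mu (X `&` [set x | exists j, wball (w ++ ws j) (t + delta) x /\
                                 ~ wball (w ++ ws j) (t - delta) x]) <=
    16 * m%:R / rho * delta * mu X.
Proof.
move=> XS d0 dr.
(* q measures how many annuli of width 2 delta fit between the radii rho/4 and rho/2; the [t i] are
   their middle radii. *)
pose q := rho / (8 * delta); have d8 : 0 < 8 * delta by rewrite mulr_gt0.
have q1 : 1 <= q by rewrite ler_pdivlMr//; lra.
have q0 : 0 <= q by lra.
have [M hM] : exists M, Num.truncn q = M.+1.
  have : (0 < Num.truncn q)%N by rewrite truncn_gt0.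
  by case: (Num.truncn q) => // M _; exists M.
have /andP[] := truncn_itv q0; rewrite hM => Mq qM.
pose t (i : 'I_M.+1) := rho / 4 + (2 * i%:R + 1) * delta.
pose Ann i j := [set x | wball (w ++ ws j) (t i + delta) x /\ ~ wball (w ++ ws j) (t i - delta) x].
have carAnn i j : carMu (Ann i j).
  by apply: carMuI; [exact: carMu_wball | apply: carMuC; exact: carMu_wball].
have disj j i i' x : Ann i j x -> Ann i' j x -> i = i'.
  suff lt i1 i2 : Ann i1 j x -> Ann i2 j x -> ~ (i1 < i2)%N.
    move=> h1 h2; apply: val_inj; case: (ltngtP i i') => //= ii.
      by case: (lt _ _ h1 h2).
    by case: (lt _ _ h2 h1).
  move=> [[sx h1] _] [_ h2] ii; apply: h2; split => //; apply: (lt_le_trans h1).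
  have h3 : i1%:R + 1 <= i2%:R :> R by rewrite natr1 ler_nat.
  have : (i1%:R + 1) * delta <= i2%:R * delta by rewrite ler_pM2r.
  rewrite /t; lra.
have tot : \sum_(i < M.+1) \sum_j mu (X `&` Ann i j) <= m%:R * mu X.
  rewrite exchange_big/=; apply: (@le_trans _ _ (\sum_(j < m) mu X)).
    by apply: ler_sum => j _; apply: carMu_sum => // i i' x; exact: disj.
  by rewrite sumr_const card_ord -[leLHS]mulr_natl.
have [i hi] := pigeonhole tot.
have M0 : 0 < M.+1%:R :> R by [].
have iM : i%:R + 1 <= M.+1%:R :> R by rewrite natr1 ler_nat.
have Md : M.+1%:R * (8 * delta) <= rho by rewrite -ler_pdivlMr.
(* The integer part M + 1 of q >= 1 is at least q/2, so averaging over the radii gains a factor 16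
   delta / rho. *)
have qM2 : rho <= 16 * M.+1%:R * delta.
  have : q <= 2 * M.+1%:R.
    have q' : q < M.+1%:R + 1 by rewrite natr1.
    have M1 : 1 <= M.+1%:R :> R by rewrite ler1n.
    move: (M.+1%:R) q' M1 => u q' M1; lra.
  by rewrite /q ler_pdivrMr//; lra.
exists (t i).
  have : (i%:R + 1) * delta <= M.+1%:R * delta by rewrite ler_pM2r.
  have : 0 <= i%:R * delta by rewrite mulr_ge0// ltW.
  rewrite /t; lra.
apply: (@le_trans _ _ (\sum_j mu (X `&` Ann i j))).
  apply: (le_trans _ (mu_fin _)); apply: mu_mono => x [Xx [j hj]]; exists j; split => //.
apply: (le_trans hi).
have -> : 16 * m%:R / rho * delta * mu X = m%:R * mu X * (16 * delta / rho) by ring.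
apply: ler_wpM2l; first by rewrite mulr_ge0 ?mu_ge0.
rewrite -[leLHS]div1r ler_pdivrMr// mulrAC ler_pdivlMr// mul1r; lra.
Qed.

(** D' dominates the geometric series of the distortions C (lam^i s)^alpha along a word, whatever
    its depth. *)
Variable D' : R.
Hypothesis D'_ge : C + D' * lam `^ alpha <= D'.

(** z is a parameter and not a point of the cell: w carries the ball of radius s about z into E. The
    depth N improves the contraction but does not enter the distortion bound. *)
Definition good (N : nat) (s : R) (w : word) (E : set V) (z : V) : Prop :=
  [/\ sphere z,
      forall p, sball z s p -> E (wact F w p),
      forall p p', sball z s p -> sball z s p' ->
        enorm (wact F w p - wact F w p') <= lam ^+ N * enorm (p - p') &
      forall E1 E2, E1 `<=` sball z s -> E2 `<=` sball z s ->
        mu (wact F w @` E1) * mu E2 <=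
        expR (D' * s `^ alpha) * (mu (wact F w @` E2) * mu E1)].

Definition goodset N s (I : finType) (w : I -> word) (E : I -> set V) : set V :=
  [set x | exists i z, good N s (w i) (E i) z /\ x = wact F (w i) z].

Variables (r0 D : R).
Hypothesis r0_rho : r0 <= rho / 2.
Hypothesis r0_C : r0 <= C^-1.
Hypothesis r0_Lam : Lam * lam * r0 <= rho / 8.
Hypothesis D_ge : 16 * m%:R / rho * (Lam * lam) + D * lam <= D.

Lemma D'_ge0 : 0 <= D'.
Proof.
have [l0 l1] := andP lam01; have [a0 _] := andP alpha01.
have : lam `^ alpha < 1.
  have <- : 1 `^ alpha = 1 :> R by rewrite powR1.
  by apply: gt0_ltr_powR; rewrite ?nnegrE ?(ltW l0)// ler01.
have := D'_ge; move: (lam `^ alpha) => p hp p1; have p1' : 0 < 1 - p by rewrite subr_gt0.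
rewrite -(pmulr_lge0 _ p1') mulrBr mulr1 subr_ge0; apply: le_trans hp; rewrite lerDr; exact: ltW.
Qed.

Lemma D_ge0 : 0 <= D.
Proof.
have [l0 l1] := andP lam01; have L0 : 0 < Lam by apply: lt_le_trans Lam1.
have : 0 <= 16 * m%:R / rho * (Lam * lam) by rewrite !mulr_ge0 ?invr_ge0 ?(ltW rho0) ?(ltW L0) ?(ltW l0).
have := D_ge; have l1' : 0 < 1 - lam by rewrite subr_gt0.
move=> h h'; rewrite -(pmulr_lge0 _ l1') mulrBr mulr1 subr_ge0; by apply: le_trans h; rewrite lerDr.
Qed.

(** [ws j] sends the s-ball about the new parameter into the (lam s)-ball about z. The new cell asks
    j to be the first index whose ball of radius t holds the pulled-back point, which makes cells
    disjoint. Since the annuli of half-width Lam lam s are avoided, the whole ball makes the same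
    choice of j as its centre. *)
Lemma good_step N s w (E : set V) z j (t : R) : 0 < s <= r0 ->
  good N (lam * s) w E z -> rho / 4 < t -> t <= rho / 2 ->
  enorm (wact F (winv (ws j)) z - e) < t ->
  (forall j' : 'I_m, (j' < j)%N -> ~ enorm (wact F (winv (ws j')) z - e) < t) ->
  (forall j', ~ (wball (w ++ ws j') (t + Lam * lam * s) (wact F w z) /\
     ~ wball (w ++ ws j') (t - Lam * lam * s) (wact F w z))) ->
  good N.+1 s (w ++ ws j)
    (E `&` (wball (w ++ ws j) t `&`
      [set x | forall j' : 'I_m, j' \in [seq i : 'I_m <- enum 'I_m | (i < j)%N] -> (~` wball (w ++ ws j') t) x]))
    (wact F (winv (ws j)) z).
Proof.
move=> /andP[s0 sr] [sz hE hlip hdist] t1 t2 hj hj' nbad.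
have [l0 l1] := andP lam01; have L0 : 0 < Lam by apply: lt_le_trans Lam1.
set y := wact F (winv (ws j)) z in hj *.
have sy : sphere y by exact: wact_sphere.
have gy : wact F (ws j) y = z by rewrite /y wactKV.
have s_rho : s <= rho / 2 by apply: le_trans r0_rho.
have yr : enorm (y - e) <= rho by lra.
have ball_e p : sball y s p -> enorm (p - e) <= rho.
  by move=> [sp py]; have := ler_enorm_add y p e; lra.
have step p : sball y s p -> sball z (lam * s) (wact F (ws j) p).
  move=> hp; have pe := ball_e _ hp; have [sp py] := hp; split; first exact: wact_sphere.
  by rewrite -gy; apply: (le_trans (con j sp sy pe yr)); rewrite ler_pM2l.
have inv_comp w1 w2 x : wact F (winv (w1 ++ w2)) x = wact F (winv w2) (wact F (winv w1) x).
  by rewrite /winv map_cat rev_cat wact_cat.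
split => //.
- move=> p hp; have [su uz] := step _ hp; rewrite wact_cat.
  set u := wact F (ws j) p in su uz *.
  have sx : sphere (wact F w u) by exact: wact_sphere.
  have near_ j1 : `|enorm (wact F (winv (ws j1)) u - e) - enorm (wact F (winv (ws j1)) z - e)|
      <= Lam * lam * s.
    apply: (le_trans (ler_enorm_dist _ _)); rewrite opprB addrA subrK.
    by apply: (le_trans (lip_inv j1 su sz)); rewrite -mulrA ler_pM2l.
  (* Avoiding the annulus, a centre within the outer radius is already within the inner one, and the
     displacement in [near_] cannot carry it across t. *)
  have bad1 j1 : enorm (wact F (winv (ws j1)) z - e) < t + Lam * lam * s ->
      enorm (wact F (winv (ws j1)) z - e) < t - Lam * lam * s.
    move=> h; apply: contrapT => h'; apply: (nbad j1); split.
      by split; [exact: wact_sphere | rewrite inv_comp wactK].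
    by move=> [_]; rewrite inv_comp wactK.
  have d0 : 0 <= Lam * lam * s by rewrite !mulr_ge0 ?ltW.
  split; first exact: hE.
  split.
    split => //; rewrite inv_comp wactK//.
    have := bad1 j; have := near_ j; rewrite -/y ler_norml => h1 h2.
    have := h2 (ltac:(lra)); lra.
  move=> j1; rewrite mem_filter => /andP[jj _] [_]; rewrite inv_comp wactK// => h1.
  apply: (hj' j1 jj); have := near_ j1; rewrite ler_norml => h2.
  have := bad1 j1 (ltac:(lra)); lra.
- move=> p p' hp hp'; rewrite !wact_cat exprSr -mulrA.
  apply: (le_trans (hlip _ _ (step _ hp) (step _ hp'))); apply: ler_wpM2l.
    by rewrite exprn_ge0// ltW.
  have [sp _] := hp; have [sp' _] := hp'.
  exact: (con j sp sp' (ball_e _ hp) (ball_e _ hp')).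
- move=> E1 E2 hE1 hE2; have k0 : 0 <= k by apply: le_trans k1.
  have gE (E3 : set V) : E3 `<=` sball y s -> wact F (ws j) @` E3 `<=` sball z (lam * s).
    by move=> h _ [p /h hp <-]; exact: step.
  have imE (E3 : set V) : wact F (w ++ ws j) @` E3 = wact F w @` (wact F (ws j) @` E3).
    by rewrite image_comp; congr image; apply/funext => x; rewrite wact_cat.
  have wS w1 x : sphere x -> sphere (wact F w1 x) by exact: wact_sphere.
  have lw w1 : lipS (k ^+ size w1) (wact F w1) by exact: lipS_wact.
  have kw w1 : 0 <= k ^+ size (w1 : word) by rewrite exprn_ge0.
  have i1 := hdist _ _ (gE _ hE1) (gE _ hE2).
  have c1 : 0 < s <= C^-1 by rewrite s0 (le_trans sr).
  have i2 := dist j sy c1 hE1 hE2.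
  have E1S : E1 `<=` S := subset_trans hE1 (@sball_sphere _ _).
  have E2S : E2 `<=` S := subset_trans hE2 (@sball_sphere _ _).
  have n1 : mu (wact F (ws j) @` E1) = 0 -> mu (wact F w @` (wact F (ws j) @` E1)) = 0.
    exact: (mu_image_null (wS w) (kw w) (lw w) (image_sphere (wS (ws j)) E1S)).
  have n2 : mu (wact F (ws j) @` E2) = 0 -> mu E2 = 0.
    rewrite -{2}(imageK (wactK (ws j) bF) E2S).
    exact: (mu_image_null (wS _) (kw _) (lw _) (image_sphere (wS (ws j)) E2S)).
  rewrite !imE.
  have := cancel_ratio (mu_ge0 _) (mu_ge0 _) (mu_ge0 _) (mu_ge0 _) (mu_ge0 _) (mu_ge0 _)
    (expR_ge0 _) (expR_ge0 _) i1 i2 n1 n2.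
  move=> i3; apply: (le_trans i3); rewrite ler_wpM2r ?mulr_ge0 ?mu_ge0//.
  rewrite -expRD ler_expR powRM ?(ltW s0) ?(ltW l0)//.
  have := ler_wpM2r (powR_ge0 s alpha) D'_ge; lra.
Qed.

(** Stated for all s because depth N + 1 at radius s uses depth N at radius lam s. The loss D lam s
    inherited from there and the share of the annuli add up to at most D s, by [D_ge]. *)
Lemma goodset_large N : forall s, 0 < s <= r0 ->
  exists (I : finType) (w : I -> word) (E : I -> set V),
    [/\ forall i, E i `<=` S, forall i, carMu (E i),
        forall i i' x, E i x -> E i' x -> i = i' &
        mu (S `\` goodset N s w E) <= D * s * mu S].
Proof.
have [l0 l1] := andP lam01; have L0 : 0 < Lam by apply: lt_le_trans Lam1.
elim: N => [|N IH] s /andP[s0 sr].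
  exists unit, (fun=> [::]), (fun=> S); split => //.
  - by move=> _ x.
  - move=> _ X XS; rewrite (_ : X `\` S = set0).
      by rewrite mu0 addr0; apply: mu_mono => x [].
    by apply/seteqP; split=> x // [/XS].
  - by move=> [] [].
  rewrite [X in mu X](_ : _ = set0); last first.
    apply/seteqP; split => // x [sx []]; exists tt, x; split => //; split => //.
    - by move=> p [].
    - by move=> p p' _ _; rewrite mul1r.
    - move=> E1 E2 _ _; rewrite /= !image_id mulrC -[leLHS]mul1r.
      rewrite ler_wpM2r ?mulr_ge0 ?mu_ge0// -[leLHS]expR0 ler_expR.
      by rewrite mulr_ge0 ?powR_ge0 ?D'_ge0.
  by rewrite mu0 !mulr_ge0 ?D_ge0 ?mu_ge0// ltW.
have ls : 0 < lam * s <= r0.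
  rewrite mulr_gt0//=; apply: (le_trans _ sr); rewrite ler_piMl ?(ltW s0)//; exact: ltW.
have [I [w [E [ES cE dE hgood]]]] := IH _ ls.
pose delta := Lam * lam * s.
have d0 : 0 < delta by rewrite !mulr_gt0.
have dr : delta <= rho / 8.
  by apply: (le_trans _ r0_Lam); rewrite ler_pM2l// mulr_gt0.
have /choice[t ht] : forall i, exists t, rho / 4 < t /\ t <= rho / 2 /\
    mu (E i `&` [set x | exists j, wball (w i ++ ws j) (t + delta) x /\
                                 ~ wball (w i ++ ws j) (t - delta) x]) <=
    16 * m%:R / rho * delta * mu (E i).
  by move=> i; have [t [t1 t2] h] := good_radius (w i) (ES i) d0 dr; exists t.
pose E' (ij : I * 'I_m) : set V := E ij.1 `&` (wball (w ij.1 ++ ws ij.2) (t ij.1) `&`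
      [set x | forall j' : 'I_m, j' \in [seq i : 'I_m <- enum 'I_m | (i < ij.2)%N] ->
         (~` wball (w ij.1 ++ ws j') (t ij.1)) x]).
exists (I * 'I_m)%type, (fun ij => w ij.1 ++ ws ij.2), E'; split.
- by move=> ij x [/ES].
- move=> ij; apply: carMuI => //; apply: carMuI; first exact: carMu_wball.
  by apply: carMu_all => j'; apply: carMuC; exact: carMu_wball.
- move=> [i j] [i' j'] x [Ei [Wj nW]] [Ei' [Wj' nW']]; rewrite /= in Ei Wj nW Ei' Wj' nW'.
  have ii : i = i' := dE _ _ _ Ei Ei'; subst i'; congr (_, _); apply: val_inj => /=.
  case: (ltngtP j j') => // jj.
    by exfalso; apply: (nW' j _ Wj); rewrite mem_filter jj mem_enum.
  by exfalso; apply: (nW j' _ Wj'); rewrite mem_filter jj mem_enum.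
pose Bad i := E i `&` [set x | exists j, wball (w i ++ ws j) (t i + delta) x /\
                                 ~ wball (w i ++ ws j) (t i - delta) x].
have sub : S `\` goodset N.+1 s (fun ij : I * 'I_m => w ij.1 ++ ws ij.2) E' `<=`
    (S `\` goodset N (lam * s) w E) `|` [set x | exists i, Bad i x].
  move=> x [sx ngood]; have [[i [z [gz xE]]]|] := pselect (goodset N (lam * s) w E x); last by left.
  right; exists i; apply: contrapT => nbad.
  have [sz hE _ _] := gz.
  have Ex : E i x.
    by rewrite xE; apply: hE; split => //; rewrite subrr enorm0 mulr_ge0 ?ltW.
  have [t1 [t2 _]] := ht i.
  have ex : exists j : 'I_m, enorm (wact F (winv (ws j)) z - e) < t i.
    by have [j hj] := cov sz; exists j; apply: le_lt_trans hj t1.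
  have [j hj hmin] := @arg_minnP _ (xchoose ex)
    (fun j : 'I_m => enorm (wact F (winv (ws j)) z - e) < t i) val (xchooseP ex).
  apply: ngood; exists (i, j), (wact F (winv (ws j)) z); split; last first.
    by rewrite /= wact_cat wactKV.
  apply: good_step => //=; first by rewrite s0.
  - by move=> j' jj' h; have := hmin _ h; rewrite leqNgt jj'.
  - by move=> j' hj'; apply: nbad; split => //; exists j'; rewrite xE.
apply: (le_trans (mu_mono sub)); apply: (le_trans (mu_setU _ _)).
have bad : mu [set x | exists i, Bad i x] <= 16 * m%:R / rho * delta * mu S.
  apply: (le_trans (mu_fin _)).
  apply: (@le_trans _ _ (\sum_i 16 * m%:R / rho * delta * mu (E i))).
    by apply: ler_sum => i _; have [_ [_]] := ht i.
  rewrite -mulr_sumr ler_wpM2l ?mulr_ge0 ?invr_ge0 ?(ltW L0) ?(ltW l0) ?(ltW s0) ?(ltW rho0)//.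
  rewrite (eq_bigr (fun i => mu (S `&` E i))) => [|i _]; first exact: carMu_sum.
  by rewrite setIidr.
have := ler_wpM2r (mulr_ge0 (ltW s0) (mu_ge0 S)) D_ge.
move: hgood bad; rewrite /delta; lra.
Qed.

(** An averaging argument. If Z took a larger share of every good image, choosing one good parameter
    per cell and net point would cover the good set with overlap at most L over disjoint cells,
    giving eta mu(goodset) <= L mu(Z). This contradicts the smallness of Z, as at least half of the
    sphere is good. The count L does not depend on N. *)
Lemma good_cell N (r eta : R) (Z : set V) L (c : 'I_L -> V) : 0 < r <= r0 -> D * r <= 1 / 2 ->
  0 < mu S -> 0 < eta -> Z `<=` S ->
  (forall z, sphere z -> exists l, enorm (z - c l) <= r / 2) ->
  L%:R * mu Z <= eta * mu S / 4 ->
  exists w E z, good N r w E z /\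
    mu (Z `&` (wact F w @` sball z r)) <= eta * mu (wact F w @` sball z r).
Proof.
move=> rr Dr S0 e0 ZS net hZ; have [I [w [E [ES cE dE hg]]]] := goodset_large N rr.
have [r1 _] := andP rr; apply: contrapT => hno.
have bad i z : good N r (w i) (E i) z ->
    eta * mu (wact F (w i) @` sball z r) <= mu (Z `&` (wact F (w i) @` sball z r)).
  move=> gz; rewrite leNgt; apply/negP => h; apply: hno; exists (w i), (E i), z.
  by split=> //; exact: ltW.
pose near_ (il : I * 'I_L) z := good N r (w il.1) (E il.1) z /\ enorm (z - c il.2) <= r / 2.
(* One good parameter per cell and net point suffices: its r-ball contains all good parameters of
   that cell within r/2 of the same net point. *)
have /choice[zc hzc] : forall il, exists z, (exists z', near_ il z') -> near_ il z.
  move=> il; have [[z hz]|h] := pselect (exists z', near_ il z'); first by exists z.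
  by exists 0 => h'.
pose Q il := [set x | near_ il (zc il) /\ (wact F (w il.1) @` sball (zc il) r) x].
have hQ il : eta * mu (Q il) <= mu (Z `&` E il.1).
  have [h|h] := pselect (near_ il (zc il)); last first.
    by rewrite (_ : Q il = set0) ?mu0 ?mulr0 ?mu_ge0//; apply/seteqP; split => x [].
  have -> : Q il = wact F (w il.1) @` sball (zc il) r.
    by apply/seteqP; split => [x []//|x hx]; split.
  apply: (le_trans (bad _ _ h.1)); apply: mu_mono => x [Zx [p hp xE]]; split => //.
  by rewrite -xE; have [_ hE _ _] := h.1; exact: hE.
have sub : goodset N r w E `<=` [set x | exists il, Q il x].
  move=> x [i [z [gz ->]]]; have [sz _ _ _] := gz; have [l hl] := net _ sz.
  exists (i, l); have h : near_ (i, l) (zc (i, l)) by apply: hzc; exists z.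
  split => //; exists z => //; split => //.
  rewrite -(subrKA (c l)); apply: (le_trans (ler_enormD _ _)); have [_ /=] := h.
  by rewrite (enorm_distC (c l)) => h2; lra.
have sumQ : eta * mu (goodset N r w E) <= L%:R * mu Z.
  apply: (@le_trans _ _ (eta * \sum_il mu (Q il))).
    by rewrite ler_pM2l//; apply: (le_trans (mu_mono sub)); exact: mu_fin.
  rewrite mulr_sumr; apply: (@le_trans _ _ (\sum_(il : I * 'I_L) mu (Z `&` E il.1))).
    by apply: ler_sum => il _; exact: hQ.
  rewrite -(pair_bigA _ (fun i (l : 'I_L) => mu (Z `&` E i)))/= exchange_big/=.
  apply: (@le_trans _ _ (\sum_(l < L) mu Z)).
    by apply: ler_sum => l _; exact: carMu_sum.
  by rewrite sumr_const card_ord -[leLHS]mulr_natl.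
have tot : mu S <= mu (S `\` goodset N r w E) + mu (goodset N r w E).
  by apply: (le_trans _ (mu_setU _ _)); apply: mu_mono => x sx;
    have [|] := pselect (goodset N r w E x); [right|left].
have h1 : mu (S `\` goodset N r w E) <= 1 / 2 * mu S.
  by apply: (le_trans hg); rewrite ler_wpM2r ?mu_ge0.
have h2 : mu S / 2 <= mu (goodset N r w E) by lra.
have h3 : eta * (mu S / 2) <= eta * mu (goodset N r w E) by rewrite ler_pM2l.
have : 0 < eta * mu S by rewrite mulr_gt0.
lra.
Qed.

(** Invariance sends the part of B in the ball into Z; bounded distortion then turns the small share
    of Z in the image into a small share of B in the ball of fixed radius r. *)
Lemma good_invariant N (r eta : R) w E z Z B : 0 <= eta -> good N r w E z -> B `<=` S ->
  (forall x, sphere x -> B x -> B (wact F w x)) ->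
  B `&` (wact F w @` sball z r) `<=` Z ->
  mu (Z `&` (wact F w @` sball z r)) <= eta * mu (wact F w @` sball z r) ->
  mu (B `&` sball z r) <= expR (D' * r `^ alpha) * (eta * mu S).
Proof.
move=> eta0 [sz _ _ hd] BS Binv BZ hZ; set b := sball z r in BZ hZ hd *.
have bS : b `<=` S by exact: sball_sphere.
have e0 := expR_ge0 (D' * r `^ alpha).
have h1 := hd b (B `&` b) (@subset_refl _ b) (@subIsetr _ B b).
have h2 : mu (wact F w @` (B `&` b)) <= eta * mu (wact F w @` b).
  apply: (le_trans _ hZ); apply: mu_mono => _ [x [Bx bx] <-].
  have hx : (wact F w @` b) (wact F w x) by exists x.
  by split => //; apply: BZ; split => //; apply: Binv => //; exact: BS.
have h3 : mu b <= mu S := mu_mono bS.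
have wS w1 x : sphere x -> sphere (wact F w1 x) by exact: wact_sphere.
have [h0|h0] := eqVneq (mu (wact F w @` b)) 0.
  suff b0 : mu b = 0.
    apply: (@le_trans _ _ (mu b)); first by apply: mu_mono => x [].
    by rewrite b0 !mulr_ge0 ?mu_ge0.
  rewrite -(imageK (wactK w bF) bS); apply: (@mu_image_null _ _ (k ^+ size (winv w))) => //.
  - exact: wS.
  - by rewrite exprn_ge0// (le_trans _ k1).
  - exact: lipS_wact.
  - exact: (image_sphere (wS w) bS).
have h0' : 0 < mu (wact F w @` b) by rewrite lt_neqAle eq_sym h0 mu_ge0.
rewrite -(ler_pM2l h0'); apply: (le_trans h1).
have -> : mu (wact F w @` b) * (expR (D' * r `^ alpha) * (eta * mu S)) =
  expR (D' * r `^ alpha) * (eta * mu (wact F w @` b) * mu S) by ring.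
rewrite ler_wpM2l//; apply: ler_pM => //; exact: mu_ge0.
Qed.

Section Invariant.
Variable A : set V.
Hypothesis AS : A `<=` S.
Hypothesis mA : smeasurable A.
Hypothesis iA : forall w x, sphere x -> (A (wact F w x) <-> A x).

Let side (b : bool) : set V := if b then A else S `\` A.

Lemma side_sphere b : side b `<=` S. Proof. by case: b => // x []. Qed.

Lemma side_invariant b w x : sphere x -> side b x -> side b (wact F w x).
Proof.
case: b => sx /=; first by move=> Ax; exact/iA.
by move=> [_ nA]; split; [exact: wact_sphere | move/iA => /(_ sx)].
Qed.

(* The image of a small ball under a deep good word is too small to meet both
   compact approximations of A and of its complement. *)
Lemma invariant_small (r eta : R) L (c : 'I_L -> V) : 0 < r <= r0 -> D * r <= 1 / 2 ->
  0 < mu S -> 0 < eta ->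
  (forall z, sphere z -> exists l, enorm (z - c l) <= r / 2) ->
  exists z b, sphere z /\
    mu (side b `&` sball z r) <= expR (D' * r `^ alpha) * (eta * mu S).
Proof.
move=> rr Dr S0 e0 net; have [l0 l1] := andP lam01; have [r1 _] := andP rr.
(* Two approximations with error [ee], counted L times, lose at most eta mu(S) / 4 as [good_cell]
   requires; [L.+1] keeps the denominator nonzero. *)
pose ee := eta * mu S / (8 * L.+1%:R).
have ee0 : 0 < ee by rewrite divr_gt0 ?mulr_gt0.
have rside b : Reg (cone (side b)) by have [] := smeasurable_compl AS mA; case: b.
have /choice[K hK] : forall b, exists K, [/\ compact K, K `<=` side b & mu (side b `\` K) <= ee].
  move=> b; have [K cK [KA hK]] := inner_regular (@side_sphere b) (rside b) ee0.
  by exists K.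
have [cK1 K1A hK1] := hK true; have [cK2 K2A hK2] := hK false.
have dK : K true `&` K false = set0.
  by apply/seteqP; split => x // [/K1A h /K2A [_]].
have [d d0 hd] := closed_separated cK1 (compact_closed (@norm_hausdorff _ _) cK2) dK.
have [N hN] : exists N, lam ^+ N * (2 * r) < d.
  have : (fun N => lam ^+ N) @ \oo --> (0 : R) by apply: cvg_expr; rewrite ger0_norm ?ltW.
  move/cvgrPdist_lt => /(_ (d / (2 * r))) []; first by rewrite divr_gt0// mulr_gt0.
  move=> N _ /(_ N (leqnn N)); rewrite /= sub0r normrN ger0_norm ?exprn_ge0 ?ltW//.
  by rewrite ltr_pdivlMr ?mulr_gt0// => h; exists N.
pose Z := (side true `\` K true) `|` (side false `\` K false).
have ZS : Z `<=` S by move=> x [] [/side_sphere].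
have muZ : L%:R * mu Z <= eta * mu S / 4.
  apply: (@le_trans _ _ (L.+1%:R * (ee + ee))).
    apply: ler_pM; rewrite ?mu_ge0 ?ler_nat//.
    by apply: (le_trans (mu_setU _ _)); exact: lerD.
  have M0 : L.+1%:R != 0 :> R by rewrite pnatr_eq0.
  rewrite le_eqVlt; apply/orP; left; apply/eqP; rewrite /ee; move: (L.+1%:R) M0 => M M0.
  by field.
have [w [E [z [gz hz]]]] := good_cell N rr Dr S0 e0 ZS net muZ.
have [sz _ hlip _] := gz.
have [b hb] : exists b, forall x, (wact F w @` sball z r) x -> ~ K b x.
  apply: contrapT => /forallNP h; have ex b : exists x, (wact F w @` sball z r) x /\ K b x.
    by have /existsNP[x /not_implyP[h1 /contrapT h2]] := h b; exists x.
  have [x [[p hp px] Kx]] := ex true; have [y [[q hq qy] Ky]] := ex false.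
  have h1 := hd _ _ Kx Ky; have h2 := hlip _ _ hp hq; rewrite px qy in h2.
  have h3 : enorm (p - q) <= 2 * r.
    have [_ pz] := hp; have [_ qz] := hq; rewrite -(subrKA z).
    by apply: (le_trans (ler_enormD _ _)); rewrite (enorm_distC z); lra.
  have h4 := le_trans h2 (ler_wpM2l (exprn_ge0 N (ltW l0)) h3).
  by have := le_lt_trans (le_trans h1 (le_trans (mx_le_enorm _) h4)) hN; rewrite ltxx.
exists z, b; split => //.
apply: (good_invariant (ltW e0) gz (@side_sphere b) _ _ hz).
  by move=> x sx; exact: side_invariant.
by move=> x [sx /hb nK]; case: b sx nK {hb} => h1 h2; [left|right].
Qed.

(** There are finitely many pairs of a net ball and a side. If none were null, their measures would
    have a positive lower bound d, against [invariant_small] with eta chosen to make its bound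
    d/2. *)
Lemma side_null_on_ball (r : R) L (c : 'I_L -> V) : 0 < r <= r0 -> D * r <= 1 / 2 ->
  0 < mu S -> (forall z, sphere z -> exists l, enorm (z - c l) <= r / 2) ->
  exists l b, mu (side b `&` sball (c l) (r / 2)) = 0.
Proof.
move=> rr Dr S0 net; apply: contrapT => hn.
have pos l b : 0 < mu (side b `&` sball (c l) (r / 2)).
  rewrite lt_neqAle mu_ge0 andbT; apply/eqP => h; apply: hn; exists l, b; exact/esym.
have [lb|d d0 hd] := @fin_min _ _ (fun (lb : 'I_L * bool) d =>
    d <= mu (side lb.2 `&` sball (c lb.1) (r / 2))).
  by exists (mu (side lb.2 `&` sball (c lb.1) (r / 2))) => // d /andP[].
pose X := expR (D' * r `^ alpha); have X0 : 0 < X by exact: expR_gt0.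
pose eta := d / (2 * X * mu S).
have eta0 : 0 < eta by rewrite divr_gt0 ?mulr_gt0.
have [z [b [sz hz]]] := invariant_small rr Dr S0 eta0 net.
have [l hl] := net _ sz; have := hd (l, b) => /=; apply/negP; rewrite -ltNge.
apply: (@le_lt_trans _ _ (X * (eta * mu S))); last first.
  have -> : X * (eta * mu S) = d / 2.
    by rewrite /eta; field; rewrite !gt_eqF.
  lra.
apply: (le_trans _ hz); apply: mu_mono => x [sx [sx' hx]]; split => //; split => //.
by rewrite -(subrKA (c l)); apply: (le_trans (ler_enormD _ _)); rewrite (enorm_distC (c l)); lra.
Qed.

(** Each point of the side is moved into the ball by some word; there are countably many words, and
    their inverses preserve null sets. *)
Lemma side_null b p (t : R) :
  (forall x, sphere x -> exists w, enorm (wact F w x - p) <= t) ->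
  mu (side b `&` sball p t) = 0 -> mu (side b) = 0.
Proof.
move=> dense h0.
pose E (i : nat) := if unpickle i is Some w then
  wact F (winv w) @` (side b `&` sball p t) else set0 : set V.
have wS w1 x : sphere x -> sphere (wact F w1 x) by exact: wact_sphere.
have E0 i : mu (E i) = 0.
  rewrite /E; case: (unpickle i) => [w|]; last exact: mu0.
  apply: (@mu_image_null _ _ (k ^+ size (winv w))) => //.
  - exact: wS.
  - by rewrite exprn_ge0// (le_trans _ k1).
  - exact: lipS_wact.
  - by move=> x [/side_sphere].
apply/eqP; rewrite eq_le mu_ge0 andbT.
apply: (@le_trans _ _ (mu (\bigcup_i E i))); last first.
  by apply: mu_bigcup => N; rewrite big1.
apply: mu_mono => x sx; have sx' := side_sphere sx; have [w hw] := dense _ sx'.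
exists (pickle w) => //; rewrite /E pickleK; exists (wact F w x); last by rewrite wactK.
by split; [exact: side_invariant | split => //; exact: wS].
Qed.

Lemma invariant_null (r : R) L (c : 'I_L -> V) : 0 < r <= r0 -> D * r <= 1 / 2 ->
  (forall z, sphere z -> exists l, enorm (z - c l) <= r / 2) ->
  (forall l x, sphere x -> exists w, enorm (wact F w x - c l) <= r / 2) ->
  snull A \/ snull (S `\` A).
Proof.
move=> rr Dr net dense.
have [S0|S0] := eqVneq (mu S) 0.
  left; apply: mu_snull => //; apply/eqP; rewrite eq_le mu_ge0 andbT -S0; exact: mu_mono.
have {}S0 : 0 < mu S by rewrite lt_neqAle eq_sym S0 mu_ge0.
have [l [b hb]] := side_null_on_ball rr Dr S0 net.
have := side_null (dense l) hb; case: b {hb} => h; [left|right]; apply: mu_snull => //.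
Qed.

End Invariant.
End Cells.

Section Ergodic.
Context {R : realType} {n : nat}.
Local Notation V := 'cV[R]_n.+1.
Variables (J : finType) (F : J -> V -> V).
Hypothesis bF : bijF F.

Lemma orbit_word x z : sphere x -> Defs.orbit F x z -> exists w, z = wact F w x.
Proof.
move=> sx oz; apply: (oz [set z | exists w, z = wact F w x]); split; last first.
  by move=> _ ->; exists [::].
move=> i y sy; split=> [[w ->]|[w yE]]; first by exists ((i, true) :: w).
by exists ((i, false) :: w); rewrite /= -yE; exact: esym (lactK (i, true) bF sy).
Qed.

Lemma invariant_wact (A : set V) : Defs.invariant F A ->
  forall w x, sphere x -> (A (wact F w x) <-> A x).
Proof.
move=> iA w x sx; elim: w => //= l w <-; have sw := wact_sphere w bF sx.
rewrite /lact; case: l => i [] /=; first exact: iA.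
by have [s e] := sphere_invP (bF i) sw; rewrite -{2}e; exact: iff_sym (iA _ _ s).
Qed.

Lemma contracting_cover_ergodic (alpha lam rho k : R) (e : V) m
    (ws : 'I_m -> seq (J * bool)) :
  0 < alpha <= 1 -> 0 < lam < 1 -> 0 < rho -> 1 <= k ->
  (forall l, lipS k (lact F l)) ->
  (forall j, contracting lam rho e (wact F (ws j))) ->
  (forall x, sphere x -> exists j, enorm (wact F (winv (ws j)) x - e) <= rho / 4) ->
  (forall o, C1map (F o) /\ Hoelder_deriv alpha (F o)) ->
  Defs.ergodic F.
Proof.
move=> alpha01 lam01 rho0 k1 lF con cov reg A AS mA iA.
have minF := contracting_cover_minimal bF lam01 rho0 con cov.
have [l0 l1] := andP lam01; have [a0 _] := andP alpha01.
have [j|C C1 dist] := @fin_max _ _ (fun j C => distortion alpha C (wact F (ws j))).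
  have [C C0 hC] := wact_distortion alpha01 (ws j) bF k1 lF reg.
  by exists C => C' CC; exact: distortion_le hC.
have [j|Lam Lam1 lip_inv] := @fin_max _ _ (fun j K => lipS K (wact F (winv (ws j)))).
  exists (k ^+ size (winv (ws j))) => K kK x y sx sy.
  apply: (le_trans (lipS_wact (winv (ws j)) bF k1 lF sx sy)).
  by rewrite ler_wpM2r ?enorm_ge0.
have C0 : 0 < C by apply: lt_le_trans C1.
have L0 : 0 < Lam by apply: lt_le_trans Lam1.
have p1 : lam `^ alpha < 1.
  have <- : 1 `^ alpha = 1 :> R by rewrite powR1.
  by apply: gt0_ltr_powR; rewrite ?nnegrE ?(ltW l0)// ler01.
(* b / (1 - q) is the fixed point of x = b + x q; it supplies D' with q = lam^alpha and D with q =
   lam. *)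
have geo (b q : R) : q < 1 -> b + b / (1 - q) * q <= b / (1 - q).
  move=> q1; rewrite le_eqVlt; apply/orP; left; apply/eqP; field.
  by rewrite subr_eq0 eq_sym lt_eqF.
have D'_ge := geo C _ p1; set D' := C / _ in D'_ge.
pose b0 := 16 * m%:R / rho * (Lam * lam).
have b00 : 0 <= b0 by rewrite /b0 !mulr_ge0 ?invr_ge0 ?(ltW rho0) ?(ltW L0) ?(ltW l0).
have D_ge := geo b0 _ l1; set D := b0 / _ in D_ge.
have D0 : 0 <= D by rewrite divr_ge0// subr_ge0 ltW.
(* The three bounds keep balls of radius r0 in the domain of contraction and in the range of the
   distortion bound, and the half-width of the annuli below rho/8. *)
pose r0 := Num.min (rho / 2) (Num.min C^-1 (rho / 8 / (Lam * lam))).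
have r0_rho : r0 <= rho / 2 by rewrite ge_min lexx.
have r0_C : r0 <= C^-1 by rewrite !ge_min lexx orbT.
have r0_Lam : Lam * lam * r0 <= rho / 8.
  by rewrite mulrC -ler_pdivlMr ?mulr_gt0// !ge_min lexx !orbT.
have r00 : 0 < r0 by rewrite !lt_min invr_gt0 C0 !divr_gt0// mulr_gt0.
(* The second bound makes at least half of the sphere good at every depth. *)
pose r := Num.min r0 (1 / 2 / (D + 1)).
have D10 : 0 < D + 1 by rewrite ltr_wpDl.
have r1 : 0 < r by rewrite lt_min r00 !divr_gt0.
have rr : 0 < r <= r0 by rewrite r1 ge_min lexx.
have Dr : D * r <= 1 / 2.
  apply: (@le_trans _ _ (r * (D + 1))); first by rewrite mulrC ler_pM2l// lerDl.
  by rewrite -ler_pdivlMr// ge_min lexx orbT.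
have r2 : 0 < r / 2 by rewrite divr_gt0.
have [s [sS hs]] := sphere_net (@subset_refl _ (@sphere R n)) r2.
apply: (@invariant_null _ _ alpha alpha01 _ F e lam rho k m ws bF lam01 rho0 k1 lF con cov Lam C
  Lam1 lip_inv C0 dist D' D'_ge r0 D r0_rho r0_C r0_Lam D_ge A AS mA (invariant_wact iA)
  r (size s) (fun l => nth 0 s l)) => //.
- move=> z sz; have [y ys hy] := hs _ sz; have hi : (index y s < size s)%N by rewrite index_mem.
  by exists (Ordinal hi); rewrite /= nth_index.
- move=> l x sx; have sc : sphere (nth 0 s l) by apply: sS; exact: mem_nth.
  have [z [/(orbit_word sx)[w ->] hz]] := minF _ _ sx sc _ r2.
  by exists w; exact: ltW.
Qed.

End Ergodic.
Theorem mainTheorem15 (R : realType) (d k : nat) (hd : (1 <= d)%N)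
  (A : 'I_k -> 'M[R]_d.+1) (A0 : 'M[R]_d.+1) :
  (forall i, SO (A i)) -> dense_in_SO A ->
  \det A0 = 1 -> ~ SO A0 ->
  (forall alpha : R, 0 < alpha <= 1 ->
     exists eps : R, 0 < eps /\
       forall F : option 'I_k -> 'cV[R]_d.+1 -> 'cV[R]_d.+1,
         (forall o, Diff1 (F o) /\ Hoelder_deriv alpha (F o) /\
                    C1close eps (F o) (fA (gens A0 A o))) ->
         ergodic F) /\
  (exists eps : R, 0 < eps /\
     forall F : option 'I_k -> 'cV[R]_d.+1 -> 'cV[R]_d.+1,
       (forall o, Diff1 (F o) /\ C1close eps (F o) (fA (gens A0 A o))) ->
       minimal F).
Proof.
move=> SOA dA detA0 nSO; have [e [lam lam01 [rho rho0 [se [m [ws [eps eps0 key]]]]]]] :=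
  contracting_cover hd SOA dA detA0 nSO.
split; last first.
  (* Halved because C^1-closeness eps gives Lipschitz closeness 2 eps. *)
  exists (eps / 2); split; first by rewrite divr_gt0.
  move=> F hF; have nF := C1close_nb SOA detA0 hF.
  have {}nF : nb (pact A A0) eps F by apply: nb_le nF; rewrite mulrC divfK.
  have [con cov] := key _ nF.
  exact: (contracting_cover_minimal (nb_bij nF) lam01 rho0 con cov).
move=> alpha alpha01.
have [K K1 [eps' eps'0 lip]] := nb_bilip (pact_bilip SOA detA0).
(* Besides the contracting cover, ergodicity uses a common Lipschitz bound for all letters, hence a
   second threshold. *)
pose e0 := Num.min eps eps'; have e00 : 0 < e0 by rewrite lt_min eps0.
exists (e0 / 2); split; first by rewrite divr_gt0.
move=> F hF; have nF : nb (pact A A0) e0 F.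
  have -> : e0 = 2 * (e0 / 2) by rewrite mulrC divfK.
  by apply: C1close_nb => // o; have [D [_ cl]] := hF o.
have {}nF1 : nb (pact A A0) eps F by apply: nb_le nF; rewrite ge_min lexx.
have {}nF2 : nb (pact A A0) eps' F by apply: nb_le nF; rewrite ge_min lexx orbT.
have [con cov] := key _ nF1.
apply: (contracting_cover_ergodic (nb_bij nF) alpha01 lam01 rho0 K1 (lip _ nF2) con cov).
by move=> o; have [[C1 _] [H _]] := hF o.
Qed.
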